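(* Let $s>0$, $\beta=\max(0,s-1)$, let $M:[0,1)\to(0,\infty)$ be a non-decreasing continuous function, and let $$\int_0\frac1t\Bigl(\log\frac1t\Bigr)^\beta\frac{dt}{M(1-t)}=\infty .$$ Then there exist $E\in\mathcal{SU}(\mathcal{A}_s)$ and $f\in H^\infty\setminus\{0\}$ such that $$\log|f(\lambda)|\le -M(|\lambda|),\qquad \lambda\in E.$$
   Context: $\mathbb{D}$ is the open unit disc in $\mathbb{C}$, $\mathrm{Hol}(\mathbb{D})$ is the set of functions analytic in $\mathbb{D}$, and $H^\infty$ is the space of bounded analytic functions in $\mathbb{D}$. The notation $\int_0$ refers to behaviour of the integral at $0$, i.e. the integral over $(0,\delta)$ for some (equivalently any) $\delta\in(0,1)$. Convention: $\log 0=-\infty$. Spaces: for $r,s>0$, $\mathcal{A}^r_s$ is the set of all $f\in\mathrm{Hol}(\mathbb{D})$ for which there is a constant $c_f$ with $\log|f(z)|\le r\left(\log\frac{1}{1-|z|}\right)^s+c_f$ for all $z\in\mathbb{D}$; and $\mathcal{A}_s=\bigcup_{0<r<\infty}\mathcal{A}^r_s$. Uniqueness sets: for a space $X$ of analytic functions in $\mathbb{D}$, $\mathcal{U}(X)$ is the class of all $E\subset\mathbb{D}$ having no limit points in $\mathbb{D}$ such that $f\in X$, $f|_E=0$ imply $f=0$. Separation: for $s>0$ and $\beta=\max(0,s-1)$ put $\rho_s(z)=(1-|z|)\left(\log\frac1{1-|z|}\right)^{-\beta/2}$, $z\in\mathbb{D}$ (so $\rho_s(z)=1-|z|$ if $s\le1$;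 if $s>1$ the value at $z=0$ is $+\infty$). A set $E\subset\mathbb{D}$ is $s$-separated if there is $\varepsilon>0$ such that the discs $\{\zeta\in\mathbb{C}:|\zeta-\lambda|<\varepsilon\rho_s(\lambda)\}$, $\lambda\in E$, are pairwise disjoint. For $0<s\le1$ this is called hyperbolic separation. The class $\mathcal{SU}(\mathcal{A}_s)$: for $0<s<1$ it is the class of hyperbolically separated subsets $E$ of $\mathbb{D}$ with $E\in\mathcal{U}(\mathcal{A}_s)$; for $s\ge1$ it is the class of all $E\subset\mathbb{D}$ such that for every $r<\infty$ there exists an $s$-separated subset $E_r$ of $E$ with $E_r\in\mathcal{U}(\mathcal{A}^r_s)$. *)

(* Defs.v *)
From Stdlib Require Import Reals.
From Coquelicot Require Import Coquelicot.
Open Scope R_scope.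

(* Functions on the disc are total functions C -> C; only their values on the
   disc matter, and "f = 0" always means "f vanishes on the disc". *)

Definition disc (z : C) : Prop := Cmod z < 1.

Definition Hol (f : C -> C) : Prop :=
  forall z : C, disc z -> @ex_derive C_AbsRing C_NormedModule f z.

Definition zero_on_disc (f : C -> C) : Prop :=
  forall z : C, disc z -> f z = RtoC 0.

Definition Hinf (f : C -> C) : Prop :=
  Hol f /\ exists B : R, forall z : C, disc z -> Cmod (f z) <= B.

(* The library's [ln] is 0 at 0; here log 0 = -oo. *)
Definition log (x : R) : Rbar :=
  if Rlt_dec 0 x then Finite (ln x) else m_infty.

(* x ^ y for x >= 0 and y > 0; [Rpower 0 y] is 1 rather than 0. *)
Definition rpow (x y : R) : R :=
  if Rlt_dec 0 x then Rpower x y else 0.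

(* log (1 / (1 - |z|)), a nonnegative real for z in the disc *)
Definition logd (z : C) : R := ln (1 / (1 - Cmod z)).

Definition A_rs (r s : R) (f : C -> C) : Prop :=
  Hol f /\
  exists c : R, forall z : C, disc z ->
    Rbar_le (log (Cmod (f z))) (Finite (r * rpow (logd z) s + c)).

Definition A_s (s : R) (f : C -> C) : Prop :=
  exists r : R, 0 < r /\ A_rs r s f.

Definition limit_point (E : C -> Prop) (z : C) : Prop :=
  forall eps : R, 0 < eps ->
    exists w : C, E w /\ w <> z /\ Cmod (w - z)%C < eps.

Definition uniqueness_set (X : (C -> C) -> Prop) (E : C -> Prop) : Prop :=
  (forall z : C, E z -> disc z) /\
  (forall z : C, disc z -> ~ limit_point E z) /\
  (forall f : C -> C, X f -> (forall z : C, E z -> f z = RtoC 0) ->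
     zero_on_disc f).

Definition beta (s : R) : R := Rmax 0 (s - 1).

Definition rho (s : R) (z : C) : Rbar :=
  if Rle_dec s 1 then Finite (1 - Cmod z)
  else if Req_EM_T (Cmod z) 0 then p_infty
  else Finite ((1 - Cmod z) * Rpower (logd z) (- beta s / 2)).

Definition separation_disc (s eps : R) (a w : C) : Prop :=
  Rbar_lt (Finite (Cmod (w - a)%C)) (Rbar_mult (Finite eps) (rho s a)).

Definition separated (s : R) (E : C -> Prop) : Prop :=
  (forall z : C, E z -> disc z) /\
  exists eps : R, 0 < eps /\
    forall a b : C, E a -> E b -> a <> b ->
      forall w : C, ~ (separation_disc s eps a w /\ separation_disc s eps b w).

Definition SU (s : R) (E : C -> Prop) : Prop :=
  if Rlt_dec s 1 then separated s E /\ uniqueness_set (A_s s) E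
  else
    (forall z : C, E z -> disc z) /\
    forall r : R, 0 < r ->
      exists Er : C -> Prop,
        (forall z : C, Er z -> E z) /\
        separated s Er /\ uniqueness_set (A_rs r s) Er.

(* The integral of g over (0, delta) is +oo for some delta in (0, 1); meant for
   g nonnegative and continuous on (0, 1), for which the choice of delta is
   irrelevant. *)
Definition int0_infinite (g : R -> R) : Prop :=
  exists delta : R, 0 < delta < 1 /\
    filterlim (fun x : R => RInt g x delta) (at_right 0) (Rbar_locally p_infty).

(* Main.v *)
Require Import Defs.
From Stdlib Require Import Reals Lra Lia List ClassicalEpsilon ZArith.
From Coquelicot Require Import Coquelicot.
Import ListNotations.
Open Scope R_scope.

(** The set E lies over a nested family of boundary sets, each so thin that a unit mass
    spread over all of them is as dense as M requires, but not thin enough to prevent E from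
    being a uniqueness set. Stage k has arcs of length l_k = 2^(-2^(k+3)), and total length
    comparable to 1 / M_k with M_k = M (1 - l_(k+1)); the arcs of stage k + 1 sit at the
    left ends of equal cells of the arcs of stage k, so the uniform measures on the stages
    converge to a probability measure. Seen from a point over stage k whose height lies
    between the cell length and l_k, this measure has density about M_k, so its Poisson
    integral is at least M_k there (herglotz_mean_lower). Hence f = exp (- Herglotz
    integral) is bounded by 1, has no zeros, and |f| <= exp (-M) on any set of such points.

    For E take in every dyadic square at these heights a grid of about Q^2 2^(k beta)
    points, with Q = 1 if s < 1 and with all Q >= 1 together if s >= 1; for fixed Q no
    higher power of 2^k is compatible with s-separation. There are about 2^k dyadic heights
    in stage k, so the sum of 1 - |p| over the stage is about Q^2 2^(k (1 + beta)) / M_k.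
    Splitting the integral in the hypothesis at the scales l_k shows that these numbers have
    a divergent sum (sum_unbounded, kept_unbounded). Stages with M_k > 2^(k^2) cannot be
    thinned enough and receive no points; their share of the sum is finite.

    Let g in A^r_s vanish on the grids of density Q. Consider the region that, over the
    boundary points lost between stages k and k + 1, stops at height about l_(k+1)^2, and
    that stops at stage N elsewhere. In it log |g| is at most about r 2^(k s) at the points
    over stage k, which is majorized by a positive harmonic function whose value near 0 is
    about the sum of r 2^(k s) / M_k over k <= N: the cost of stage k is the length of its
    boundary set. Dividing g by the Blaschke product of these zeros up to stage N changes
    little on the boundary of the region, because this boundary is much closer to the circle
    than the zeros nearby, whereas near 0 it gains a fixed proportion of the sum of Q^2 2^(k
    (1 + beta)) / M_k. The maximum principle (uniqueness_bound) thus yields a bound for |g|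
    near 0 that tends to 0 with N: for s < 1 because 2^(k s) is negligible against 2^k, for
    s >= 1 because 1 + beta = s and Q is chosen large in terms of r. The identity theorem
    finishes the argument.

    The function theory needed for this is derived from complex differentiability alone:
    Goursat's theorem in log-polar coordinates (goursat) gives the mean value property,
    hence the maximum principle, in a form that tolerates the zeros of the Blaschke product,
    and the identity theorem. *)

(** * Complex differentiability *)

(** Increments with an explicit modulus are easier to combine than filters. *)
Definition cdiff_at (f : C -> C) (z l : C) : Prop :=
  forall eps : R, 0 < eps -> exists d : R, 0 < d /\
    forall h : C, Cmod h < d ->
      Cmod (f (z + h) - f z - l * h)%C <= eps * Cmod h.

Definition cdiff (f : C -> C) (z : C) : Prop := exists l : C, cdiff_at f z l.

Lemma ex_derive_cdiff (f : C -> C) (z : C) :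
  @ex_derive C_AbsRing C_NormedModule f z -> cdiff f z.
Proof.
  intros [l [_ Hl]]. exists l. intros eps Heps.
  specialize (Hl z (fun P H => H) (mkposreal eps Heps)).
  destruct Hl as [d Hd]. exists d. split. apply cond_pos.
  intros h Hh. specialize (Hd (z + h)%C).
  assert (Hb : @ball (AbsRing_UniformSpace C_AbsRing) z d (z + h)%C).
  { change (Cmod (z + h + - z)%C < d).
    replace (z + h + - z)%C with h by ring. exact Hh. }
  specialize (Hd Hb).
  change (Cmod ((f (z + h) + - f z) + - ((z + h + - z) * l))%C
          <= eps * Cmod (z + h + - z)%C) in Hd.
  replace (z + h + - z)%C with h in Hd by ring.
  replace (f (z + h) - f z - l * h)%C with (f (z + h) + - f z + - (h * l))%C by ring.
  exact Hd.
Qed.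

Lemma cdiff_ex_derive (f : C -> C) (z : C) :
  cdiff f z -> @ex_derive C_AbsRing C_NormedModule f z.
Proof.
  intros [l Hl]. exists l. split. apply is_linear_scal_l.
  intros x Hx.
  apply (@is_filter_lim_locally_unique C_AbsRing (AbsRing_NormedModule C_AbsRing)) in Hx.
  subst x.
  intros eps. destruct (Hl eps (cond_pos eps)) as [d [Hd H]].
  exists (mkposreal d Hd).
  assert (G : forall y : C, Cmod (y - z)%C < d ->
    Cmod ((f y + - f z) + - ((y + - z) * l))%C <= eps * Cmod (y + - z)%C).
  { intros y Hb. specialize (H _ Hb).
    replace (z + (y - z))%C with y in H by ring.
    replace (f y + - f z + - ((y + - z) * l))%C with (f y - f z - l * (y - z))%C by ring.
    exact H. }
  exact G.
Qed.

Lemma Rlt_Rmin (x a b : R) : x < Rmin a b -> x < a /\ x < b.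
Proof. apply Rmin_Rgt_l. Qed.

Lemma Rdiv_le_div (a b c d : R) : 0 <= a <= b -> 0 < d <= c -> a / c <= b / d.
Proof.
  intros Ha Hd. apply Rmult_le_compat; try lra. left; apply Rinv_0_lt_compat; lra.
  apply Rinv_le_contravar; lra.
Qed.

Lemma pow2_pos (n : nat) : 0 < 2 ^ n.
Proof. apply pow_lt. lra. Qed.

Lemma Cmod_sub_comm (x y : C) : Cmod (x - y)%C = Cmod (y - x)%C.
Proof. rewrite <- Cmod_opp. f_equal. ring. Qed.

Lemma Cmod_triangle_sub (x y : C) : Cmod (x - y)%C <= Cmod x + Cmod y.
Proof. unfold Cminus. rewrite <- (Cmod_opp y). apply Cmod_triangle. Qed.

Lemma Cmod_sub_lower (x y : C) : Cmod x - Cmod y <= Cmod (x - y)%C.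
Proof.
  replace x with ((x - y) + y)%C at 1 by ring.
  pose proof (Cmod_triangle (x - y)%C y). lra.
Qed.

Lemma Cmod_le_2Rmax (z : C) : Cmod z <= 2 * Rmax (Rabs (fst z)) (Rabs (snd z)).
Proof.
  eapply Rle_trans; [apply Cmod_2Rmax|]. apply Rmult_le_compat_r.
  eapply Rle_trans; [apply Rabs_pos|apply Rmax_l].
  rewrite <- (sqrt_square 2) at 2 by lra. apply sqrt_le_1_alt; lra.
Qed.

Lemma cdiff_const (c z : C) : cdiff (fun _ => c) z.
Proof.
  exists (RtoC 0). intros eps He. exists 1. split. lra. intros h _.
  replace (c - c - 0 * h)%C with (RtoC 0) by ring. rewrite Cmod_0.
  pose proof (Cmod_ge_0 h). nra.
Qed.

Lemma cdiff_id (z : C) : cdiff (fun x => x) z.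
Proof.
  exists (RtoC 1). intros eps He. exists 1. split. lra. intros h _.
  replace (z + h - z - 1 * h)%C with (RtoC 0) by ring. rewrite Cmod_0.
  pose proof (Cmod_ge_0 h). nra.
Qed.

Lemma cdiff_plus (f g : C -> C) (z : C) :
  cdiff f z -> cdiff g z -> cdiff (fun x => (f x + g x)%C) z.
Proof.
  intros [l Hl] [k Hk]. exists (l + k)%C. intros eps He.
  destruct (Hl (eps / 2) ltac:(lra)) as [d [Hd H]].
  destruct (Hk (eps / 2) ltac:(lra)) as [d' [Hd' H']].
  exists (Rmin d d'). split. now apply Rmin_pos. intros h Hh.
  specialize (H h (Rlt_le_trans _ _ _ Hh (Rmin_l _ _))).
  specialize (H' h (Rlt_le_trans _ _ _ Hh (Rmin_r _ _))).
  replace (f (z + h) + g (z + h) - (f z + g z) - (l + k) * h)%C with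
    ((f (z + h) - f z - l * h) + (g (z + h) - g z - k * h))%C by ring.
  eapply Rle_trans. apply Cmod_triangle. lra.
Qed.

Lemma cdiff_at_lip (f : C -> C) (z l : C) : cdiff_at f z l ->
  exists d, 0 < d /\ forall h, Cmod h < d ->
    Cmod (f (z + h) - f z)%C <= (Cmod l + 1) * Cmod h.
Proof.
  intros Hl. destruct (Hl 1 ltac:(lra)) as [d [Hd H]].
  exists d. split; auto. intros h Hh. specialize (H h Hh).
  replace (f (z + h) - f z)%C with ((f (z + h) - f z - l * h) + l * h)%C by ring.
  eapply Rle_trans. apply Cmod_triangle. rewrite Cmod_mult. lra.
Qed.

Lemma cdiff_continuous (f : C -> C) (z : C) : cdiff f z ->
  forall eps, 0 < eps -> exists d, 0 < d /\ forall y, Cmod (y - z)%C < d ->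
    Cmod (f y - f z)%C < eps.
Proof.
  intros [l Hl] eps He. destruct (cdiff_at_lip f z l Hl) as [d [Hd H]].
  pose proof (Cmod_ge_0 l) as Hl0.
  exists (Rmin d (eps / (Cmod l + 1))). split.
  { apply Rmin_pos; auto. apply Rdiv_lt_0_compat; lra. }
  intros y Hy. apply Rlt_Rmin in Hy as [Hy1 Hy2].
  replace y with (z + (y - z))%C by ring.
  eapply Rle_lt_trans. now apply H.
  apply Rmult_lt_compat_l with (r := Cmod l + 1) in Hy2; [|lra].
  replace ((Cmod l + 1) * (eps / (Cmod l + 1))) with eps in Hy2 by (field; lra).
  exact Hy2.
Qed.

Lemma cdiff_comp (f g : C -> C) (z : C) :
  cdiff g z -> cdiff f (g z) -> cdiff (fun x => f (g x)) z.
Proof.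
  intros [k Hk] [l Hl]. exists (l * k)%C. intros eps He.
  pose proof (Cmod_ge_0 l) as Hl0. pose proof (Cmod_ge_0 k) as Hk0.
  destruct (cdiff_at_lip g z k Hk) as [d1 [Hd1 H1]].
  set (e1 := eps / (2 * (Cmod k + 1))).
  assert (He1 : 0 < e1) by (apply Rdiv_lt_0_compat; lra).
  set (e2 := eps / (2 * (Cmod l + 1))).
  assert (He2 : 0 < e2) by (apply Rdiv_lt_0_compat; lra).
  destruct (Hl e1 He1) as [d2 [Hd2 H2]].
  destruct (Hk e2 He2) as [d3 [Hd3 H3]].
  exists (Rmin d1 (Rmin d3 (d2 / (Cmod k + 1)))). split.
  { repeat apply Rmin_pos; auto. apply Rdiv_lt_0_compat; lra. }
  intros h Hh.
  apply Rlt_Rmin in Hh as [Ha Hh]. apply Rlt_Rmin in Hh as [Hb Hc].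
  specialize (H1 h Ha). specialize (H3 h Hb).
  set (D := (g (z + h) - g z)%C) in *.
  assert (HD : Cmod D < d2).
  { eapply Rle_lt_trans; [exact H1|].
    apply Rmult_lt_compat_l with (r := Cmod k + 1) in Hc; [|lra].
    replace ((Cmod k + 1) * (d2 / (Cmod k + 1))) with d2 in Hc by (field; lra). lra. }
  specialize (H2 D HD).
  replace (g z + D)%C with (g (z + h)%C) in H2 by (unfold D; ring).
  replace (f (g (z + h)) - f (g z) - l * k * h)%C with
    ((f (g (z + h)) - f (g z) - l * D) + l * (D - k * h))%C by ring.
  eapply Rle_trans. apply Cmod_triangle. rewrite Cmod_mult.
  assert (E1 : e1 * Cmod D <= e1 * ((Cmod k + 1) * Cmod h)) by (apply Rmult_le_compat_l; lra).
  assert (E2 : Cmod l * Cmod (D - k * h)%C <= (Cmod l + 1) * (e2 * Cmod h)).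
  { apply Rmult_le_compat; try lra; apply Cmod_ge_0. }
  replace (e1 * ((Cmod k + 1) * Cmod h)) with (eps / 2 * Cmod h) in E1
    by (unfold e1; field; lra).
  replace ((Cmod l + 1) * (e2 * Cmod h)) with (eps / 2 * Cmod h) in E2
    by (unfold e2; field; lra).
  lra.
Qed.

Lemma cdiff_scal (c z : C) : cdiff (fun x => (c * x)%C) z.
Proof.
  exists c. intros eps He. exists 1. split. lra. intros h _.
  replace (c * (z + h) - c * z - c * h)%C with (RtoC 0) by ring. rewrite Cmod_0.
  pose proof (Cmod_ge_0 h). nra.
Qed.

Lemma cdiff_sqr (z : C) : cdiff (fun x => (x * x)%C) z.
Proof.
  exists (2 * z)%C. intros eps He. exists eps. split. lra. intros h Hh.
  replace ((z + h) * (z + h) - z * z - 2 * z * h)%C with (h * h)%C by ring.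
  rewrite Cmod_mult. pose proof (Cmod_ge_0 h). nra.
Qed.

Lemma cdiff_mult (f g : C -> C) (z : C) :
  cdiff f z -> cdiff g z -> cdiff (fun x => (f x * g x)%C) z.
Proof.
  intros Hf Hg.
  (* polarization reduces the product to squares *)
  assert (Hn : cdiff (fun x => (f x + (-1) * g x)%C) z).
  { apply (cdiff_plus f (fun x => (-1 * g x)%C)); auto.
    apply (cdiff_comp (fun y => (-1 * y)%C) g); auto. apply cdiff_scal. }
  assert (Hp := cdiff_plus f g z Hf Hg).
  assert (H1 := cdiff_comp _ _ z Hp (cdiff_sqr _)). simpl in H1.
  assert (H2 := cdiff_comp _ _ z Hn (cdiff_sqr _)). simpl in H2.
  assert (H3 := cdiff_comp (fun y => ((RtoC (1/4)) * y)%C) _ z H1 (cdiff_scal _ _)).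
  assert (H4 := cdiff_comp (fun y => ((RtoC (-1/4)) * y)%C) _ z H2 (cdiff_scal _ _)).
  destruct (cdiff_plus _ _ z H3 H4) as [l Hl]. exists l.
  intros eps He. destruct (Hl eps He) as [d [Hd H]]. exists d. split; auto.
  intros h Hh. specialize (H h Hh). simpl in H.
  match goal with |- Cmod ?a <= _ => match type of H with Cmod ?b <= _ =>
    replace a with b; [exact H|] end end.
  apply injective_projections; simpl; field.
Qed.

Lemma cdiff_Cinv (z : C) : z <> RtoC 0 -> cdiff Cinv z.
Proof.
  intros Hz. assert (Hm : 0 < Cmod z) by now apply Cmod_gt_0.
  exists (- / (z * z))%C. intros eps He.
  exists (Rmin (Cmod z / 2) (eps * (Cmod z)^3 / 2)). split.
  { apply Rmin_pos. lra. assert (0 < Cmod z ^ 3) by now apply pow_lt. nra. }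
  intros h Hh.
  apply Rlt_Rmin in Hh as [Ha Hb].
  assert (Hzh : Cmod z / 2 < Cmod (z + h)%C).
  { pose proof (Cmod_sub_lower z (- h)%C) as HH. rewrite Cmod_opp in HH.
    replace (z - - h)%C with (z + h)%C in HH by ring. lra. }
  assert (Hne : (z + h)%C <> RtoC 0) by (apply Cmod_gt_0; lra).
  replace (/ (z + h) - / z - - / (z * z) * h)%C with
    (h * h / ((z + h) * (z * z)))%C by (field; auto).
  rewrite Cmod_div by (repeat apply Cmult_neq_0; auto).
  rewrite !Cmod_mult. pose proof (Cmod_ge_0 h) as Hh0.
  apply Rle_div_l. { repeat apply Rmult_lt_0_compat; lra. }
  assert (Cmod h * Cmod h <= Cmod h * (eps * Cmod z ^ 3 / 2)) by (apply Rmult_le_compat_l; lra).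
  assert (0 <= eps * Cmod h * (Cmod z * Cmod z)) by (repeat apply Rmult_le_pos; lra).
  assert (eps * Cmod h * (Cmod z * Cmod z) * (Cmod z / 2) <=
          eps * Cmod h * (Cmod z * Cmod z) * Cmod (z + h)) by (apply Rmult_le_compat_l; lra).
  replace (eps * Cmod h * (Cmod (z + h) * (Cmod z * Cmod z))) with
   (eps * Cmod h * (Cmod z * Cmod z) * Cmod (z + h)) by ring.
  nra.
Qed.

Lemma cdiff_inv (f : C -> C) (z : C) :
  cdiff f z -> f z <> RtoC 0 -> cdiff (fun x => (/ f x)%C) z.
Proof. intros Hf Hz. apply (cdiff_comp Cinv f); auto. now apply cdiff_Cinv. Qed.

Lemma cdiff_div (f g : C -> C) (z : C) :
  cdiff f z -> cdiff g z -> g z <> RtoC 0 -> cdiff (fun x => (f x / g x)%C) z.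
Proof. intros Hf Hg Hz. apply cdiff_mult; auto. now apply cdiff_inv. Qed.

Lemma cdiff_pow (f : C -> C) (z : C) (n : nat) :
  cdiff f z -> cdiff (fun x => (f x ^ n)%C) z.
Proof.
  intros Hf. induction n; simpl. apply cdiff_const. now apply cdiff_mult.
Qed.

Lemma cdiff_sub_const (c z : C) : cdiff (fun x => (x - c)%C) z.
Proof. apply (cdiff_plus (fun x => x)). apply cdiff_id. apply cdiff_const. Qed.

Definition Cexp (z : C) : C := (exp (fst z) * cos (snd z), exp (fst z) * sin (snd z)).

Lemma Cmod_Cexp (z : C) : Cmod (Cexp z) = exp (fst z).
Proof.
  unfold Cmod, Cexp; simpl.
  replace (_ + _) with (Rsqr (exp (fst z))).
  { apply sqrt_Rsqr. left. apply exp_pos. }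
  unfold Rsqr. pose proof (sin2_cos2 (snd z)) as H. unfold Rsqr in H.
  transitivity (exp (fst z) * exp (fst z) * (sin (snd z) * sin (snd z) + cos (snd z) * cos (snd z))).
  rewrite H; ring. ring.
Qed.

Lemma Cexp_neq_0 (z : C) : Cexp z <> RtoC 0.
Proof. apply Cmod_gt_0. rewrite Cmod_Cexp. apply exp_pos. Qed.

(** The matrix with rows (p, -q), (q, p) is multiplication by p + iq. This gives the
    complex exponential its derivative. *)
Lemma cdiff_CR (U V : R -> R -> R) (x y p q : R) :
  differentiable_pt_lim U x y p (- q) -> differentiable_pt_lim V x y q p ->
  cdiff (fun z => (U (fst z) (snd z), V (fst z) (snd z))) (x, y).
Proof.
  intros HU HV. exists (p, q). intros eps He.
  assert (He2 : 0 < eps / 2) by lra.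
  destruct (HU (mkposreal _ He2)) as [d1 H1].
  destruct (HV (mkposreal _ He2)) as [d2 H2].
  exists (Rmin d1 d2). split. apply Rmin_pos; apply cond_pos.
  intros [a b] Hh. simpl.
  pose proof (Rmax_Cmod (a, b)) as Hm. simpl in Hm.
  assert (Hab : Rabs a < Rmin d1 d2 /\ Rabs b < Rmin d1 d2).
  { split; eapply Rle_lt_trans; [|exact Hh| |exact Hh];
    (eapply Rle_trans; [|exact Hm]); [apply Rmax_l|apply Rmax_r]. }
  destruct Hab as [Ha Hb].
  pose proof (Rmin_l d1 d2). pose proof (Rmin_r d1 d2).
  specialize (H1 (x + a) (y + b)). specialize (H2 (x + a) (y + b)).
  replace (x + a - x) with a in * by ring. replace (y + b - y) with b in * by ring.
  specialize (H1 ltac:(lra) ltac:(lra)). specialize (H2 ltac:(lra) ltac:(lra)).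
  simpl in H1, H2.
  match goal with |- Cmod ?e <= _ =>
    replace e with ((U (x + a) (y + b) - U x y - (p * a + - q * b),
       V (x + a) (y + b) - V x y - (q * a + p * b)) : C)
  end.
  2:{ apply injective_projections; simpl; ring. }
  set (u := U (x + a) (y + b) - U x y - (p * a + - q * b)) in *.
  set (v := V (x + a) (y + b) - V x y - (q * a + p * b)) in *.
  assert (Hs : Cmod (u, v) <= Rabs u + Rabs v).
  { replace ((u, v) : C) with (RtoC u + Ci * RtoC v)%C
      by (apply injective_projections; simpl; ring).
    eapply Rle_trans. apply Cmod_triangle.
    rewrite Cmod_mult, Cmod_Ci, !Cmod_R. lra. }
  apply (Rle_trans _ _ _ Hs). nra.
Qed.

Lemma differentiable_mul_coords (x y : R) :
  differentiable_pt_lim (fun u v => u * v) x y y x.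
Proof.
  intros eps. exists eps. intros u v Hu Hv.
  replace (u * v - x * y - (y * (u - x) + x * (v - y))) with ((u - x) * (v - y)) by ring.
  rewrite Rabs_mult.
  apply Rle_trans with (eps * Rabs (v - y)).
  apply Rmult_le_compat_r. apply Rabs_pos. lra.
  apply Rmult_le_compat_l. left; apply cond_pos. apply Rmax_r.
Qed.

Lemma differentiable_pt_lim_proj2_0 (f : R -> R) (x y l : R) :
  derivable_pt_lim f y l -> differentiable_pt_lim (fun _ v => f v) x y 0 l.
Proof.
  intros H eps. destruct (differentiable_pt_lim_proj1_0 f y x l H eps) as [d Hd].
  exists d. intros u v Hu Hv. specialize (Hd v u Hv Hu).
  rewrite Rmax_comm. replace (0 * (u - x) + l * (v - y)) with
   (l * (v - y) + 0 * (u - x)) by ring. exact Hd.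
Qed.

Lemma differentiable_tensor (f g : R -> R) (x y l m : R) :
  derivable_pt_lim f x l -> derivable_pt_lim g y m ->
  differentiable_pt_lim (fun u v => f u * g v) x y (l * g y) (f x * m).
Proof.
  intros Hf Hg.
  pose proof (differentiable_pt_lim_comp (fun u v => u * v) (fun u _ => f u) (fun _ v => g v)
    x y (g y) (f x) l 0 0 m (differentiable_mul_coords _ _)
    (differentiable_pt_lim_proj1_0 f x y l Hf)
    (differentiable_pt_lim_proj2_0 g x y m Hg)) as H.
  replace (l * g y) with (g y * l + f x * 0) by ring.
  replace (f x * m) with (g y * 0 + f x * m) by ring. exact H.
Qed.

Lemma cdiff_Cexp (z : C) : cdiff Cexp z.
Proof.
  destruct z as [x y]. unfold Cexp.
  apply (cdiff_CR (fun u v => exp u * cos v) (fun u v => exp u * sin v) x y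
    (exp x * cos y) (exp x * sin y)).
  - replace (- (exp x * sin y)) with (exp x * - sin y) by ring.
    apply differentiable_tensor. apply derivable_pt_lim_exp. apply derivable_pt_lim_cos.
  - apply differentiable_tensor. apply derivable_pt_lim_exp. apply derivable_pt_lim_sin.
Qed.

(** Multiplication by l acts on the plane through the rows (Re l, -Im l) and
    (Im l, Re l), which is how the Cauchy-Riemann equations enter. *)
Lemma cdiff_at_parts (g : C -> C) (x y : R) (l : C) : cdiff_at g (x, y) l ->
  differentiable_pt_lim (fun u v => fst (g (u, v))) x y (fst l) (- snd l) /\
  differentiable_pt_lim (fun u v => snd (g (u, v))) x y (snd l) (fst l).
Proof.
  intros H.
  assert (HH : forall eps : posreal, locally_2d (fun u v =>
    Cmod (g (u, v) - g (x, y) - l * (((u - x)%R, (v - y)%R) : C))%C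
      <= eps * Rmax (Rabs (u - x)) (Rabs (v - y))) x y).
  { intros eps.
    assert (He : 0 < eps / 2) by (pose proof (cond_pos eps); lra).
    destruct (H (eps / 2) He) as [d [Hd Hl]].
    assert (Hd2 : 0 < d / 2) by lra.
    exists (mkposreal _ Hd2). intros u v Hu Hv. simpl in Hu, Hv.
    pose proof (Cmod_le_2Rmax ((u - x, v - y) : C)) as Hm. simpl in Hm.
    assert (Hlt : Cmod ((u - x, v - y) : C) < d).
    { eapply Rle_lt_trans; [exact Hm|].
      assert (Rmax (Rabs (u - x)) (Rabs (v - y)) < d / 2) by (apply Rmax_lub_lt; auto). lra. }
    specialize (Hl _ Hlt).
    replace ((x, y) + ((u - x)%R, (v - y)%R))%C with ((u, v) : C) in Hl
      by (apply injective_projections; simpl; ring).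
    eapply Rle_trans; [exact Hl|].
    apply Rle_trans with (eps / 2 * (2 * Rmax (Rabs (u - x)) (Rabs (v - y)))).
    apply Rmult_le_compat_l; [lra|exact Hm]. lra. }
  split; intros eps; destruct (HH eps) as [d Hd]; exists d; intros u v Hu Hv;
    specialize (Hd u v Hu Hv); eapply Rle_trans; [|exact Hd| |exact Hd];
    (eapply Rle_trans; [|apply Rmax_Cmod]).
  - eapply Rle_trans; [|apply Rmax_l]. simpl. apply Req_le. f_equal. ring.
  - eapply Rle_trans; [|apply Rmax_r]. simpl. apply Req_le. f_equal. ring.
Qed.

Lemma cdiff_opp (f : C -> C) (z : C) : cdiff f z -> cdiff (fun x => (- f x)%C) z.
Proof.
  intros [l Hl]. exists (- l)%C. intros eps He.
  destruct (Hl eps He) as [d [Hd H]]. exists d. split; auto. intros h Hh.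
  replace (- f (z + h) - - f z - - l * h)%C with (- (f (z + h) - f z - l * h))%C by ring.
  rewrite Cmod_opp. auto.
Qed.

(** * Bisection and Goursat's theorem *)

Lemma nested_intervals (u : nat -> R) (d : R) : 0 <= d ->
  (forall n, u (S n) = u n \/ u (S n) = u n + d / 2 ^ (S n)) ->
  exists x, forall n, u n <= x <= u n + d / 2 ^ n.
Proof.
  intros Hd Hs.
  assert (Hp : forall n, d / 2 ^ n = 2 * (d / 2 ^ S n)).
  { intros n. simpl. field. apply pow_nonzero. lra. }
  assert (H0 : forall n, 0 <= d / 2 ^ n).
  { intros n. apply Rmult_le_pos; auto. left. apply Rinv_0_lt_compat, pow_lt. lra. }
  assert (Hst : forall n k, u n <= u (n + k)%nat /\
     u (n + k)%nat + d / 2 ^ (n + k) <= u n + d / 2 ^ n).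
  { intros n k. induction k. rewrite Nat.add_0_r. lra.
    rewrite Nat.add_succ_r. specialize (Hs (n + k)%nat). specialize (Hp (n + k)%nat).
    specialize (H0 (S (n + k))). lra. }
  assert (Hu : forall n m, u m <= u n + d / 2 ^ n).
  { intros n m. destruct (Nat.le_ge_cases n m) as [H|H].
    - pose proof (Hst n (m - n)%nat) as [_ HH]. replace (n + (m - n))%nat with m in HH by lia.
      specialize (H0 m). lra.
    - pose proof (Hst m (n - m)%nat) as [HH _]. replace (m + (n - m))%nat with n in HH by lia.
      specialize (H0 n). lra. }
  destruct (completeness (fun r => exists n, r = u n)) as [x [Hx1 Hx2]].
  - exists (u 0%nat + d / 2 ^ 0). intros r [n ->]. apply Hu.
  - exists (u 0%nat), 0%nat. reflexivity.
  - exists x. intros n. split. apply Hx1. now exists n.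
    apply Hx2. intros r [m ->]. apply Hu.
Qed.

(** The common engine of the two compactness arguments below: the vanishing of a
    circulation and the existence of a maximum. *)
Lemma bisection (P : nat -> R -> R -> Prop) (d e x0 y0 : R) : 0 <= d -> 0 <= e ->
  P 0%nat x0 y0 ->
  (forall n x y, P n x y -> exists x' y',
     (x' = x \/ x' = x + d / 2 ^ S n) /\ (y' = y \/ y' = y + e / 2 ^ S n) /\ P (S n) x' y') ->
  exists xs ys, forall n, exists x y, P n x y /\
     x <= xs <= x + d / 2 ^ n /\ y <= ys <= y + e / 2 ^ n.
Proof.
  intros Hd He H0 Hs.
  set (rel := fun n (p q : R * R) =>
    (fst q = fst p \/ fst q = fst p + d / 2 ^ S n) /\
    (snd q = snd p \/ snd q = snd p + e / 2 ^ S n) /\ P (S n) (fst q) (snd q)).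
  set (sq := fix sq n := match n with O => (x0, y0) | S k =>
     epsilon (inhabits (x0, y0)) (fun q => rel k (sq k) q) end).
  assert (HP : forall n, P n (fst (sq n)) (snd (sq n)) /\ rel n (sq n) (sq (S n))).
  { assert (Hrel : forall n, P n (fst (sq n)) (snd (sq n)) -> rel n (sq n) (sq (S n))).
    { intros n Hn. simpl. apply epsilon_spec.
      destruct (Hs n _ _ Hn) as [x' [y' H]]. exists (x', y'). exact H. }
    intros n. induction n. split; auto.
    destruct IHn as [_ [_ [_ IH]]]. split; auto. }
  destruct (nested_intervals (fun n => fst (sq n)) d Hd) as [xs Hx].
  { intros n. apply (proj1 (proj2 (HP n))). }
  destruct (nested_intervals (fun n => snd (sq n)) e He) as [ys Hy].
  { intros n. apply (proj2 (HP n)). }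
  exists xs, ys. intros n. exists (fst (sq n)), (snd (sq n)). split; auto. apply HP.
Qed.

Lemma RInt_near_const (f : R -> R) (a b c eta : R) : a <= b -> ex_RInt f a b ->
  (forall x, a <= x <= b -> Rabs (f x - c) <= eta) ->
  Rabs (RInt f a b - c * (b - a)) <= eta * (b - a).
Proof.
  intros Hab Hex Hf.
  assert (H1 : RInt (fun _ => c - eta) a b <= RInt f a b).
  { apply RInt_le; auto. apply ex_RInt_const. intros x Hx.
    specialize (Hf x ltac:(lra)). apply Rabs_le_between in Hf. lra. }
  assert (H2 : RInt f a b <= RInt (fun _ => c + eta) a b).
  { apply RInt_le; auto. apply ex_RInt_const. intros x Hx.
    specialize (Hf x ltac:(lra)). apply Rabs_le_between in Hf. lra. }
  rewrite RInt_const in H1, H2. unfold scal in H1, H2; simpl in H1, H2.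
  unfold mult in H1, H2; simpl in H1, H2.
  apply Rabs_le_between. nra.
Qed.

Lemma differentiable_continuous_fst (P : R -> R -> R) (x y p q : R) :
  differentiable_pt_lim P x y p q -> continuous (fun u => P u y) x.
Proof.
  intros H. apply continuity_pt_filterlim. apply derivable_continuous_pt.
  exists (p * 1 + q * 0).
  apply (derivable_pt_lim_comp_2d P (fun t => t) (fun _ => y) x p q 1 0).
  exact H. apply derivable_pt_lim_id. apply derivable_pt_lim_const.
Qed.

Lemma differentiable_continuous_snd (P : R -> R -> R) (x y p q : R) :
  differentiable_pt_lim P x y p q -> continuous (fun v => P x v) y.
Proof.
  intros H. apply continuity_pt_filterlim. apply derivable_continuous_pt.
  exists (p * 0 + q * 1).
  apply (derivable_pt_lim_comp_2d P (fun _ => x) (fun t => t) y p q 0 1).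
  exact H. apply derivable_pt_lim_const. apply derivable_pt_lim_id.
Qed.

(** The integral of P dx + Q dy around the rectangle, counterclockwise. *)
Definition circulation (P Q : R -> R -> R) (x y d e : R) : R :=
  RInt (fun u => P u y) x (x + d) + RInt (fun v => Q (x + d) v) y (y + e)
  - RInt (fun u => P u (y + e)) x (x + d) - RInt (fun v => Q x v) y (y + e).

(** The circulation is additive under quartering, so some quarter keeps a fourth of
    it. At the point to which the quarters shrink, the affine parts of P and Q contribute
    (Q_x - P_y) times the area, which is 0, and the remainder is o(area). Derivatives are
    only asked to exist pointwise, as for a holomorphic function. *)
Lemma goursat (P Q : R -> R -> R) (a b d e : R) : 0 <= d -> 0 <= e ->
  (forall x y, a <= x <= a + d -> b <= y <= b + e -> exists p r q,
     differentiable_pt_lim P x y p r /\ differentiable_pt_lim Q x y r q) ->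
  circulation P Q a b d e = 0.
Proof.
  intros Hd He Hdiff.
  assert (exP : forall y x x', b <= y <= b + e -> a <= x <= x' -> x' <= a + d ->
    ex_RInt (fun u => P u y) x x').
  { intros y x x' Hy Hx Hx'. apply (@ex_RInt_continuous R_CompleteNormedModule). intros z Hz.
    rewrite Rmin_left, Rmax_right in Hz by lra.
    destruct (Hdiff z y) as [p [r [q [H _]]]]; try lra.
    exact (differentiable_continuous_fst _ _ _ _ _ H). }
  assert (exQ : forall x y y', a <= x <= a + d -> b <= y <= y' -> y' <= b + e ->
    ex_RInt (fun v => Q x v) y y').
  { intros x y y' Hx Hy Hy'. apply (@ex_RInt_continuous R_CompleteNormedModule). intros z Hz.
    rewrite Rmin_left, Rmax_right in Hz by lra.
    destruct (Hdiff x z) as [p [r [q [_ H]]]]; try lra.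
    exact (differentiable_continuous_snd _ _ _ _ _ H). }
  assert (H2n : forall n, 0 < 2 ^ n) by (intros; apply pow_lt; lra).
  assert (H4n : forall n, 0 < 4 ^ n) by (intros; apply pow_lt; lra).
  set (c0 := Rabs (circulation P Q a b d e)).
  destruct (bisection (fun n x y => a <= x /\ x + d / 2 ^ n <= a + d /\
     b <= y /\ y + e / 2 ^ n <= b + e /\
     c0 / 4 ^ n <= Rabs (circulation P Q x y (d / 2 ^ n) (e / 2 ^ n))) d e a b Hd He)
    as [xs [ys Hlim]].
  { simpl. unfold Rdiv. rewrite Rinv_1, !Rmult_1_r. fold c0. lra. }
  { intros n x y (Hx & Hx' & Hy & Hy' & Hc).
    set (h := d / 2 ^ S n) in *. set (k := e / 2 ^ S n) in *.
    replace (d / 2 ^ n) with (h + h) in * by (unfold h; simpl; field; apply Rgt_not_eq, H2n).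
    replace (e / 2 ^ n) with (k + k) in * by (unfold k; simpl; field; apply Rgt_not_eq, H2n).
    assert (Hh : 0 <= h).
    { unfold h. apply Rmult_le_pos; auto. left. apply Rinv_0_lt_compat, H2n. }
    assert (Hk : 0 <= k).
    { unfold k. apply Rmult_le_pos; auto. left. apply Rinv_0_lt_compat, H2n. }
    assert (Hsum : circulation P Q x y (h + h) (k + k) =
      circulation P Q x y h k + circulation P Q (x + h) y h k +
      circulation P Q x (y + k) h k + circulation P Q (x + h) (y + k) h k).
    { unfold circulation.
      rewrite <- !(Rplus_assoc x h h), <- !(Rplus_assoc y k k).
      rewrite <- (RInt_Chasles (fun u => P u y) x (x + h) (x + h + h)) by (apply exP; lra).
      rewrite <- (RInt_Chasles (fun u => P u (y + k + k)) x (x + h) (x + h + h)) by (apply exP; lra).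
      rewrite <- (RInt_Chasles (fun v => Q x v) y (y + k) (y + k + k)) by (apply exQ; lra).
      rewrite <- (RInt_Chasles (fun v => Q (x + h + h) v) y (y + k) (y + k + k)) by (apply exQ; lra).
      unfold plus; simpl. ring. }
    rewrite Hsum in Hc.
    assert (E4 : c0 / 4 ^ n = 4 * (c0 / 4 ^ S n)) by (simpl; field; apply Rgt_not_eq, H4n).
    rewrite E4 in Hc. set (t := c0 / 4 ^ S n) in *.
    set (c1 := circulation P Q x y h k) in *. set (c2 := circulation P Q (x + h) y h k) in *.
    set (c3 := circulation P Q x (y + k) h k) in *.
    set (c4 := circulation P Q (x + h) (y + k) h k) in *.
    assert (T : Rabs (c1 + c2 + c3 + c4) <= Rabs c1 + Rabs c2 + Rabs c3 + Rabs c4).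
    { pose proof (Rabs_triang (c1 + c2 + c3) c4). pose proof (Rabs_triang (c1 + c2) c3).
      pose proof (Rabs_triang c1 c2). lra. }
    destruct (Rle_dec t (Rabs c1)). { exists x, y. repeat split; try tauto; lra. }
    destruct (Rle_dec t (Rabs c2)). { exists (x + h), y. repeat split; try tauto; lra. }
    destruct (Rle_dec t (Rabs c3)). { exists x, (y + k). repeat split; try tauto; lra. }
    exists (x + h), (y + k). apply Rnot_le_lt in n0, n1, n2. repeat split; try tauto; try lra. fold h k c4 t. lra. }
  assert (Hin : a <= xs <= a + d /\ b <= ys <= b + e).
  { destruct (Hlim 0%nat) as [x [y [(? & ? & ? & ? & ?) [? ?]]]]. lra. }
  destruct (Hdiff xs ys (proj1 Hin) (proj2 Hin)) as [p [r [q [HP HQ]]]].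
  assert (Hle : forall eps, 0 < eps -> c0 <= eps * (2 * (d + e) * (d + e))).
  { intros eps Heps.
    destruct (HP (mkposreal _ Heps)) as [d1 H1]. destruct (HQ (mkposreal _ Heps)) as [d2 H2].
    simpl in H1, H2.
    assert (Hn : exists n, (d + e) / 2 ^ n < Rmin d1 d2).
    { assert (Hm : 0 < Rmin d1 d2) by (apply Rmin_pos; apply cond_pos).
      destruct (Pow_x_infinity 2) with (b := ((d + e) / Rmin d1 d2) + 1) as [N HN].
      { rewrite Rabs_right; lra. }
      exists N. specialize (HN N (Nat.le_refl N)).
      rewrite Rabs_right in HN by (left; apply H2n).
      apply Rlt_div_l; [apply H2n|]. rewrite Rmult_comm. apply Rlt_div_l; lra. }
    destruct Hn as [n Hn].
    destruct (Hlim n) as [x [y [(Hx & Hx' & Hy & Hy' & Hc) [Hxs Hys]]]].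
    set (h := d / 2 ^ n) in *. set (k := e / 2 ^ n) in *.
    assert (Hh : 0 <= h).
    { unfold h. apply Rmult_le_pos; auto. left. apply Rinv_0_lt_compat, H2n. }
    assert (Hk : 0 <= k).
    { unfold k. apply Rmult_le_pos; auto. left. apply Rinv_0_lt_compat, H2n. }
    assert (Hhk : (d + e) / 2 ^ n = h + k) by (unfold h, k, Rdiv; ring).
    rewrite Hhk in Hn. pose proof (Rmin_l d1 d2). pose proof (Rmin_r d1 d2).
    assert (B : forall u v, x <= u <= x + h -> y <= v <= y + k ->
      Rabs (P u v - P xs ys - (p * (u - xs) + r * (v - ys))) <= eps * (h + k) /\
      Rabs (Q u v - Q xs ys - (r * (u - xs) + q * (v - ys))) <= eps * (h + k)).
    { intros u v Hu Hv.
      assert (Ru : Rabs (u - xs) <= h) by (apply Rabs_le_between; lra).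
      assert (Rv : Rabs (v - ys) <= k) by (apply Rabs_le_between; lra).
      assert (Rmax (Rabs (u - xs)) (Rabs (v - ys)) <= h + k) by (apply Rmax_lub; lra).
      specialize (H1 u v ltac:(lra) ltac:(lra)). specialize (H2 u v ltac:(lra) ltac:(lra)).
      assert (eps * Rmax (Rabs (u - xs)) (Rabs (v - ys)) <= eps * (h + k))
        by (apply Rmult_le_compat_l; lra).
      lra. }
    assert (IP : Rabs (RInt (fun u => P u y - P u (y + k)) x (x + h) - (- r * k) * (x + h - x))
       <= 2 * (eps * (h + k)) * (x + h - x)).
    { apply RInt_near_const. lra.
      apply (@ex_RInt_minus R_CompleteNormedModule); apply exP; lra.
      intros u Hu.
      pose proof (proj1 (B u y Hu ltac:(lra))) as B1.
      pose proof (proj1 (B u (y + k) Hu ltac:(lra))) as B2.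
      apply Rabs_le_between in B1, B2. apply Rabs_le_between. lra. }
    assert (IQ : Rabs (RInt (fun v => Q (x + h) v - Q x v) y (y + k) - (r * h) * (y + k - y))
       <= 2 * (eps * (h + k)) * (y + k - y)).
    { apply RInt_near_const. lra.
      apply (@ex_RInt_minus R_CompleteNormedModule); apply exQ; lra.
      intros v Hv.
      pose proof (proj2 (B x v ltac:(lra) Hv)) as B1.
      pose proof (proj2 (B (x + h) v ltac:(lra) Hv)) as B2.
      apply Rabs_le_between in B1, B2. apply Rabs_le_between. lra. }
    assert (EP : RInt (fun u => P u y - P u (y + k)) x (x + h) =
      RInt (fun u => P u y) x (x + h) - RInt (fun u => P u (y + k)) x (x + h)).
    { apply (@RInt_minus R_CompleteNormedModule (fun u => P u y) (fun u => P u (y + k)));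
       apply exP; lra. }
    assert (EQ : RInt (fun v => Q (x + h) v - Q x v) y (y + k) =
      RInt (fun v => Q (x + h) v) y (y + k) - RInt (fun v => Q x v) y (y + k)).
    { apply (@RInt_minus R_CompleteNormedModule (fun v => Q (x + h) v) (fun v => Q x v));
       apply exQ; lra. }
    assert (Hcirc : Rabs (circulation P Q x y h k) <= 2 * (eps * (h + k)) * (h + k)).
    { rewrite EP in IP. rewrite EQ in IQ. unfold circulation.
      apply Rabs_le_between in IP, IQ. apply Rabs_le_between. nra. }
    assert (c0 / 4 ^ n <= 2 * (eps * (h + k)) * (h + k)) by lra.
    apply (proj1 (Rle_div_l _ _ _ (H4n n))) in H3.
    eapply Rle_trans; [exact H3|]. rewrite <- Hhk.
    assert (E4 : 4 ^ n = 2 ^ n * 2 ^ n).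
    { rewrite <- Rpow_mult_distr. f_equal. }
    rewrite E4. apply Req_le. field. apply Rgt_not_eq, H2n. }
  assert (Hc0 : c0 <= 0).
  { apply Rnot_lt_le. intros Hlt.
    set (K := 2 * (d + e) * (d + e)) in *.
    assert (HK : 0 <= K) by (unfold K; nra).
    specialize (Hle (c0 / (2 * (K + 1))) ltac:(apply Rdiv_lt_0_compat; lra)).
    assert (c0 / (2 * (K + 1)) * K <= c0 / 2).
    { unfold Rdiv at 1. rewrite Rmult_assoc. unfold Rdiv. apply Rmult_le_compat_l. lra.
      rewrite Rmult_comm. apply Rle_div_l; lra. }
    lra. }
  pose proof (Rabs_pos (circulation P Q a b d e)). fold c0 in H.
  apply Rabs_eq_0. fold c0. lra.
Qed.

(** * The mean value property and the maximum principle *)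

(** In the coordinates z = exp (u + iv), the Cauchy-Riemann equations say that the form
    Im g du + Re g dv is closed. *)
Lemma cdiff_log_polar (g : C -> C) (u v : R) : cdiff g (Cexp (u, v)) ->
  exists p r q,
   differentiable_pt_lim (fun s t => snd (g (Cexp (s, t)))) u v p r /\
   differentiable_pt_lim (fun s t => fst (g (Cexp (s, t)))) u v r q.
Proof.
  intros [l Hl]. unfold Cexp in *. simpl in *.
  destruct (cdiff_at_parts g _ _ l Hl) as [H1 H2].
  pose proof (differentiable_tensor exp cos u v _ _ (derivable_pt_lim_exp u) (derivable_pt_lim_cos v)) as Hx.
  pose proof (differentiable_tensor exp sin u v _ _ (derivable_pt_lim_exp u) (derivable_pt_lim_sin v)) as Hy.
  pose proof (differentiable_pt_lim_comp _ _ _ u v _ _ _ _ _ _ H1 Hx Hy) as HU.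
  pose proof (differentiable_pt_lim_comp _ _ _ u v _ _ _ _ _ _ H2 Hx Hy) as HV.
  do 3 eexists. split; [exact HV|].
  match goal with |- differentiable_pt_lim _ _ _ ?a ?b =>
    match type of HU with differentiable_pt_lim _ _ _ ?c _ => replace a with c by ring end end.
  exact HU.
Qed.

(** On the rectangle [u, ln r] x [0, 2 pi] of log-polar coordinates the two sides v = 0
    and v = 2 pi cancel by periodicity, so circle means do not depend on the radius.
    Letting u tend to -oo gives the value at the centre. *)
Lemma mean_value (g : C -> C) (a : C) (r : R) : 0 < r ->
  (forall z, Cmod (z - a)%C <= r -> cdiff g z) ->
  ex_RInt (fun t => fst (g (a + Cexp (ln r, t))%C)) 0 (2 * PI) /\
  RInt (fun t => fst (g (a + Cexp (ln r, t))%C)) 0 (2 * PI) = 2 * PI * fst (g a).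
Proof.
  intros Hr Hg. pose proof PI_RGT_0 as Hpi.
  set (U := fun s t => fst (g (a + Cexp (s, t))%C)).
  set (V := fun s t => snd (g (a + Cexp (s, t))%C)).
  assert (Hd : forall s t, s <= ln r -> exists p q r0,
    differentiable_pt_lim V s t p q /\ differentiable_pt_lim U s t q r0).
  { intros s t Hs. apply (cdiff_log_polar (fun z => g (a + z)%C)).
    apply (cdiff_comp g (fun z => (a + z)%C)).
    apply (cdiff_plus (fun _ => a) (fun z => z)). apply cdiff_const. apply cdiff_id.
    apply Hg. replace (a + Cexp (s, t) - a)%C with (Cexp (s, t)) by ring.
    rewrite Cmod_Cexp. simpl. rewrite <- (exp_ln r) by auto.
    destruct Hs as [Hs| ->]. left. now apply exp_increasing. right; auto. }
  assert (Hex : forall s, s <= ln r -> ex_RInt (fun t => U s t) 0 (2 * PI)).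
  { intros s Hs. apply (@ex_RInt_continuous R_CompleteNormedModule). intros t _.
    destruct (Hd s t Hs) as [p [q [r0 [_ H]]]].
    exact (differentiable_continuous_snd _ _ _ _ _ H). }
  split. apply (Hex (ln r)). lra.
  change (RInt (fun t => U (ln r) t) 0 (2 * PI) = 2 * PI * fst (g a)).
  assert (Hconst : forall s, s <= ln r ->
    RInt (fun t => U (ln r) t) 0 (2 * PI) = RInt (fun t => U s t) 0 (2 * PI)).
  { intros s Hs.
    assert (G := goursat V U s 0 (ln r - s) (2 * PI) ltac:(lra) ltac:(lra)).
    unfold circulation in G. replace (s + (ln r - s)) with (ln r) in G by ring.
    rewrite !Rplus_0_l in G.
    assert (E : RInt (fun u => V u (2 * PI)) s (ln r) = RInt (fun u => V u 0) s (ln r)).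
    { apply RInt_ext. intros x _. unfold V, Cexp. simpl.
      now rewrite sin_2PI, cos_2PI, sin_0, cos_0. }
    rewrite E in G.
    assert (G' := G ltac:(intros x y Hx Hy; apply Hd; lra)). lra. }
  apply Rminus_diag_uniq. apply Rabs_eq_0. apply Rle_antisym; [|apply Rabs_pos].
  apply le_epsilon. intros eps He. rewrite Rplus_0_l.
  destruct (cdiff_continuous g a (Hg a ltac:(replace (a - a)%C with (RtoC 0) by ring; rewrite Cmod_0; lra))
     (eps / (2 * PI)) ltac:(apply Rdiv_lt_0_compat; lra)) as [d [Hdp Hcont]].
  set (s := Rmin (ln r) (ln (d / 2))).
  assert (Hs : s <= ln r) by apply Rmin_l.
  rewrite (Hconst s Hs).
  replace (2 * PI * fst (g a)) with (fst (g a) * (2 * PI - 0)) by ring.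
  replace eps with (eps / (2 * PI) * (2 * PI - 0)) by (field; lra).
  apply RInt_near_const; [lra|now apply Hex|]. intros t _.
  unfold U. left. eapply Rle_lt_trans; [|apply (Hcont (a + Cexp (s, t))%C)].
  - eapply Rle_trans; [|apply re_le_Cmod]. simpl. right. f_equal.
  - replace (a + Cexp (s, t) - a)%C with (Cexp (s, t)) by ring.
    rewrite Cmod_Cexp. simpl.
    assert (exp s <= d / 2).
    { rewrite <- (exp_ln (d / 2)) by lra. unfold s.
      destruct (Rmin_r (ln r) (ln (d / 2))) as [H| ->]; [left; now apply exp_increasing|right; auto]. }
    lra.
Qed.

Definition Cclosed (K : C -> Prop) : Prop :=
  forall z, ~ K z -> exists d, 0 < d /\ forall y, Cmod (y - z)%C < d -> ~ K y.

Definition Cinterior (K : C -> Prop) (z : C) : Prop :=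
  exists d, 0 < d /\ forall y, Cmod (y - z)%C < d -> K y.

(** At each bisection one keeps a quarter on which the supremum has not dropped; upper
    semicontinuity at the limit point does the rest. *)
Lemma attains_max (K : C -> Prop) (B : R) (phi : C -> R) (z0 : C) : K z0 ->
  (forall z, K z -> Cmod z <= B) -> Cclosed K ->
  (forall z, K z -> forall eps, 0 < eps -> exists d, 0 < d /\
     forall y, K y -> Cmod (y - z)%C < d -> phi y < phi z + eps) ->
  exists m, K m /\ forall z, K z -> phi z <= phi m.
Proof.
  intros Hz0 HB Hcl Husc.
  assert (HB0 : 0 <= B) by (eapply Rle_trans; [apply Cmod_ge_0|apply (HB z0 Hz0)]).
  set (s := fun n => 2 * B / 2 ^ n).
  set (sq := fun n x y (k : C) => K k /\ x <= fst k <= x + s n /\ y <= snd k <= y + s n).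
  destruct (bisection (fun n x y => forall k, K k -> exists k', sq n x y k' /\ phi k <= phi k')
     (2 * B) (2 * B) (- B) (- B)) as [xs [ys Hl]]; try lra.
  { intros k Hk. exists k. split; [|lra]. split; [exact Hk|].
    unfold s. simpl. specialize (HB k Hk). pose proof (Rmax_Cmod k) as Hm.
    pose proof (Rmax_l (Rabs (fst k)) (Rabs (snd k))). pose proof (Rmax_r (Rabs (fst k)) (Rabs (snd k))).
    assert (H1 : Rabs (fst k) <= B) by lra. assert (H2 : Rabs (snd k) <= B) by lra.
    apply Rabs_le_between in H1, H2. lra. }
  { intros n x y Hn.
    apply NNPP. intros Hno.
    assert (Hq : forall x' y', (x' = x \/ x' = x + s (S n)) -> (y' = y \/ y' = y + s (S n)) ->
      exists k, K k /\ forall k', sq (S n) x' y' k' -> phi k' < phi k).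
    { intros x' y' Hx' Hy'. apply NNPP. intros Hno2. apply Hno. exists x', y'.
      repeat split; auto. intros k Hk. apply NNPP. intros Hno3. apply Hno2.
      exists k. split; auto. intros k' Hk'. apply Rnot_le_lt. intros Hle. apply Hno3. eauto. }
    destruct (Hq x y) as [k1 [K1 F1]]; auto.
    destruct (Hq (x + s (S n)) y) as [k2 [K2 F2]]; auto.
    destruct (Hq x (y + s (S n))) as [k3 [K3 F3]]; auto.
    destruct (Hq (x + s (S n)) (y + s (S n))) as [k4 [K4 F4]]; auto.
    destruct (Hn k1 K1) as [m1 [S1 P1]]. destruct (Hn k2 K2) as [m2 [S2 P2]].
    destruct (Hn k3 K3) as [m3 [S3 P3]]. destruct (Hn k4 K4) as [m4 [S4 P4]].
    assert (Hmax : exists m, sq n x y m /\ phi k1 <= phi m /\ phi k2 <= phi m /\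
       phi k3 <= phi m /\ phi k4 <= phi m).
    { assert (Hc : forall p q, sq n x y p -> sq n x y q ->
         exists m, sq n x y m /\ phi p <= phi m /\ phi q <= phi m).
      { intros p q Hp Hq'. destruct (Rle_lt_dec (phi p) (phi q)). exists q. repeat split; try apply Hq'; lra.
        exists p. repeat split; try apply Hp; lra. }
      destruct (Hc m1 m2 S1 S2) as [a [Sa [? ?]]]. destruct (Hc m3 m4 S3 S4) as [b [Sb [? ?]]].
      destruct (Hc a b Sa Sb) as [m [Sm [? ?]]]. exists m. split; auto. lra. }
    destruct Hmax as [m [[Km [Hx Hy]] Hm]].
    assert (Hs : s n = s (S n) + s (S n)).
    { unfold s. simpl. field. apply pow_nonzero. lra. }
    rewrite Hs in Hx, Hy.
    destruct (Rle_lt_dec (fst m) (x + s (S n))); destruct (Rle_lt_dec (snd m) (y + s (S n))).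
    all: apply (Rlt_irrefl (phi m)).
    - apply Rlt_le_trans with (phi k1); [apply F1; split; auto; lra|apply Hm].
    - apply Rlt_le_trans with (phi k3); [apply F3; split; auto; lra|apply Hm].
    - apply Rlt_le_trans with (phi k2); [apply F2; split; auto; lra|apply Hm].
    - apply Rlt_le_trans with (phi k4); [apply F4; split; auto; lra|apply Hm]. }
  assert (Hclose : forall d, 0 < d -> forall k, K k -> exists k', K k' /\
     Cmod (k' - (xs, ys))%C < d /\ phi k <= phi k').
  { intros d Hd k Hk.
    assert (Hn : exists n, 2 * s n < d).
    { destruct (Pow_x_infinity 2) with (b := (4 * B / d) + 1) as [N HN].
      { rewrite Rabs_right; lra. }
      exists N. specialize (HN N (Nat.le_refl N)).
      pose proof (pow2_pos N) as H2n.
      rewrite Rabs_right in HN by (left; exact H2n).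
      unfold s. replace (2 * (2 * B / 2 ^ N)) with ((4 * B) / 2 ^ N) by (field; lra).
      apply Rlt_div_l; [exact H2n|]. rewrite (Rmult_comm d). apply Rlt_div_l; lra. }
    destruct Hn as [n Hn]. destruct (Hl n) as [x [y [HP [Hx Hy]]]].
    destruct (HP k Hk) as [k' [[Kk' [Hx' Hy']] Hphi]].
    fold (s n) in Hx, Hy.
    exists k'. repeat split; auto. eapply Rle_lt_trans; [|exact Hn].
    eapply Rle_trans; [apply Cmod_le_2Rmax|]. simpl.
    apply Rmult_le_compat_l; [lra|]. apply Rmax_lub; apply Rabs_le_between; lra. }
  assert (Km : K (xs, ys)).
  { apply NNPP. intros Hno. destruct (Hcl _ Hno) as [d [Hd H]].
    destruct (Hclose d Hd z0 Hz0) as [k' [Kk' [Hk' _]]]. exact (H k' Hk' Kk'). }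
  exists (xs, ys). split; auto. intros k Hk. apply le_epsilon. intros eps He.
  destruct (Husc _ Km eps He) as [d [Hd H]].
  destruct (Hclose d Hd k Hk) as [k' [Kk' [Hk' Hphi]]].
  specialize (H k' Kk' Hk'). lra.
Qed.

Lemma Cmod_sqr_plus (m h : C) :
  Cmod (m + h)%C ^ 2 = Cmod m ^ 2 + Cmod h ^ 2 + 2 * fst (Cconj m * h)%C.
Proof. rewrite !Cmod2_alt. unfold Re, Im. simpl. ring. Qed.

Lemma cdiff_mod_continuous (g : C -> C) (z : C) : cdiff g z ->
  forall eps, 0 < eps -> exists d, 0 < d /\ forall y, Cmod (y - z)%C < d ->
    Rabs (Cmod (g y) - Cmod (g z)) < eps.
Proof.
  intros Hg eps He. destruct (cdiff_continuous g z Hg eps He) as [d [Hd H]].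
  exists d. split; auto. intros y Hy. specialize (H y Hy).
  pose proof (Cmod_sub_lower (g y) (g z)). pose proof (Cmod_sub_lower (g z) (g y)).
  rewrite (Cmod_sub_comm (g z)) in H1. apply Rabs_lt_between. lra.
Qed.

(** Adding e |z|^2 makes |g| strictly subharmonic. At an interior maximum m choose u of
    modulus 1 with u g(m) = |g(m)|; on a small circle around m the real part of
    u g(z) + 2 e conj(m) z would then stay e r^2 below its value at m, against the mean
    value property. *)
Lemma max_principle (K : C -> Prop) (B M : R) (g : C -> C) :
  (forall z, K z -> Cmod z <= B) -> Cclosed K -> 0 <= M ->
  (forall z, K z -> cdiff g z) ->
  (forall z, K z -> Cinterior K z \/ Cmod (g z) <= M) ->
  forall z, K z -> Cmod (g z) <= M.
Proof.
  intros HB Hcl HM Hg Hbd z Hz.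
  assert (HB0 : 0 <= B) by (eapply Rle_trans; [apply Cmod_ge_0|apply (HB z Hz)]).
  cut (forall e, 0 < e -> Cmod (g z) <= M + e * (B ^ 2)).
  { intros H. apply le_epsilon. intros e He.
    assert (HB2 : 0 <= B ^ 2) by nra.
    specialize (H (e / (B ^ 2 + 1)) ltac:(apply Rdiv_lt_0_compat; lra)).
    eapply Rle_trans; [exact H|]. apply Rplus_le_compat_l.
    unfold Rdiv. rewrite Rmult_assoc. rewrite <- (Rmult_1_r e) at 2.
    apply Rmult_le_compat_l. lra. rewrite Rmult_comm. apply Rle_div_l; lra. }
  intros e He.
  destruct (attains_max K B (fun z => Cmod (g z) + e * Cmod z ^ 2) z Hz HB Hcl) as [m [Km Hm]].
  { intros y Hy eps Heps.
    assert (HY : cdiff (fun z => (z * z)%C) y) by apply cdiff_sqr.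
    destruct (cdiff_mod_continuous g y (Hg y Hy) (eps / 2) ltac:(lra)) as [d1 [Hd1 H1]].
    destruct (cdiff_mod_continuous _ y HY (eps / (2 * e)) ltac:(apply Rdiv_lt_0_compat; lra)) as [d2 [Hd2 H2]].
    exists (Rmin d1 d2). split. now apply Rmin_pos. intros x _ Hx.
    specialize (H1 x (Rlt_le_trans _ _ _ Hx (Rmin_l _ _))).
    specialize (H2 x (Rlt_le_trans _ _ _ Hx (Rmin_r _ _))).
    rewrite !Cmod_mult in H2. apply Rabs_lt_between in H1, H2.
    assert (e * (Cmod x * Cmod x - Cmod y * Cmod y) < e * (eps / (2 * e))) by (apply Rmult_lt_compat_l; lra).
    replace (e * (eps / (2 * e))) with (eps / 2) in H by (field; lra).
    simpl. lra. }
  assert (Hgm : Cmod (g m) <= M).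
  { destruct (Hbd m Km) as [[d [Hd Hint]]|]; auto.
    destruct (Rle_dec (Cmod (g m)) M) as [|Hn]; auto. exfalso.
    apply Rnot_le_lt in Hn.
    assert (Hpos : 0 < Cmod (g m)) by lra.
    set (r := d / 2). assert (Hr : 0 < r) by (unfold r; lra).
    set (u := (Cconj (g m) / RtoC (Cmod (g m)))%C).
    assert (Hne : RtoC (Cmod (g m)) <> RtoC 0).
    { intros E. apply RtoC_inj in E. lra. }
    assert (Hu : Cmod u = 1).
    { unfold u. rewrite Cmod_div, Cmod_conj, Cmod_R, Rabs_right; auto; [field; lra|lra]. }
    assert (Hug : fst (u * g m)%C = Cmod (g m)).
    { assert (E : (u * g m = RtoC (Cmod (g m)))%C).
      { unfold u. replace (Cconj (g m) / RtoC (Cmod (g m)) * g m)%C with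
          (g m * Cconj (g m) / RtoC (Cmod (g m)))%C by (field; auto).
        rewrite <- Cmod2_conj. rewrite <- RtoC_div by lra. f_equal. field. lra. }
      rewrite E. reflexivity. }
    set (G := fun z => (u * g z + RtoC (2 * e) * Cconj m * z)%C).
    assert (HG : forall z, Cmod (z - m)%C <= r -> cdiff G z).
    { intros y Hy. unfold G. apply (cdiff_plus (fun z => (u * g z)%C)).
      apply (cdiff_comp (fun x => (u * x)%C) g). apply Hg. apply Hint. unfold r in *; lra.
      apply cdiff_scal. apply cdiff_scal. }
    destruct (mean_value G m r Hr HG) as [Hex Hmean].
    assert (Hle : RInt (fun t => fst (G (m + Cexp (ln r, t))%C)) 0 (2 * PI) <=
      RInt (fun t => fst (G m) - e * r ^ 2) 0 (2 * PI)).
    { pose proof PI_RGT_0. apply RInt_le; auto. lra. apply ex_RInt_const.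
      intros t _. set (h := Cexp (ln r, t)).
      assert (Hh : Cmod h = r) by (unfold h; rewrite Cmod_Cexp; simpl; now apply exp_ln).
      assert (Kh : K (m + h)%C).
      { apply Hint. replace (m + h - m)%C with h by ring. rewrite Hh. unfold r; lra. }
      specialize (Hm _ Kh). rewrite Cmod_sqr_plus, Hh in Hm.
      assert (Hre : fst (u * g (m + h))%C <= Cmod (g (m + h)%C)).
      { eapply Rle_trans; [apply Rle_abs|]. eapply Rle_trans; [apply re_le_Cmod|].
        rewrite Cmod_mult, Hu. lra. }
      assert (EG : forall x, fst (G x) = fst (u * g x)%C + 2 * e * fst (Cconj m * x)%C).
      { intros x. unfold G. simpl. ring. }
      rewrite !EG, Hug.
      assert (Em : fst (Cconj m * (m + h))%C = fst (Cconj m * m)%C + fst (Cconj m * h)%C)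
        by (simpl; ring).
      rewrite Em. nra. }
    rewrite Hmean, RInt_const in Hle. unfold scal in Hle; simpl in Hle. unfold mult in Hle; simpl in Hle.
    pose proof PI_RGT_0. assert (0 < e * (r * r)) by (repeat apply Rmult_lt_0_compat; lra). nra. }
  pose proof (Hm z Hz) as H1. simpl in H1.
  pose proof (HB m Km). pose proof (Cmod_ge_0 m). pose proof (Cmod_ge_0 z).
  assert (Cmod m * (Cmod m * 1) <= B * (B * 1)) by nra.
  assert (e * (Cmod m * (Cmod m * 1)) <= e * (B * (B * 1))) by (apply Rmult_le_compat_l; lra).
  assert (0 <= e * (Cmod z * (Cmod z * 1))) by (apply Rmult_le_pos; nra).
  simpl. lra.
Qed.

Fixpoint Cprod {T : Type} (F : T -> C) (l : list T) : C :=
  match l with [] => RtoC 1 | x :: l' => (F x * Cprod F l')%C end.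

Lemma cdiff_Cprod {T : Type} (F : T -> C -> C) (l : list T) (z : C) :
  (forall x, In x l -> cdiff (F x) z) -> cdiff (fun y => Cprod (fun x => F x y) l) z.
Proof.
  induction l as [|x l IH]; intros H; simpl. apply cdiff_const.
  apply cdiff_mult. apply H; now left. apply IH. intros y Hy. apply H; now right.
Qed.

Lemma Cprod_zero {T : Type} (F : T -> C) (l : list T) (x : T) :
  In x l -> F x = RtoC 0 -> Cprod F l = RtoC 0.
Proof.
  induction l as [|y l IH]; simpl; intros [].
  - subst. intros ->. ring.
  - intros E. rewrite IH; auto. ring.
Qed.

Lemma Cprod_neq_0 {T : Type} (F : T -> C) (l : list T) :
  (forall x, In x l -> F x <> RtoC 0) -> Cprod F l <> RtoC 0.
Proof.
  induction l as [|y l IH]; simpl; intros H. exact C1_nz.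
  apply Cmult_neq_0; auto.
Qed.

Lemma Cmod_Cprod_le {T : Type} (F : T -> C) (g : T -> R) (l : list T) :
  (forall x, In x l -> Cmod (F x) <= exp (g x)) ->
  Cmod (Cprod F l) <= exp (fold_right Rplus 0 (map g l)).
Proof.
  induction l as [|y l IH]; simpl; intros H. rewrite Cmod_1, exp_0; lra.
  rewrite Cmod_mult, exp_plus. apply Rmult_le_compat; auto; apply Cmod_ge_0.
Qed.

Lemma Cmod_Cprod_ge {T : Type} (F : T -> C) (g : T -> R) (l : list T) :
  (forall x, In x l -> exp (g x) <= Cmod (F x)) ->
  exp (fold_right Rplus 0 (map g l)) <= Cmod (Cprod F l).
Proof.
  induction l as [|y l IH]; simpl; intros H. rewrite Cmod_1, exp_0; lra.
  rewrite Cmod_mult, exp_plus. apply Rmult_le_compat; auto; left; apply exp_pos.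
Qed.

Lemma le_of_pow_le (x M c d : R) : 0 <= M -> 0 < d -> 0 <= x ->
  (forall n, x ^ n * d <= M ^ n * c) -> x <= M.
Proof.
  intros HM Hd Hx H. apply Rnot_lt_le. intros Hlt.
  assert (Hx0 : 0 < x) by lra.
  destruct (Req_dec M 0) as [->|HM0].
  - specialize (H 1%nat). simpl in H. nra.
  - assert (HMp : 0 < M) by lra.
    assert (Hq : 1 < x / M) by (apply Rlt_div_r; lra).
    destruct (Pow_x_infinity (x / M)) with (b := c / d + 1) as [N HN].
    { rewrite Rabs_right; lra. }
    specialize (HN N (Nat.le_refl N)).
    rewrite Rabs_right in HN by (left; apply pow_lt; lra).
    specialize (H N).
    assert (HMN : 0 < M ^ N) by now apply pow_lt.
    assert (E : x ^ N = M ^ N * (x / M) ^ N).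
    { rewrite <- Rpow_mult_distr. f_equal. field. lra. }
    rewrite E in H. rewrite Rmult_assoc in H.
    apply Rmult_le_reg_l in H; auto.
    assert (c < (x / M) ^ N * d). { apply Rlt_div_l; lra. } lra.
Qed.

(** At a point p where phi is only locally bounded, phi^n times the square of a
    polynomial vanishing at p is differentiable with derivative 0. The maximum principle
    bounds these products, and taking n-th roots removes the polynomial as n grows. *)
Lemma max_principle_except (K : C -> Prop) (M : R) (phi : C -> C) (L : list C) :
  (forall z, K z -> Cmod z <= 1) -> Cclosed K -> 0 <= M ->
  (forall p, In p L -> Cmod p <= 1) ->
  (forall z, K z -> ~ In z L -> cdiff phi z) ->
  (forall p, In p L -> exists d A, 0 < d /\
     forall h, Cmod h < d -> h <> RtoC 0 -> Cmod (phi (p + h)%C) <= A) ->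
  (forall z, K z -> Cinterior K z \/ (~ In z L /\ Cmod (phi z) <= M)) ->
  forall z, K z -> ~ In z L -> Cmod (phi z) <= M.
Proof.
  intros HB Hcl HM HL Hd Hlb Hbd z Kz Hz.
  set (P := fun y => Cprod (fun p => (y - p)%C) L).
  assert (HPd : forall y, cdiff P y).
  { intros y. apply (cdiff_Cprod (fun p y => (y - p)%C)). intros. apply cdiff_sub_const. }
  set (A := fold_right Rplus 0 (map (fun _ : C => ln 2) L)).
  assert (HPle : forall y, K y -> Cmod (P y) <= exp A).
  { intros y Ky. apply Cmod_Cprod_le. intros p Hp. rewrite exp_ln by lra.
    eapply Rle_trans; [apply Cmod_triangle_sub|]. specialize (HB y Ky). specialize (HL p Hp). lra. }
  assert (HPz : 0 < Cmod (P z)).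
  { apply Cmod_gt_0. apply Cprod_neq_0. intros p Hp E. apply Hz.
    replace z with p; auto. transitivity (p + (z - p))%C. rewrite E. ring. ring. }
  apply (le_of_pow_le _ M (exp A ^ 2) (Cmod (P z) ^ 2)); auto.
  now apply pow_lt. apply Cmod_ge_0.
  intros n.
  set (psi := fun y => (phi y ^ n * (P y * P y))%C).
  replace (Cmod (phi z) ^ n * Cmod (P z) ^ 2) with (Cmod (psi z)).
  2:{ unfold psi. rewrite !Cmod_mult, Cmod_pow. ring. }
  assert (He : 0 < exp A) by apply exp_pos.
  assert (HMn : 0 <= M ^ n) by now apply pow_le.
  apply (max_principle K 1); auto.
  { apply Rmult_le_pos; auto. simpl. nra. }
  - intros y Ky. destruct (excluded_middle_informative (In y L)) as [Hy|Hy].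
    + destruct (Hlb y Hy) as [d [A' [Hdp Hbnd]]].
      destruct (HPd y) as [l Hl]. destruct (cdiff_at_lip P y l Hl) as [d' [Hd' Hlip]].
      assert (HP0 : P y = RtoC 0).
      { apply Cprod_zero with (x := y); auto. ring. }
      assert (Hpsi0 : psi y = RtoC 0) by (unfold psi; rewrite HP0; ring).
      exists (RtoC 0). intros eps Heps.
      set (k := Rmax A' 0 ^ n * (Cmod l + 1) ^ 2).
      assert (HA0 : 0 <= Rmax A' 0) by apply Rmax_r.
      assert (Hk : 0 <= k).
      { apply Rmult_le_pos. now apply pow_le. apply pow_le. pose proof (Cmod_ge_0 l). lra. }
      exists (Rmin (Rmin d d') (eps / (k + 1))). split.
      { repeat apply Rmin_pos; auto. apply Rdiv_lt_0_compat; lra. }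
      intros h Hh.
      apply Rlt_Rmin in Hh as [Hh Hh3]. apply Rlt_Rmin in Hh as [Hh1 Hh2].
      rewrite Hpsi0. replace (psi (y + h) - 0 - 0 * h)%C with (psi (y + h)%C) by ring.
      destruct (excluded_middle_informative (h = RtoC 0)) as [->|Hh0].
      { replace (y + 0)%C with y by ring. rewrite Hpsi0, Cmod_0. lra. }
      specialize (Hbnd h Hh1 Hh0). specialize (Hlip h Hh2).
      rewrite HP0 in Hlip. replace (P (y + h) - 0)%C with (P (y + h)%C) in Hlip by ring.
      unfold psi. rewrite !Cmod_mult, Cmod_pow.
      assert (E1 : Cmod (phi (y + h)%C) ^ n <= Rmax A' 0 ^ n).
      { apply pow_incr. split. apply Cmod_ge_0. eapply Rle_trans; [exact Hbnd|apply Rmax_l]. }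
      assert (E2 : Cmod (P (y + h)%C) * Cmod (P (y + h)%C) <=
         ((Cmod l + 1) * Cmod h) * ((Cmod l + 1) * Cmod h)).
      { apply Rmult_le_compat; auto; apply Cmod_ge_0. }
      apply Rle_trans with (Rmax A' 0 ^ n * (((Cmod l + 1) * Cmod h) * ((Cmod l + 1) * Cmod h))).
      { apply Rmult_le_compat; auto. apply pow_le, Cmod_ge_0.
        apply Rmult_le_pos; apply Cmod_ge_0. }
      replace (Rmax A' 0 ^ n * (((Cmod l + 1) * Cmod h) * ((Cmod l + 1) * Cmod h)))
        with (k * Cmod h * Cmod h) by (unfold k; ring).
      apply Rmult_le_compat_r. apply Cmod_ge_0.
      apply Rlt_div_r in Hh3; [|lra]. pose proof (Cmod_ge_0 h). nra.
    + unfold psi. apply cdiff_mult. apply cdiff_pow. now apply Hd.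
      apply cdiff_mult; apply HPd.
  - intros y Ky. destruct (Hbd y Ky) as [H|[Hy Hle]]; [now left|right].
    unfold psi. rewrite !Cmod_mult, Cmod_pow. specialize (HPle y Ky).
    apply Rmult_le_compat. apply pow_le, Cmod_ge_0.
    apply Rmult_le_pos; apply Cmod_ge_0.
    apply pow_incr. split; auto. apply Cmod_ge_0.
    simpl. rewrite Rmult_1_r. apply Rmult_le_compat; auto; apply Cmod_ge_0.
Qed.

Lemma Cclosed_ball (r : R) : Cclosed (fun z => Cmod z <= r).
Proof.
  intros z Hz. apply Rnot_le_lt in Hz. exists (Cmod z - r). split. lra.
  intros y Hy Hle. pose proof (Cmod_sub_lower z y). rewrite Cmod_sub_comm in H. lra.
Qed.

(** Since f vanishes near 0, f(z) / z^n is differentiable in the whole disc for every n,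
    and the maximum principle bounds |f(a)| by B (|a| / r)^n with r > |a|. *)
Lemma identity_theorem (f : C -> C) (delta : R) : 0 < delta ->
  (forall z, Defs.disc z -> cdiff f z) ->
  (forall z, Cmod z < delta -> f z = RtoC 0) -> zero_on_disc f.
Proof.
  intros Hdel Hf H0 a Ha. unfold Defs.disc in Ha.
  set (r := (1 + Cmod a) / 2). pose proof (Cmod_ge_0 a) as Ha0.
  assert (Hr : 0 < r /\ Cmod a < r < 1) by (unfold r; lra).
  set (K := fun z => Cmod z <= r).
  assert (HK : forall z, K z -> Defs.disc z) by (intros z Hz; unfold K, Defs.disc in *; lra).
  destruct (attains_max K r (fun z => Cmod (f z)) (RtoC 0)) as [m [_ Hm]].
  { unfold K. rewrite Cmod_0. lra. }
  { auto. }
  { apply Cclosed_ball. }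
  { intros z Hz eps Heps. destruct (cdiff_mod_continuous f z (Hf z (HK z Hz)) eps Heps) as [d [Hd H]].
    exists d. split; auto. intros y _ Hy. specialize (H y Hy). apply Rabs_lt_between in H. lra. }
  set (B := Cmod (f m)) in *.
  assert (HB : 0 <= B) by apply Cmod_ge_0.
  assert (Ha1 : a <> RtoC 0 -> f a = RtoC 0).
  { intros Hane. assert (Hap : 0 < Cmod a) by now apply Cmod_gt_0.
    assert (Hn : forall n, Cmod (f a) * r ^ n <= B * Cmod a ^ n).
    { intros n.
      assert (Hq : Cmod (f a / a ^ n)%C <= B / r ^ n).
      { apply (max_principle K r (B / r ^ n) (fun z => (f z / z ^ n)%C)); auto.
        - apply Cclosed_ball.
        - apply Rmult_le_pos; auto. left. apply Rinv_0_lt_compat, pow_lt. lra.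
        - intros z Hz. destruct (excluded_middle_informative (z = RtoC 0)) as [->|Hz0].
          + exists (RtoC 0). intros eps Heps. exists delta. split; auto. intros h Hh.
            rewrite (H0 0%C) by (rewrite Cmod_0; lra).
            rewrite (H0 (0 + h)%C) by (rewrite Cplus_0_l; auto).
            unfold Cdiv. rewrite !Cmult_0_l.
            replace (0 - 0 - 0)%C with (RtoC 0) by ring. rewrite Cmod_0.
            pose proof (Cmod_ge_0 h). nra.
          + apply cdiff_div. apply Hf; auto. apply cdiff_pow, cdiff_id. now apply Cpow_nz.
        - intros z Hz. destruct (Rlt_dec (Cmod z) r) as [Hlt|Hge].
          + left. exists (r - Cmod z). split. lra. intros y Hy. unfold K.
            pose proof (Cmod_sub_lower y z). lra.
          + right. assert (Ez : Cmod z = r) by (unfold K in Hz; lra).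
            rewrite Cmod_div, Cmod_pow, Ez.
            apply Rmult_le_compat_r. left. apply Rinv_0_lt_compat, pow_lt. lra. now apply Hm.
            apply Cpow_nz. apply Cmod_gt_0. lra.
        - unfold K. lra. }
      rewrite Cmod_div, Cmod_pow in Hq by now apply Cpow_nz.
      assert (Hrn : 0 < r ^ n) by (apply pow_lt; lra). assert (Han : 0 < Cmod a ^ n) by now apply pow_lt.
      apply (proj1 (Rle_div_l _ _ _ Han)) in Hq.
      replace (B / r ^ n * Cmod a ^ n) with (B * Cmod a ^ n / r ^ n) in Hq by (field; lra).
      apply (proj2 (Rle_div_r _ _ _ Hrn)) in Hq. exact Hq. }
    apply Cmod_eq_0. apply Rle_antisym; [|apply Cmod_ge_0]. apply Rnot_lt_le. intros Hpos.
    assert (Hle : r <= Cmod a).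
    { apply (le_of_pow_le r (Cmod a) B (Cmod (f a))); auto; try lra.
      intros n. specialize (Hn n). lra. }
    lra. }
  destruct (excluded_middle_informative (a = RtoC 0)) as [->|Hne]; auto.
  apply H0. rewrite Cmod_0. auto.
Qed.

(** * Finite sums and a rational parametrization of the circle *)

Definition lsum {T : Type} (F : T -> R) (l : list T) : R := fold_right Rplus 0 (map F l).

Lemma lsum_app {T : Type} (F : T -> R) (l l' : list T) :
  lsum F (l ++ l') = lsum F l + lsum F l'.
Proof. unfold lsum. induction l; simpl; lra. Qed.

Lemma lsum_flat_map {T S : Type} (F : S -> R) (g : T -> list S) (l : list T) :
  lsum F (flat_map g l) = lsum (fun x => lsum F (g x)) l.
Proof. induction l; simpl. reflexivity. rewrite lsum_app, IHl. reflexivity. Qed.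

Lemma lsum_map {T S : Type} (F : S -> R) (g : T -> S) (l : list T) :
  lsum F (map g l) = lsum (fun x => F (g x)) l.
Proof. unfold lsum. now rewrite map_map. Qed.

Lemma lsum_const {T : Type} (c : R) (l : list T) : lsum (fun _ => c) l = INR (length l) * c.
Proof.
  induction l; unfold lsum in *. simpl; ring.
  change (length (a :: l)) with (S (length l)). rewrite S_INR. simpl. lra.
Qed.

Lemma lsum_le {T : Type} (F G : T -> R) (l : list T) :
  (forall x, In x l -> F x <= G x) -> lsum F l <= lsum G l.
Proof.
  unfold lsum. induction l; simpl; intros H. lra.
  pose proof (H a (or_introl eq_refl)). specialize (IHl (fun x Hx => H x (or_intror Hx))). lra.
Qed.

Lemma lsum_ext {T : Type} (F G : T -> R) (l : list T) :
  (forall x, In x l -> F x = G x) -> lsum F l = lsum G l.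
Proof. intros H. apply Rle_antisym; apply lsum_le; intros x Hx; rewrite (H x Hx); lra. Qed.

Lemma lsum_scal {T : Type} (c : R) (F : T -> R) (l : list T) :
  lsum (fun x => c * F x) l = c * lsum F l.
Proof. unfold lsum. induction l; simpl. ring. lra. Qed.

Lemma lsum_nonneg {T : Type} (F : T -> R) (l : list T) :
  (forall x, In x l -> 0 <= F x) -> 0 <= lsum F l.
Proof.
  unfold lsum. induction l; simpl; intros H. lra.
  pose proof (H a (or_introl eq_refl)). specialize (IHl (fun x Hx => H x (or_intror Hx))). lra.
Qed.

(** The Cayley parametrization: chord lengths are algebraic in the parameter and, on
    [0, 1], comparable to parameter differences, which keeps trigonometry out of the
    estimates. *)
Definition circ (x : R) : C := ((1 - x ^ 2) / (1 + x ^ 2), 2 * x / (1 + x ^ 2)).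

Lemma Cmod_eq_sqr (z : C) (r : R) : 0 <= r -> Cmod z ^ 2 = r ^ 2 -> Cmod z = r.
Proof.
  intros Hr H. rewrite <- !Rsqr_pow2 in H. apply Rsqr_inj; auto. apply Cmod_ge_0.
Qed.

Lemma Cmod_circ (x : R) : Cmod (circ x) = 1.
Proof.
  apply Cmod_eq_sqr; [lra|]. rewrite Cmod2_alt. unfold circ, Re, Im. simpl. field. nra.
Qed.

Lemma circ_dist (x y : R) :
  Cmod (circ x - circ y)%C ^ 2 = 4 * (x - y) ^ 2 / ((1 + x ^ 2) * (1 + y ^ 2)).
Proof.
  rewrite Cmod2_alt. unfold circ, Re, Im. simpl. field. split; nra.
Qed.

Lemma circ_dist_le (x y : R) : Cmod (circ x - circ y)%C <= 2 * Rabs (x - y).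
Proof.
  apply Rsqr_incr_0_var; [|pose proof (Rabs_pos (x - y)); lra].
  rewrite !Rsqr_pow2, circ_dist, Rpow_mult_distr, pow2_abs.
  pose proof (pow2_ge_0 (x - y)) as H1. pose proof (pow2_ge_0 x) as H2.
  pose proof (pow2_ge_0 y) as H3.
  set (a := (x - y) ^ 2) in *. set (b := x ^ 2) in *. set (c := y ^ 2) in *.
  assert (H4 : 1 <= (1 + b) * (1 + c)) by nra.
  set (d := (1 + b) * (1 + c)) in *.
  apply Rle_div_l; [lra|]. replace (2 ^ 2 * a * d) with (4 * a * d) by ring. nra.
Qed.

Lemma circ_dist_ge (x y : R) : 0 <= x <= 1 -> 0 <= y <= 1 ->
  Rabs (x - y) <= Cmod (circ x - circ y)%C.
Proof.
  intros Hx Hy. apply Rsqr_incr_0_var; [|apply Cmod_ge_0].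
  rewrite !Rsqr_pow2, circ_dist, pow2_abs.
  pose proof (pow2_ge_0 (x - y)) as H1. assert (H2 : 0 <= x ^ 2 <= 1) by nra.
  assert (H3 : 0 <= y ^ 2 <= 1) by nra.
  set (a := (x - y) ^ 2) in *. set (b := x ^ 2) in *. set (c := y ^ 2) in *.
  assert (H4 : (1 + b) * (1 + c) <= 4) by nra.
  assert (H5 : 1 <= (1 + b) * (1 + c)) by nra.
  set (d := (1 + b) * (1 + c)) in *.
  apply (Rle_div_r a (4 * a) d); [lra|]. nra.
Qed.

Lemma INR_ge_1 (n : nat) : (1 <= n)%nat -> 1 <= INR n.
Proof. apply (le_INR 1). Qed.

Lemma INR_lt_succ (u v : nat) : (u < v)%nat -> INR u + 1 <= INR v.
Proof. intros H. rewrite <- S_INR. now apply le_INR. Qed.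

Lemma INR_apart (u v : nat) : u <> v -> 1 <= Rabs (INR u - INR v).
Proof.
  intros H. destruct (Nat.lt_gt_cases u v) as [[Hl|Hl] _]; auto; apply INR_lt_succ in Hl.
  rewrite Rabs_left1; lra. rewrite Rabs_right; lra.
Qed.

(** * Nested boundary sets *)

Definition children (m : nat -> nat) (l : nat -> R) (k : nat) (x : R) : list R :=
  map (fun u => x + INR u * (l k / INR (m k))) (seq 0 (m k)).

Fixpoint desc (m : nat -> nat) (l : nat -> R) (k j : nat) (x : R) : list R :=
  match j with
  | O => [x]
  | S i => flat_map (children m l (k + i)) (desc m l k i x)
  end.

(** The arcs [x, x + l k] with x in gen m l k make up the k-th boundary set; each is cut
    into m k equal cells, and the next set keeps an arc of length l (S k) at the left end
    of every cell. *)
Definition gen (m : nat -> nat) (l : nat -> R) (k : nat) : list R := desc m l 0 k 0.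

Record tree (m : nat -> nat) (l : nat -> R) : Prop := {
  tree_m : forall k, (1 <= m k)%nat;
  tree_pos : forall k, 0 < l k;
  tree_step : forall k, INR (m k) * l (S k) <= l k;
  tree_l0 : l 0%nat <= 1 / 8 }.

Lemma flat_map_flat_map {X Y W : Type} (f : Y -> list W) (g : X -> list Y) (s : list X) :
  flat_map f (flat_map g s) = flat_map (fun x => flat_map f (g x)) s.
Proof. induction s; simpl; auto. now rewrite flat_map_app, IHs. Qed.

(** Descent composes, so that sums over a late generation can be grouped by the
    ancestors in an earlier one. *)
Lemma desc_add (m : nat -> nat) (l : nat -> R) (k i j : nat) (x : R) :
  desc m l k (i + j) x = flat_map (desc m l (k + i) j) (desc m l k i x).
Proof.
  induction j.
  - rewrite Nat.add_0_r. simpl. induction (desc m l k i x); simpl; auto. now f_equal.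
  - rewrite Nat.add_succ_r. simpl. rewrite IHj, flat_map_flat_map.
    now rewrite Nat.add_assoc.
Qed.

Lemma gen_add (m : nat -> nat) (l : nat -> R) (k j : nat) :
  gen m l (k + j) = flat_map (desc m l k j) (gen m l k).
Proof. apply desc_add. Qed.

Lemma length_children (m : nat -> nat) (l : nat -> R) (k : nat) (x : R) :
  length (children m l k x) = m k.
Proof. unfold children. now rewrite length_map, length_seq. Qed.

Lemma length_flat_map_const {X Y : Type} (g : X -> list Y) (n : nat) (s : list X) :
  (forall x, length (g x) = n) -> length (flat_map g s) = (length s * n)%nat.
Proof. intros H. induction s; simpl; auto. now rewrite length_app, H, IHs. Qed.

Fixpoint nprod (m : nat -> nat) (k j : nat) : nat :=
  match j with O => 1%nat | S i => (nprod m k i * m (k + i))%nat end.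

Lemma length_desc (m : nat -> nat) (l : nat -> R) (k j : nat) (x : R) :
  length (desc m l k j x) = nprod m k j.
Proof.
  induction j; simpl; auto.
  rewrite (length_flat_map_const _ (m (k + j)%nat)), IHj; auto.
  intros. apply length_children.
Qed.

Section Tree.
Variables (m : nat -> nat) (l : nat -> R) (HT : tree m l).

Lemma tree_m_INR (k : nat) : 1 <= INR (m k).
Proof. apply INR_ge_1, (tree_m _ _ HT). Qed.

Lemma tree_gap (k : nat) : l (S k) <= l k / INR (m k).
Proof.
  pose proof (tree_m_INR k). apply Rle_div_r; [lra|].
  rewrite Rmult_comm. apply (tree_step _ _ HT).
Qed.

Lemma tree_gap_le (k : nat) : l k / INR (m k) <= l k.
Proof.
  pose proof (tree_m_INR k). pose proof (tree_pos _ _ HT k).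
  apply Rle_div_l; [lra|]. nra.
Qed.

Lemma tree_decr (j k : nat) : (j <= k)%nat -> l k <= l j.
Proof.
  induction 1 as [|i _ IH]. lra. pose proof (tree_gap i). pose proof (tree_gap_le i). lra.
Qed.

Lemma tree_le (k : nat) : l k <= 1 / 8.
Proof. pose proof (tree_decr 0 k ltac:(lia)). pose proof (tree_l0 _ _ HT). lra. Qed.

Lemma in_children (k : nat) (x y : R) : In y (children m l k x) ->
  exists u, (u < m k)%nat /\ y = x + INR u * (l k / INR (m k)).
Proof.
  intros H. apply in_map_iff in H. destruct H as [u [<- Hu]]. apply in_seq in Hu.
  exists u. split; auto. lia.
Qed.

Lemma child_range (k : nat) (x y : R) : In y (children m l k x) ->
  x <= y <= x + l k - l k / INR (m k).
Proof.
  intros H. destruct (in_children k x y H) as [u [Hu ->]].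
  pose proof (tree_m_INR k). pose proof (tree_pos _ _ HT k). pose proof (pos_INR u).
  set (g := l k / INR (m k)).
  assert (Hg : 0 < g) by (apply Rdiv_lt_0_compat; lra).
  assert (E : l k = INR (m k) * g) by (unfold g; field; lra).
  assert (INR u + 1 <= INR (m k)) by (apply INR_lt_succ; lia).
  split. nra. rewrite E. nra.
Qed.

Lemma desc_range (k j : nat) (x y : R) : In y (desc m l k j x) ->
  x <= y <= x + l k - l (k + j)%nat.
Proof.
  revert y. induction j; intros y; simpl.
  - intros [->|[]]. rewrite Nat.add_0_r. lra.
  - intros H. apply in_flat_map in H. destruct H as [y' [H1 H2]].
    specialize (IHj y' H1). apply child_range in H2. rewrite Nat.add_succ_r.
    pose proof (tree_gap (k + j)). lra.
Qed.

Lemma gen_range (k : nat) (x : R) : In x (gen m l k) -> 0 <= x /\ x + l k <= 1 / 8.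
Proof.
  intros H. apply desc_range in H. simpl in H. pose proof (tree_l0 _ _ HT). lra.
Qed.

Lemma gen_ancestor (k j : nat) (x : R) : (k <= j)%nat -> In x (gen m l j) ->
  exists y, In y (gen m l k) /\ y <= x <= y + l k - l j.
Proof.
  intros Hkj H. replace j with (k + (j - k))%nat in * by lia.
  rewrite gen_add in H. apply in_flat_map in H. destruct H as [y [Hy Hx]].
  exists y. split; auto. now apply desc_range in Hx.
Qed.

Lemma gen_length (k : nat) : length (gen m l k) = nprod m 0 k.
Proof. apply length_desc. Qed.

Lemma NoDup_flat_map {X Y : Type} (g : X -> list Y) (s : list X) :
  NoDup s -> (forall x, In x s -> NoDup (g x)) ->
  (forall x x' y, In x s -> In x' s -> In y (g x) -> In y (g x') -> x = x') ->
  NoDup (flat_map g s).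
Proof.
  induction s as [|a s IH]; intros Hs Hg Hd; simpl. constructor.
  inversion Hs; subst. apply NoDup_app.
  - apply Hg; now left.
  - apply IH; auto. intros; apply Hg; now right.
    intros x x' y Hx Hx'. apply Hd; now right.
  - intros y Hy Hy'. apply in_flat_map in Hy'. destruct Hy' as [x [Hx Hxy]].
    apply H1. rewrite (Hd a x y); auto. now left. now right.
Qed.

Lemma gen_separated (k : nat) : NoDup (gen m l k) /\
  forall x y, In x (gen m l k) -> In y (gen m l k) -> x <> y -> l k <= Rabs (x - y).
Proof.
  induction k as [|k [IHn IHs]].
  - split. constructor; [simpl; tauto|constructor].
    intros x y [<-|[]] [<-|[]]. congruence.
  - change (gen m l (S k)) with (flat_map (children m l k) (gen m l k)).
    pose proof (tree_m_INR k) as Hm. pose proof (tree_pos _ _ HT k) as Hl.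
    pose proof (tree_pos _ _ HT (S k)) as Hl'.
    pose proof (tree_gap k) as Hgap.
    set (g := l k / INR (m k)) in *.
    assert (Hdiff : forall x x' y y', In x (gen m l k) -> In x' (gen m l k) -> x <> x' ->
      In y (children m l k x) -> In y' (children m l k x') -> g <= Rabs (y - y')).
    { intros x x' y y' Hx Hx' Hne Hy Hy'. specialize (IHs x x' Hx Hx' Hne).
      apply child_range in Hy, Hy'. fold g in Hy, Hy'.
      unfold Rabs in *. destruct (Rcase_abs (x - x')); destruct (Rcase_abs (y - y')); lra. }
    split.
    + apply NoDup_flat_map; auto.
      * intros x _. apply NoDup_map_NoDup_ForallPairs; [|apply seq_NoDup].
        intros u v _ _ E. fold g in E. apply INR_eq, Rmult_eq_reg_r with g; lra.
      * intros x x' y Hx Hx' Hy Hy'. destruct (Req_dec x x') as [|Hne]; auto.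
        pose proof (Hdiff x x' y y Hx Hx' Hne Hy Hy') as H.
        rewrite Rminus_diag, Rabs_R0 in H. lra.
    + intros y y' Hy Hy' Hne. apply in_flat_map in Hy, Hy'.
      destruct Hy as [x [Hx Hy]]. destruct Hy' as [x' [Hx' Hy']].
      apply Rle_trans with g; auto.
      destruct (Req_dec x x') as [<-|Hnx]; [|now apply (Hdiff x x')].
      apply in_children in Hy, Hy'. destruct Hy as [u [Hu ->]]. destruct Hy' as [v [Hv ->]].
      fold g in Hne |- *.
      replace (x + INR u * g - (x + INR v * g)) with ((INR u - INR v) * g) by ring.
      rewrite Rabs_mult, (Rabs_right g) by lra.
      assert (Huv : u <> v) by (intros ->; now apply Hne). pose proof (INR_apart u v Huv).
      nra.
Qed.

End Tree.

(** * Blaschke factors and Herglotz kernels *)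

Definition blaschke (p z : C) : C := ((z - p) / (1 - Cconj p * z))%C.

Lemma blaschke_denominator (p z : C) :
  Cmod (1 - Cconj p * z)%C ^ 2 =
  Cmod (z - p)%C ^ 2 + (1 - Cmod p ^ 2) * (1 - Cmod z ^ 2).
Proof. rewrite !Cmod2_alt. unfold Re, Im. simpl. ring. Qed.

Lemma blaschke_denominator_ge (p z : C) : Cmod z <= 1 -> Cmod p < 1 ->
  1 - Cmod p <= Cmod (1 - Cconj p * z)%C /\ Cmod (z - p)%C <= Cmod (1 - Cconj p * z)%C.
Proof.
  intros Hz Hp. pose proof (Cmod_ge_0 z). pose proof (Cmod_ge_0 p). split.
  - pose proof (Cmod_sub_lower 1 (Cconj p * z)%C) as H1.
    rewrite Cmod_1, Cmod_mult, Cmod_conj in H1. nra.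
  - apply Rsqr_incr_0_var; [|apply Cmod_ge_0]. rewrite !Rsqr_pow2, blaschke_denominator.
    assert (0 <= (1 - Cmod p ^ 2) * (1 - Cmod z ^ 2)) by (apply Rmult_le_pos; nra). lra.
Qed.

Lemma blaschke_denominator_neq_0 (p z : C) : Cmod z <= 1 -> Cmod p < 1 ->
  (1 - Cconj p * z)%C <> RtoC 0.
Proof.
  intros Hz Hp. apply Cmod_gt_0. pose proof (proj1 (blaschke_denominator_ge p z Hz Hp)). lra.
Qed.

Lemma Cmod_blaschke (p z : C) : Cmod z <= 1 -> Cmod p < 1 ->
  Cmod (blaschke p z) ^ 2 =
  1 - (1 - Cmod p ^ 2) * (1 - Cmod z ^ 2) / Cmod (1 - Cconj p * z)%C ^ 2.
Proof.
  intros Hz Hp. pose proof (blaschke_denominator_neq_0 p z Hz Hp) as Hne.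
  assert (0 < Cmod (1 - Cconj p * z)%C) by now apply Cmod_gt_0.
  unfold blaschke. rewrite Cmod_div by auto. unfold Rdiv at 1. rewrite Rpow_mult_distr, pow_inv.
  pose proof (blaschke_denominator p z).
  replace (Cmod (z - p)%C ^ 2) with (Cmod (1 - Cconj p * z)%C ^ 2 -
    (1 - Cmod p ^ 2) * (1 - Cmod z ^ 2)) by lra.
  field. lra.
Qed.

Lemma exp_neg_double_le (y : R) : 0 <= y <= 1 / 2 -> exp (- (2 * y)) <= 1 - y.
Proof.
  intros Hy. rewrite exp_Ropp.
  assert (H : 1 + 2 * y <= exp (2 * y)).
  { destruct (Req_dec y 0) as [->|Hn]. rewrite Rmult_0_r, exp_0; lra.
    left. apply exp_ineq1. lra. }
  apply Rle_trans with (/ (1 + 2 * y)). apply Rinv_le_contravar; lra.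
  rewrite <- (Rmult_1_l (/ (1 + 2 * y))). apply Rle_div_l; nra.
Qed.

Lemma exp_double_sqr (x : R) : exp (2 * x) = exp x ^ 2.
Proof. replace (2 * x) with (x + x) by ring. rewrite exp_plus. ring. Qed.

(** Here 1 - |b|^2 is at most y, and 1 - y >= exp (-2y) for y <= 1/2. *)
Lemma blaschke_lower (p z : C) (y : R) : Cmod z <= 1 -> Cmod p < 1 -> y <= 1 / 2 ->
  4 * (1 - Cmod p) * (1 - Cmod z) <= y * Cmod (1 - Cconj p * z)%C ^ 2 ->
  exp (- y) <= Cmod (blaschke p z).
Proof.
  intros Hz Hp Hy H. pose proof (Cmod_ge_0 z). pose proof (Cmod_ge_0 p).
  pose proof (blaschke_denominator_neq_0 p z Hz Hp) as Hne. apply Cmod_gt_0 in Hne.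
  assert (HD : 0 < Cmod (1 - Cconj p * z)%C ^ 2) by now apply pow_lt.
  set (D := Cmod (1 - Cconj p * z)%C ^ 2) in *.
  assert (Hpz : 0 <= 4 * (1 - Cmod p) * (1 - Cmod z)) by (apply Rmult_le_pos; lra).
  assert (Hy0 : 0 <= y) by (apply Rnot_lt_le; intros Hl; nra).
  apply Rsqr_incr_0_var; [|apply Cmod_ge_0]. rewrite !Rsqr_pow2.
  rewrite <- exp_double_sqr, Cmod_blaschke by auto. fold D.
  replace (2 * - y) with (- (2 * y)) by ring.
  eapply Rle_trans; [apply exp_neg_double_le; lra|].
  assert ((1 - Cmod p ^ 2) * (1 - Cmod z ^ 2) / D <= y); [|lra].
  apply Rle_div_l; auto. eapply Rle_trans; [|exact H].
  replace (4 * (1 - Cmod p) * (1 - Cmod z)) with ((2 * (1 - Cmod p)) * (2 * (1 - Cmod z))) by ring.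
  apply Rmult_le_compat; nra.
Qed.

Lemma blaschke_upper (p a : C) : Cmod a <= 1 / 4 -> Cmod p < 1 ->
  Cmod (blaschke p a) <= exp (- (3 / 10 * (1 - Cmod p))).
Proof.
  intros Ha Hp. pose proof (Cmod_ge_0 a). pose proof (Cmod_ge_0 p).
  assert (Ha1 : Cmod a <= 1) by lra.
  pose proof (blaschke_denominator_neq_0 p a Ha1 Hp) as Hne. apply Cmod_gt_0 in Hne.
  apply Rsqr_incr_0_var; [|left; apply exp_pos]. rewrite !Rsqr_pow2.
  rewrite <- exp_double_sqr, Cmod_blaschke by auto.
  set (D := Cmod (1 - Cconj p * a)%C) in *.
  assert (HD : D <= 5 / 4).
  { unfold D. eapply Rle_trans; [apply Cmod_triangle_sub|].
    rewrite Cmod_1, Cmod_mult, Cmod_conj. nra. }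
  assert (HD2 : 0 < D ^ 2 <= 25 / 16) by (split; [now apply pow_lt|nra]).
  set (Y := (1 - Cmod p ^ 2) * (1 - Cmod a ^ 2) / D ^ 2).
  assert (HY : 6 / 10 * (1 - Cmod p) <= Y).
  { unfold Y. apply (Rle_div_r _ _ (D ^ 2)); [lra|].
    assert (1 - Cmod p <= 1 - Cmod p ^ 2) by nra.
    assert (15 / 16 <= 1 - Cmod a ^ 2) by nra.
    apply Rle_trans with ((1 - Cmod p) * (15 / 16)). nra.
    apply Rmult_le_compat; lra. }
  apply Rle_trans with (exp (- Y)).
  - destruct (Req_dec Y 0) as [->|Hn]. rewrite Ropp_0, exp_0; lra.
    left. replace (1 - Y) with (1 + - Y) by ring. apply exp_ineq1. lra.
  - assert (Hle : - Y <= 2 * - (3 / 10 * (1 - Cmod p))) by lra.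
    destruct Hle as [Hl| ->]; [left; now apply exp_increasing|lra].
Qed.

Lemma cdiff_blaschke (p z : C) : Cmod z <= 1 -> Cmod p < 1 -> cdiff (blaschke p) z.
Proof.
  intros Hz Hp. unfold blaschke. apply cdiff_div. apply cdiff_sub_const.
  apply (cdiff_plus (fun _ => RtoC 1) (fun z => (- (Cconj p * z))%C)). apply cdiff_const.
  apply cdiff_opp, cdiff_scal.
  now apply blaschke_denominator_neq_0.
Qed.

Lemma blaschke_eq_0 (p z : C) : Cmod z <= 1 -> Cmod p < 1 -> blaschke p z = RtoC 0 -> z = p.
Proof.
  intros Hz Hp E. pose proof (blaschke_denominator_neq_0 p z Hz Hp).
  replace z with (p + blaschke p z * (1 - Cconj p * z))%C by (unfold blaschke; field; auto).
  rewrite E. ring.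
Qed.

(** For |p| = 1 the real part is the Poisson kernel. *)
Definition herglotz (p z : C) : C := ((p + z) / (p - z))%C.

Lemma herglotz_re (p z : C) : p <> z ->
  fst (herglotz p z) = (Cmod p ^ 2 - Cmod z ^ 2) / Cmod (p - z)%C ^ 2.
Proof.
  intros Hne. assert (Hd : 0 < Cmod (p - z)%C).
  { apply Cmod_gt_0. intros E. apply Hne. replace p with (p - z + z)%C by ring.
    rewrite E. ring. }
  assert (Hd2 : 0 < Cmod (p - z)%C ^ 2) by now apply pow_lt.
  rewrite !Cmod2_alt in *. unfold herglotz, Re, Im in *. simpl in *. field. lra.
Qed.

Lemma cdiff_herglotz (p z : C) : p <> z -> cdiff (herglotz p) z.
Proof.
  intros Hne. unfold herglotz. apply cdiff_div.
  - apply (cdiff_plus (fun _ => p) (fun z => z)). apply cdiff_const. apply cdiff_id.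
  - apply (cdiff_plus (fun _ => p) (fun z => (- z)%C)). apply cdiff_const.
    apply cdiff_opp, cdiff_id.
  - intros E. apply Hne. replace p with (p - z + z)%C by ring. rewrite E. ring.
Qed.

(** With the pole (1 + l) w at distance l outside the circle, l Re (herglotz p) is a
    positive harmonic function of size 1 within 4 l of w, while herglotz_center bounds it
    by 2 l near the origin: it majorizes a constant over an arc at the cost of the length
    of the arc. *)
Lemma herglotz_near (w z : C) (l : R) : 0 < l -> Cmod w = 1 -> Cmod z < 1 ->
  Cmod (z - w)%C <= 4 * l -> 2 / 25 <= l * fst (herglotz (RtoC (1 + l) * w) z).
Proof.
  intros Hl Hw Hz Hd. set (p := (RtoC (1 + l) * w)%C).
  assert (Hp : Cmod p = 1 + l).
  { unfold p. rewrite Cmod_mult, Cmod_R, Hw, Rabs_right; lra. }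
  assert (Hlow : l < Cmod (p - z)%C) by (pose proof (Cmod_sub_lower p z); lra).
  assert (Hup : Cmod (p - z)%C <= 5 * l).
  { replace (p - z)%C with (RtoC l * w - (z - w))%C.
    2:{ unfold p. rewrite RtoC_plus. ring. }
    eapply Rle_trans; [apply Cmod_triangle_sub|].
    rewrite Cmod_mult, Cmod_R, Hw, Rabs_right; lra. }
  rewrite herglotz_re. 2:{ intros E. rewrite E in Hp. lra. }
  rewrite Hp. set (D := Cmod (p - z)%C) in *. pose proof (Cmod_ge_0 z).
  replace (l * (((1 + l) ^ 2 - Cmod z ^ 2) / D ^ 2)) with
    (l * ((1 + l) ^ 2 - Cmod z ^ 2) / D ^ 2) by (field; lra).
  assert (HD2 : 0 < D ^ 2) by (apply pow_lt; lra).
  apply (Rle_div_r _ _ (D ^ 2)); [lra|].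
  assert (D ^ 2 <= 25 * l ^ 2) by nra.
  assert (2 * l <= (1 + l) ^ 2 - Cmod z ^ 2) by nra. nra.
Qed.

Lemma herglotz_re_pos (p z : C) : Cmod z < Cmod p -> 0 < fst (herglotz p z).
Proof.
  intros H. pose proof (Cmod_ge_0 z).
  rewrite herglotz_re. 2:{ intros E. rewrite E in H. lra. }
  assert (Hlow : 0 < Cmod (p - z)%C) by (pose proof (Cmod_sub_lower p z); lra).
  apply Rdiv_lt_0_compat. nra. now apply pow_lt.
Qed.

Lemma herglotz_center (p a : C) : 1 <= Cmod p -> Cmod a <= 1 / 4 ->
  fst (herglotz p a) <= 2.
Proof.
  intros Hp Ha. pose proof (Cmod_ge_0 a).
  rewrite herglotz_re. 2:{ intros E. rewrite E in Hp. lra. }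
  assert (Hlow : Cmod p - 1 / 4 <= Cmod (p - a)%C) by (pose proof (Cmod_sub_lower p a); lra).
  set (D := Cmod (p - a)%C) in *.
  assert (HD2 : (Cmod p - 1 / 4) ^ 2 <= D ^ 2) by nra.
  apply Rle_div_l; nra.
Qed.

(** * A Jensen-type bound for functions vanishing on the zero sets *)

Lemma list_gap {T : Type} (g : T -> R) (r : R) (s : list T) :
  (forall x, In x s -> r < g x) -> exists d, 0 < d /\ forall x, In x s -> r + d <= g x.
Proof.
  induction s as [|a s IH]; intros H.
  - exists 1. split; [lra|]. intros x [].
  - destruct IH as [d [Hd IH]]. { intros x Hx. apply H. now right. }
    specialize (H a (or_introl eq_refl)).
    exists (Rmin d (g a - r)). split. apply Rmin_pos; lra.
    intros x [<-|Hx]. pose proof (Rmin_r d (g a - r)). lra.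
    specialize (IH x Hx). pose proof (Rmin_l d (g a - r)). lra.
Qed.

Lemma uniform_radius (Q : nat -> R -> Prop) (N : nat) :
  (forall k d d', Q k d -> d' <= d -> Q k d') ->
  (forall k, (k < N)%nat -> exists d, 0 < d /\ Q k d) ->
  exists d, 0 < d /\ forall k, (k < N)%nat -> Q k d.
Proof.
  intros Hmon H. induction N.
  - exists 1. split; [lra|]. intros; lia.
  - destruct IHN as [d [Hd IH]]. { intros; apply H; lia. }
    destruct (H N ltac:(lia)) as [d' [Hd' HN]].
    exists (Rmin d d'). split. now apply Rmin_pos. intros k Hk.
    destruct (Nat.eq_dec k N) as [->|]. apply Hmon with d'; auto. apply Rmin_r.
    apply Hmon with d. apply IH; lia. apply Rmin_l.
Qed.

Lemma Cmod_Cprod_ge_1 {T : Type} (F : T -> C) (s : list T) :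
  (forall x, In x s -> 1 <= Cmod (F x)) -> 1 <= Cmod (Cprod F s).
Proof.
  induction s as [|y s IH]; simpl; intros H. rewrite Cmod_1; lra.
  rewrite Cmod_mult. assert (1 <= Cmod (F y)) by auto. assert (1 <= Cmod (Cprod F s)) by auto. nra.
Qed.

Lemma Cmod_Cprod_ge_factor {T : Type} (F : T -> C) (s : list T) (c : R) : 0 <= c ->
  (forall x, In x s -> 1 <= Cmod (F x)) ->
  (exists x, In x s /\ c <= Cmod (F x)) -> c <= Cmod (Cprod F s).
Proof.
  intros Hc H1 [x [Hx Hcx]].
  induction s as [|y s IH]; simpl in *. contradiction.
  rewrite Cmod_mult. assert (Hy : 1 <= Cmod (F y)) by auto.
  destruct Hx as [->|Hx].
  - pose proof (Cmod_Cprod_ge_1 F s ltac:(auto)). nra.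
  - assert (c <= Cmod (Cprod F s)) by auto. nra.
Qed.

(** Makes the quotient of f by a Blaschke product admissible for
    max_principle_except, without extending it across the zeros. *)
Lemma bounded_near_removed_zero (f q : C -> C) (p : C) :
  cdiff f p -> f p = RtoC 0 -> cdiff q p ->
  exists d A, 0 < d /\ forall h, Cmod h < d -> h <> RtoC 0 ->
    Cmod (f (p + h) / h * q (p + h))%C <= A.
Proof.
  intros [l Hl] H0 [k Hk].
  destruct (cdiff_at_lip f p l Hl) as [d1 [Hd1 H1]].
  destruct (cdiff_at_lip q p k Hk) as [d2 [Hd2 H2]].
  exists (Rmin 1 (Rmin d1 d2)), ((Cmod l + 1) * (Cmod (q p) + (Cmod k + 1))). split.
  { repeat apply Rmin_pos; lra. }
  intros h Hh Hne.
  apply Rlt_Rmin in Hh as [Hh1 Hh]. apply Rlt_Rmin in Hh as [Hh2 Hh3].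
  specialize (H1 h Hh2). specialize (H2 h Hh3). rewrite H0 in H1.
  replace (f (p + h) - 0)%C with (f (p + h)%C) in H1 by ring.
  apply Cmod_gt_0 in Hne. pose proof (Cmod_ge_0 l). pose proof (Cmod_ge_0 k).
  rewrite Cmod_mult, Cmod_div by now apply Cmod_gt_0.
  apply Rmult_le_compat; try apply Cmod_ge_0.
  - apply Rmult_le_pos. apply Cmod_ge_0. left. now apply Rinv_0_lt_compat.
  - now apply Rle_div_l.
  - replace (q (p + h)%C) with (q p + (q (p + h) - q p))%C by ring.
    eapply Rle_trans; [apply Cmod_triangle|]. nra.
Qed.

Lemma Cprod_split {T : Type} (F : T -> C) (s1 s2 : list T) (p : T) :
  Cprod F (s1 ++ p :: s2) = (F p * Cprod F (s1 ++ s2))%C.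
Proof. induction s1; simpl; auto. rewrite IHs1. ring. Qed.

(** The height at which the comparison region ends over the arcs of stage k that do not
    survive to stage k + 1. The square is what makes the region reach so close to the
    circle that the Blaschke product is almost of modulus 1 on its boundary. *)
Definition cutoff (l : nat -> R) (k : nat) : R := l (S k) ^ 2 / 80.

Lemma exp_le (x y : R) : x <= y -> exp x <= exp y.
Proof. intros [H| ->]; [left; now apply exp_increasing|lra]. Qed.

Section Uniqueness.
Variables (m : nat -> nat) (l : nat -> R) (HT : tree m l) (Z : nat -> list C).
Variable HZ : forall k p, In p (Z k) -> exists x th t, In x (gen m l k) /\
   x <= th <= x + l k /\ l (S k) <= t <= l k /\ p = (RtoC (1 - t) * circ th)%C.
Let ZN (N : nat) := flat_map Z (seq 0 (S N)).
Variable HND : forall N, NoDup (ZN N).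
Variables (Phi : R -> R) (f : C -> C) (c : R).
Variable HPhi0 : forall t, 0 < t <= 1 -> 0 <= Phi t.
Variable HPhi : forall t t', 0 < t -> t <= t' -> t' <= 1 -> Phi t' <= Phi t.
Variable Hf : forall z, Defs.disc z -> cdiff f z.
Variable Hfb : forall z, Defs.disc z -> Cmod (f z) <= exp (Phi (1 - Cmod z) + c).
Variable Hf0 : forall k p, In p (Z k) -> f p = RtoC 0.

Local Notation cut := (cutoff l).

(** Everything above height cut N, except that over the points leaving the boundary sets
    after stage k the region already stops at height cut k. *)
Let region (N : nat) (z : C) : Prop := cut N <= 1 - Cmod z /\
  forall k, (k < N)%nat -> cut k <= 1 - Cmod z \/
    exists x, In x (gen m l (S k)) /\ Cmod (z - circ x)%C <= 4 * l (S k).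

Let cut_pos (k : nat) : 0 < cut k.
Proof. unfold cutoff. pose proof (tree_pos _ _ HT (S k)). apply Rdiv_lt_0_compat; [nra|lra]. Qed.

Let cut_le (k : nat) : cut k <= 1 / 2.
Proof.
  unfold cutoff. pose proof (tree_pos _ _ HT (S k)). pose proof (tree_le _ _ HT (S k)).
  apply Rle_div_l; nra.
Qed.

Let Cmod_Z (k : nat) (p : C) : In p (Z k) -> l (S k) <= 1 - Cmod p <= l k /\
  exists x th, In x (gen m l k) /\ x <= th <= x + l k /\
    Cmod (p - circ th)%C <= l k.
Proof.
  intros Hp. destruct (HZ k p Hp) as [x [th [t [Hx [Hth [Ht ->]]]]]].
  pose proof (tree_pos _ _ HT (S k)). pose proof (tree_le _ _ HT k).
  rewrite Cmod_mult, Cmod_circ, Cmod_R, Rabs_right by lra.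
  split. lra. exists x, th. repeat split; auto; try lra.
  replace (RtoC (1 - t) * circ th - circ th)%C with (- (RtoC t * circ th))%C.
  2:{ rewrite RtoC_minus. ring. }
  rewrite Cmod_opp, Cmod_mult, Cmod_circ, Cmod_R, Rabs_right; lra.
Qed.

Let Z_disc (k : nat) (p : C) : In p (Z k) -> Cmod p < 1.
Proof. intros Hp. destruct (Cmod_Z k p Hp) as [H _]. pose proof (tree_pos _ _ HT (S k)). lra. Qed.

Let in_ZN (N : nat) (p : C) : In p (ZN N) -> exists k, (k <= N)%nat /\ In p (Z k).
Proof.
  intros H. apply in_flat_map in H. destruct H as [k [Hk Hp]]. apply in_seq in Hk.
  exists k. split; auto. lia.
Qed.

Let region_closed (N : nat) : Cclosed (region N).
Proof.
  intros z Hz. unfold region in Hz.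
  destruct (Rle_dec (cut N) (1 - Cmod z)) as [H|H].
  - assert (Hk : exists k, (k < N)%nat /\ 1 - Cmod z < cut k /\
       forall x, In x (gen m l (S k)) -> 4 * l (S k) < Cmod (z - circ x)%C).
    { apply NNPP. intros Hno. apply Hz. split; auto. intros k Hk.
      apply NNPP. intros Hno2. apply Hno. exists k. split; auto. split.
      - apply Rnot_le_lt. tauto.
      - intros x Hx. apply Rnot_le_lt. intros Hle. apply Hno2. right. eauto. }
    destruct Hk as [k [Hk [H1 H2]]]. destruct (list_gap _ _ _ H2) as [d [Hd H3]].
    exists (Rmin d (cut k - (1 - Cmod z))). split. apply Rmin_pos; lra.
    intros y Hy [_ Hr].
    pose proof (Rmin_l d (cut k - (1 - Cmod z))). pose proof (Rmin_r d (cut k - (1 - Cmod z))).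
    destruct (Hr k Hk) as [Ha|[x [Hx Hle]]].
    + pose proof (Cmod_sub_lower z y). rewrite Cmod_sub_comm in H5. lra.
    + specialize (H3 x Hx). pose proof (Cmod_triangle (z - y)%C (y - circ x)%C).
      replace (z - y + (y - circ x))%C with (z - circ x)%C in H5 by ring.
      rewrite (Cmod_sub_comm z y) in H5. lra.
  - exists (cut N - (1 - Cmod z)). split. lra. intros y Hy [Hr _].
    pose proof (Cmod_sub_lower z y). rewrite Cmod_sub_comm in H0. lra.
Qed.

Let region_interior (N : nat) (z : C) : region N z -> Cinterior (region N) z \/
  exists k, (k <= N)%nat /\ 1 - Cmod z <= cut k /\
    ((k < N)%nat -> forall x, In x (gen m l (S k)) -> 4 * l (S k) <= Cmod (z - circ x)%C).
Proof.
  intros [H0 Hr].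
  destruct (Rle_dec (1 - Cmod z) (cut N)) as [Hle|Hn].
  { right. exists N. repeat split; auto. intros; lia. }
  apply Rnot_le_lt in Hn.
  destruct (excluded_middle_informative (exists k, (k < N)%nat /\ 1 - Cmod z <= cut k /\
    forall x, In x (gen m l (S k)) -> 4 * l (S k) <= Cmod (z - circ x)%C)) as [[k [Hk [H1 H2]]]|Hno].
  { right. exists k. repeat split; auto. lia. }
  left.
  destruct (uniform_radius (fun k d => cut k + d <= 1 - Cmod z \/
     exists x, In x (gen m l (S k)) /\ Cmod (z - circ x)%C + d <= 4 * l (S k)) N) as [d [Hd H]].
  { intros k d d' [H|[x [Hx H]]] Hd. left; lra. right. exists x. split; auto. lra. }
  { intros k Hk. destruct (Rlt_dec (cut k) (1 - Cmod z)) as [Hlt|Hge].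
    - exists ((1 - Cmod z) - cut k). split. lra. left. lra.
    - assert (He : exists x, In x (gen m l (S k)) /\ Cmod (z - circ x)%C < 4 * l (S k)).
      { apply NNPP. intros Hno2. apply Hno. exists k. repeat split; auto. lra.
        intros x Hx. apply Rnot_lt_le. intros Hlt. apply Hno2. eauto. }
      destruct He as [x [Hx Hlt]]. exists (4 * l (S k) - Cmod (z - circ x)%C).
      split. lra. right. exists x. split; auto. lra. }
  exists (Rmin d (1 - Cmod z - cut N)). split. apply Rmin_pos; lra.
  intros y Hy. pose proof (Rmin_l d (1 - Cmod z - cut N)). pose proof (Rmin_r d (1 - Cmod z - cut N)).
  pose proof (Cmod_sub_lower y z) as Hyz.
  split. lra. intros k Hk. destruct (H k Hk) as [Ha|[x [Hx Ha]]]. left; lra.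
  right. exists x. split; auto. pose proof (Cmod_triangle (y - z)%C (z - circ x)%C).
  replace (y - z + (z - circ x))%C with (y - circ x)%C in H3 by ring. lra.
Qed.

Let pole (k : nat) (x : R) : C := (RtoC (1 + l k) * circ x)%C.

Let Cmod_pole (k : nat) (x : R) : Cmod (pole k x) = 1 + l k.
Proof.
  unfold pole. pose proof (tree_pos _ _ HT k).
  rewrite Cmod_mult, Cmod_circ, Cmod_R, Rabs_right; lra.
Qed.


Let factor (z : C) (kx : nat * R) : C :=
  Cexp (RtoC (25 / 2 * Phi (cut (fst kx)) * l (fst kx)) * herglotz (pole (fst kx) (snd kx)) z).

Let nodes (N : nat) : list (nat * R) :=
  flat_map (fun k => map (fun x => (k, x)) (gen m l k)) (seq 1 N).

(** Its logarithm is a sum of multiples of the positive harmonic functions of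
    herglotz_near, one for each arc of the stages 1 to N. *)
Let Majorant (N : nat) (z : C) : C := Cprod (factor z) (nodes N).
Let Blaschke (N : nat) (z : C) : C := Cprod (fun p => blaschke p z) (ZN N).

Let cut_range (k : nat) : 0 < cut k <= 1.
Proof. pose proof (cut_pos k). pose proof (cut_le k). lra. Qed.

Let Cmod_factor (z : C) (kx : nat * R) : Cmod (factor z kx) =
  exp (25 / 2 * Phi (cut (fst kx)) * (l (fst kx) * fst (herglotz (pole (fst kx) (snd kx)) z))).
Proof.
  unfold factor. rewrite Cmod_Cexp. f_equal. simpl. ring.
Qed.

Let factor_ge_1 (z : C) (kx : nat * R) : Cmod z < 1 -> 1 <= Cmod (factor z kx).
Proof.
  intros Hz. rewrite Cmod_factor. pose proof (tree_pos _ _ HT (fst kx)) as Hl.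
  pose proof (HPhi0 _ (cut_range (fst kx))) as HP.
  assert (H : 0 < fst (herglotz (pole (fst kx) (snd kx)) z)).
  { apply herglotz_re_pos. rewrite Cmod_pole. lra. }
  rewrite <- exp_0 at 1. assert (Hle : 0 <= 25 / 2 * Phi (cut (fst kx)) *
    (l (fst kx) * fst (herglotz (pole (fst kx) (snd kx)) z))).
  { apply Rmult_le_pos; [lra|]. left. now apply Rmult_lt_0_compat. }
  destruct Hle as [Hl'| <-]; [left; now apply exp_increasing|lra].
Qed.

Let Majorant_neq_0 (N : nat) (z : C) : Majorant N z <> RtoC 0.
Proof. apply Cprod_neq_0. intros kx _. apply Cexp_neq_0. Qed.

Let cdiff_Majorant (N : nat) (z : C) : Cmod z < 1 -> cdiff (Majorant N) z.
Proof.
  intros Hz. unfold Majorant. apply (cdiff_Cprod (fun kx z => factor z kx)).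
  intros kx _. unfold factor. apply (cdiff_comp Cexp). 2: apply cdiff_Cexp.
  apply (cdiff_comp (fun y => (RtoC (25 / 2 * Phi (cut (fst kx)) * l (fst kx)) * y)%C)).
  2: apply cdiff_scal. apply cdiff_herglotz. intros E.
  pose proof (Cmod_pole (fst kx) (snd kx)) as HH. rewrite E in HH.
  pose proof (tree_pos _ _ HT (fst kx)). lra.
Qed.

Let cdiff_Blaschke (N : nat) (z : C) : Cmod z <= 1 -> cdiff (Blaschke N) z.
Proof.
  intros Hz. unfold Blaschke. apply (cdiff_Cprod blaschke). intros p Hp.
  destruct (in_ZN N p Hp) as [k [_ Hk]]. apply cdiff_blaschke; auto. eapply Z_disc; eauto.
Qed.

Let first_level (N : nat) (tau : R) : cut N <= tau ->
  exists k, (k <= N)%nat /\ cut k <= tau /\ (k = 0%nat \/ tau < cut (k - 1)%nat).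
Proof.
  induction N as [|N IH]; intros H.
  - exists 0%nat. auto.
  - destruct (Rle_dec (cut N) tau) as [Hle|Hn].
    + destruct (IH Hle) as [k [Hk Hk']]. exists k. split; auto.
    + exists (S N). split; auto. split; auto. right. simpl. rewrite Nat.sub_0_r. lra.
Qed.

(** A point of the region with height between cut k and cut (k - 1) lies within
    4 l k of an arc of stage k, and the factor of that single arc already exceeds
    exp (Phi (cut k)). The points above height cut 0 account for the constant. *)
Let majorant (N : nat) (z : C) : region N z ->
  Cmod (f z) <= exp (c + Phi (cut 0%nat)) * Cmod (Majorant N z).
Proof.
  intros [Hz Hr].
  assert (Hz1 : Cmod z < 1) by (pose proof (cut_pos N); lra).
  pose proof (Cmod_ge_0 z) as Hz0.
  destruct (first_level N (1 - Cmod z) Hz) as [k [Hk [Htk Hor]]].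
  assert (Hfz : Cmod (f z) <= exp (Phi (cut k) + c)).
  { eapply Rle_trans; [now apply Hfb|]. apply exp_le. apply Rplus_le_compat_r.
    apply HPhi; auto; lra. }
  assert (Hall : forall kx, In kx (nodes N) -> 1 <= Cmod (factor z kx)).
  { intros kx _. now apply factor_ge_1. }
  pose proof (HPhi0 _ (cut_range 0)) as HP0.
  destruct Hor as [->|Hlt].
  - pose proof (Cmod_Cprod_ge_1 (factor z) (nodes N) Hall) as H1. fold (Majorant N z) in H1.
    rewrite (Rplus_comm c). pose proof (exp_pos (Phi (cut 0%nat) + c)). nra.
  - destruct k as [|k]. { simpl in Hlt. lra. }
    replace (S k - 1)%nat with k in Hlt by lia.
    destruct (Hr k ltac:(lia)) as [Ha|[x [Hx Hd]]]; [lra|].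
    assert (HM : exp (Phi (cut (S k))) <= Cmod (Majorant N z)).
    { unfold Majorant. apply Cmod_Cprod_ge_factor; auto. left; apply exp_pos.
      exists (S k, x). split.
      - unfold nodes. apply in_flat_map. exists (S k). split. apply in_seq; lia.
        apply in_map_iff. exists x. auto.
      - rewrite Cmod_factor. apply exp_le. cbn [fst snd].
        pose proof (herglotz_near (circ x) z (l (S k)) (tree_pos _ _ HT _) (Cmod_circ x) Hz1 Hd) as Hn.
        fold (pole (S k) x) in Hn. pose proof (HPhi0 _ (cut_range (S k))).
        assert (25 / 2 * Phi (cut (S k)) * (2 / 25) <=
          25 / 2 * Phi (cut (S k)) * (l (S k) * fst (herglotz (pole (S k) x) z))).
        { apply Rmult_le_compat_l; lra. }
        lra. }
    rewrite exp_plus in Hfz. rewrite exp_plus.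
    assert (H1 : 1 <= exp (Phi (cut 0%nat))) by (rewrite <- exp_0 at 1; now apply exp_le).
    pose proof (exp_pos c). pose proof (exp_pos (Phi (cut (S k)))).
    apply (Rle_trans _ _ _ Hfz). rewrite Rmult_comm, Rmult_assoc.
    apply Rmult_le_compat_l. lra. nra.
Qed.

Let V (N : nat) : R := lsum (fun p => 1 - Cmod p) (ZN N).

Let lsum_scal_neg (a : R) (s : list C) :
  fold_right Rplus 0 (map (fun p => - (a * (1 - Cmod p))) s) = - (a * lsum (fun p => 1 - Cmod p) s).
Proof. unfold lsum. induction s; simpl. ring. rewrite IHs. ring. Qed.

(** A zero p of stage at most k has height at least l (S k). A zero of a later stage lies
    over an arc of stage k + 1, hence within 3 l (S k) of a point from which z is at
    distance at least 4 l (S k). In both cases |1 - conj(p) z| >= l (S k), and the height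
    of z, at most l (S k)^2 / 80, makes each factor at least exp (-(1 - |p|) / 20). *)
Let boundary_blaschke (N : nat) (z : C) (k : nat) : Cmod z <= 1 ->
  (k <= N)%nat -> 1 - Cmod z <= cut k ->
  ((k < N)%nat -> forall x, In x (gen m l (S k)) -> 4 * l (S k) <= Cmod (z - circ x)%C) ->
  exp (- (1 / 20 * V N)) <= Cmod (Blaschke N z).
Proof.
  intros Hz Hk Ht Hfar. unfold V. rewrite <- lsum_scal_neg. unfold Blaschke.
  apply Cmod_Cprod_ge. intros p Hp. destruct (in_ZN N p Hp) as [j [Hj Hpj]].
  destruct (Cmod_Z j p Hpj) as [[Hp1 Hp2] [x [th [Hx [Hth Hd]]]]].
  pose proof (tree_pos _ _ HT (S k)) as Hl. pose proof (tree_pos _ _ HT (S j)) as Hlj.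
  pose proof (tree_le _ _ HT j) as Hlj8.
  assert (Hplt : Cmod p < 1) by lra.
  destruct (blaschke_denominator_ge p z Hz Hplt) as [HD1 HD2].
  assert (HD : l (S k) <= Cmod (1 - Cconj p * z)%C).
  { destruct (Nat.le_gt_cases j k) as [Hjk|Hjk].
    - pose proof (tree_decr _ _ HT (S j) (S k) ltac:(lia)). lra.
    - destruct (gen_ancestor _ _ HT (S k) j x ltac:(lia) Hx) as [y [Hy Hyx]].
      specialize (Hfar ltac:(lia) y Hy).
      pose proof (tree_decr _ _ HT (S k) j ltac:(lia)) as Hdec.
      pose proof (circ_dist_le th y) as Hc. rewrite Rabs_right in Hc by lra.
      pose proof (Cmod_triangle (z - p)%C (p - circ th + (circ th - circ y))%C) as T1.
      replace (z - p + (p - circ th + (circ th - circ y)))%C with (z - circ y)%C in T1 by ring.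
      pose proof (Cmod_triangle (p - circ th)%C (circ th - circ y)%C). lra. }
  set (D := Cmod (1 - Cconj p * z)%C) in *.
  apply blaschke_lower; auto. lra. fold D.
  assert (HDD : l (S k) ^ 2 <= D ^ 2) by nra.
  unfold cutoff in Ht.
  apply Rle_trans with (4 * (1 - Cmod p) * (l (S k) ^ 2 / 80)).
  { apply Rmult_le_compat_l; lra. }
  replace (4 * (1 - Cmod p) * (l (S k) ^ 2 / 80)) with (1 / 20 * (1 - Cmod p) * l (S k) ^ 2) by field.
  apply Rmult_le_compat_l; lra.
Qed.

Let Blaschke_neq_0 (N : nat) (z : C) : Cmod z <= 1 -> ~ In z (ZN N) -> Blaschke N z <> RtoC 0.
Proof.
  intros Hz Hn. apply Cprod_neq_0. intros p Hp E.
  destruct (in_ZN N p Hp) as [k [_ Hk]]. apply Hn.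
  now rewrite (blaschke_eq_0 p z Hz (Z_disc k p Hk) E).
Qed.

Let locally_bounded (N : nat) (p : C) : In p (ZN N) ->
  exists d A, 0 < d /\ forall h, Cmod h < d -> h <> RtoC 0 ->
    Cmod (f (p + h) / (Blaschke N (p + h) * Majorant N (p + h)))%C <= A.
Proof.
  intros Hp. destruct (in_ZN N p Hp) as [k [_ Hk]]. pose proof (Z_disc k p Hk) as Hp1.
  destruct (in_split _ _ Hp) as [s1 [s2 Hs]].
  assert (Hnd : ~ In p (s1 ++ s2)) by (apply NoDup_remove_2; rewrite <- Hs; apply HND).
  assert (Hin : forall q, In q (s1 ++ s2) -> In q (ZN N)).
  { intros q Hq. rewrite Hs. apply in_app_iff in Hq. apply in_app_iff. simpl. tauto. }
  set (rest := fun z => Cprod (fun q => blaschke q z) (s1 ++ s2)).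
  set (q := fun z => ((1 - Cconj p * z) / (rest z * Majorant N z))%C).
  assert (Hrest : rest p <> RtoC 0).
  { unfold rest. apply Cprod_neq_0. intros q' Hq' E.
    destruct (in_ZN N q' (Hin q' Hq')) as [k' [_ Hk']]. apply Hnd.
    now rewrite (blaschke_eq_0 q' p ltac:(lra) (Z_disc k' q' Hk') E). }
  assert (Hcr : cdiff rest p).
  { unfold rest. apply (cdiff_Cprod blaschke).
    intros q' Hq'. destruct (in_ZN N q' (Hin q' Hq')) as [k' [_ Hk']].
    apply cdiff_blaschke. lra. eapply Z_disc; eauto. }
  destruct (cdiff_mod_continuous rest p Hcr (Cmod (rest p)) (proj1 (Cmod_gt_0 _) Hrest))
    as [d' [Hd' Hnz]].
  destruct (bounded_near_removed_zero f q p) as [d [A [Hd HA]]].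
  - now apply Hf.
  - now apply (Hf0 k).
  - unfold q. apply cdiff_div.
    + apply (cdiff_plus (fun _ => RtoC 1) (fun z => (- (Cconj p * z))%C)). apply cdiff_const.
      apply cdiff_opp, cdiff_scal.
    + apply cdiff_mult; auto.
    + apply Cmult_neq_0; auto.
  - exists (Rmin d (Rmin d' (1 - Cmod p))), A. split. repeat apply Rmin_pos; lra.
    intros h Hh Hne.
    apply Rlt_Rmin in Hh as [Hh1 Hh]. apply Rlt_Rmin in Hh as [Hh3 Hh2].
    specialize (HA h Hh1 Hne).
    assert (Hr : rest (p + h)%C <> RtoC 0).
    { intros E. specialize (Hnz (p + h)%C). rewrite E, Cmod_0 in Hnz.
      replace (p + h - p)%C with h in Hnz by ring. specialize (Hnz Hh3).
      rewrite Rminus_0_l, Rabs_Ropp, Rabs_right in Hnz; [lra|apply Rle_ge, Cmod_ge_0]. }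
    replace (f (p + h) / (Blaschke N (p + h) * Majorant N (p + h)))%C with (f (p + h) / h * q (p + h))%C; auto.
    unfold q, Blaschke. rewrite Hs, (Cprod_split (fun q => blaschke q (p + h)%C)). fold (rest (p + h)%C).
    unfold blaschke at 1. replace (p + h - p)%C with h by ring.
    pose proof (Cmod_triangle p h).
    pose proof (blaschke_denominator_neq_0 p (p + h)%C ltac:(lra) Hp1) as Hd1.
    field. repeat split; auto.
Qed.

(** The maximum principle for f / (Blaschke * Majorant). The zeros gain 3/10 of their mass
    V N near the origin and lose 1/20 of it on the boundary of the region; the majorant
    costs, for every stage, Phi at its cutoff times the length of the boundary set. *)
Theorem uniqueness_bound (N : nat) (a : C) : Cmod a <= 1 / 4 ->
  Cmod (f a) <= exp (c + Phi (cut 0%nat) - 1 / 4 * V N +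
    lsum (fun k => 25 * Phi (cut k) * (INR (length (gen m l k)) * l k)) (seq 1 N)).
Proof.
  intros Ha.
  destruct (excluded_middle_informative (In a (ZN N))) as [Hin|Hin].
  { destruct (in_ZN N a Hin) as [k [_ Hk]]. rewrite (Hf0 k a Hk), Cmod_0. left. apply exp_pos. }
  assert (Ha1 : Cmod a <= 1) by lra.
  assert (HB : Cmod (Blaschke N a) <= exp (- (3 / 10 * V N))).
  { unfold V. rewrite <- lsum_scal_neg. apply Cmod_Cprod_le. intros p Hp.
    destruct (in_ZN N p Hp) as [k [_ Hk]]. apply blaschke_upper; auto. eapply Z_disc; eauto. }
  set (Sg := lsum (fun k => 25 * Phi (cut k) * (INR (length (gen m l k)) * l k)) (seq 1 N)).
  assert (HG : Cmod (Majorant N a) <= exp Sg).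
  { eapply Rle_trans. apply (Cmod_Cprod_le _ (fun kx => 25 * Phi (cut (fst kx)) * l (fst kx))).
    - intros kx _. rewrite Cmod_factor. apply exp_le.
      pose proof (tree_pos _ _ HT (fst kx)). pose proof (HPhi0 _ (cut_range (fst kx))).
      assert (Hh : fst (herglotz (pole (fst kx) (snd kx)) a) <= 2).
      { apply herglotz_center; auto. rewrite Cmod_pole. lra. }
      assert (l (fst kx) * fst (herglotz (pole (fst kx) (snd kx)) a) <= l (fst kx) * 2)
        by (apply Rmult_le_compat_l; lra).
      replace (25 * Phi (cut (fst kx)) * l (fst kx)) with
       (25 / 2 * Phi (cut (fst kx)) * (l (fst kx) * 2)) by field.
      apply Rmult_le_compat_l; lra.
    - apply exp_le. right. fold (lsum (fun kx => 25 * Phi (cut (fst kx)) * l (fst kx)) (nodes N)).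
      unfold nodes. rewrite lsum_flat_map. apply lsum_ext. intros k _.
      rewrite lsum_map. simpl. rewrite lsum_const. ring. }
  set (M := exp (c + Phi (cut 0%nat) + 1 / 20 * V N)).
  assert (Hmax : Cmod (f a / (Blaschke N a * Majorant N a))%C <= M).
  { apply (max_principle_except (region N) M (fun z => (f z / (Blaschke N z * Majorant N z))%C) (ZN N)); auto.
    - intros z [Hz _]. pose proof (cut_pos N). lra.
    - unfold M. left. apply exp_pos.
    - intros p Hp. destruct (in_ZN N p Hp) as [k [_ Hk]]. left. eapply Z_disc; eauto.
    - intros z [Hz _] Hnz. pose proof (cut_pos N). assert (Hz1 : Cmod z < 1) by lra.
      apply cdiff_div. now apply Hf. apply cdiff_mult. apply cdiff_Blaschke; lra. now apply cdiff_Majorant.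
      apply Cmult_neq_0; auto. apply Blaschke_neq_0; auto; lra.
    - intros z Hz. destruct (region_interior N z Hz) as [|[k [Hk [Htk Hfar]]]]; [now left|right].
      assert (Hz1 : Cmod z < 1) by (destruct Hz as [Hz _]; pose proof (cut_pos N); lra).
      pose proof (boundary_blaschke N z k ltac:(lra) Hk Htk Hfar) as Hb.
      pose proof (majorant N z Hz) as Hm.
      pose proof (exp_pos (- (1 / 20 * V N))) as He.
      assert (HnB : Blaschke N z <> RtoC 0) by (apply Cmod_gt_0; lra).
      split.
      { intros Hin2. apply HnB. apply Cprod_zero with (x := z); auto.
        unfold blaschke. replace (z - z)%C with (RtoC 0) by ring. unfold Cdiv. ring. }
      pose proof (Majorant_neq_0 N z) as HnM. pose proof (proj1 (Cmod_gt_0 _) HnM).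
      rewrite Cmod_div by (now apply Cmult_neq_0). rewrite Cmod_mult.
      apply Rle_div_l. { apply Rmult_lt_0_compat; lra. }
      unfold M. rewrite exp_plus.
      assert (Hcancel : exp (1 / 20 * V N) * exp (- (1 / 20 * V N)) = 1).
      { rewrite <- exp_plus. rewrite <- exp_0. f_equal. ring. }
      pose proof (exp_pos (1 / 20 * V N)). pose proof (exp_pos (c + Phi (cut 0%nat))).
      assert (1 <= exp (1 / 20 * V N) * Cmod (Blaschke N z)).
      { apply Rle_trans with (exp (1 / 20 * V N) * exp (- (1 / 20 * V N))).
        rewrite Hcancel; lra. apply Rmult_le_compat_l; lra. }
      apply (Rle_trans _ _ _ Hm).
      replace (exp (c + Phi (cut 0%nat)) * exp (1 / 20 * V N) * (Cmod (Blaschke N z) * Cmod (Majorant N z)))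
       with (exp (c + Phi (cut 0%nat)) * Cmod (Majorant N z) * (exp (1 / 20 * V N) * Cmod (Blaschke N z))) by ring.
      rewrite <- (Rmult_1_r (exp (c + Phi (cut 0%nat)) * Cmod (Majorant N z))) at 1.
      apply Rmult_le_compat_l; auto. apply Rmult_le_pos; lra.
    - split. pose proof (cut_le N). lra. intros k Hk. left. pose proof (cut_le k). lra. }
  pose proof (Blaschke_neq_0 N a Ha1 Hin) as HnB. pose proof (Majorant_neq_0 N a) as HnM.
  rewrite Cmod_div in Hmax by now apply Cmult_neq_0. rewrite Cmod_mult in Hmax.
  pose proof (proj1 (Cmod_gt_0 _) HnB). pose proof (proj1 (Cmod_gt_0 _) HnM).
  apply (proj1 (Rle_div_l _ _ _ (Rmult_lt_0_compat _ _ H H0))) in Hmax.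
  apply (Rle_trans _ _ _ Hmax).
  replace (c + Phi (cut 0%nat) - 1 / 4 * V N + Sg) with
    ((c + Phi (cut 0%nat) + 1 / 20 * V N) + (- (3 / 10 * V N) + Sg)) by field.
  rewrite exp_plus. fold M. rewrite (exp_plus _ Sg).
  apply Rmult_le_compat_l. left; apply exp_pos.
  apply Rmult_le_compat; auto; apply Cmod_ge_0.
Qed.

End Uniqueness.

Lemma lsum_plus {T : Type} (F G : T -> R) (s : list T) :
  lsum (fun x => F x + G x) s = lsum F s + lsum G s.
Proof. unfold lsum. induction s; simpl; lra. Qed.

Lemma lsum_ge_term {T : Type} (F : T -> R) (s : list T) (x : T) :
  (forall y, In y s -> 0 <= F y) -> In x s -> F x <= lsum F s.
Proof.
  induction s as [|y s IH]; intros H []; unfold lsum in *; simpl.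
  - subst. assert (0 <= lsum F s) by (apply lsum_nonneg; intros; apply H; now right).
    unfold lsum in *. lra.
  - pose proof (H y (or_introl eq_refl)). specialize (IH (fun z Hz => H z (or_intror Hz)) H0). lra.
Qed.

(** * The limit measure and its Herglotz integral *)

Section Mean.
Variables (m : nat -> nat) (l : nat -> R) (HT : tree m l).
Hypothesis Hl0 : is_lim_seq l 0.

Definition avg (j : nat) (g : R -> R) : R := lsum g (gen m l j) / INR (length (gen m l j)).

Lemma length_gen_pos (j : nat) : 0 < INR (length (gen m l j)).
Proof.
  rewrite gen_length. apply lt_0_INR. induction j; simpl. lia.
  pose proof (tree_m _ _ HT j). nia.
Qed.

Lemma avg_le (j : nat) (g h : R -> R) : (forall x, In x (gen m l j) -> g x <= h x) ->
  avg j g <= avg j h.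
Proof.
  intros H. unfold avg. apply Rmult_le_compat_r.
  left. apply Rinv_0_lt_compat, length_gen_pos. now apply lsum_le.
Qed.

Lemma avg_ext (j : nat) (g h : R -> R) : (forall x, g x = h x) -> avg j g = avg j h.
Proof. intros H. apply Rle_antisym; apply avg_le; intros x _; rewrite H; lra. Qed.

Lemma avg_const (j : nat) (c : R) : avg j (fun _ => c) = c.
Proof. unfold avg. rewrite lsum_const. pose proof (length_gen_pos j). field. lra. Qed.

Lemma avg_plus (j : nat) (g h : R -> R) : avg j (fun x => g x + h x) = avg j g + avg j h.
Proof. unfold avg. rewrite lsum_plus. unfold Rdiv. ring. Qed.

Lemma avg_scal (j : nat) (c : R) (g : R -> R) : avg j (fun x => c * g x) = c * avg j g.
Proof. unfold avg. rewrite lsum_scal. unfold Rdiv. ring. Qed.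

Lemma length_gen_add (j i : nat) :
  INR (length (gen m l (j + i))) = INR (length (gen m l j)) * INR (nprod m j i).
Proof.
  rewrite gen_add, (length_flat_map_const _ (nprod m j i)), mult_INR; auto.
  intros; apply length_desc.
Qed.

Definition lipschitz (L : R) (g : R -> R) : Prop := forall x y, Rabs (g x - g y) <= L * Rabs (x - y).

(** Passing from a point to its descendants moves it by at most l j. *)
Lemma avg_cauchy (L : R) (g : R -> R) (j i : nat) : 0 <= L -> lipschitz L g ->
  Rabs (avg (j + i) g - avg j g) <= L * l j.
Proof.
  intros HL Hg.
  assert (E : avg (j + i) g = avg j (fun x => lsum g (desc m l j i x) / INR (nprod m j i))).
  { unfold avg. rewrite length_gen_add, gen_add, lsum_flat_map. unfold Rdiv.
    rewrite (lsum_ext (fun x => lsum g (desc m l j i x) * / INR (nprod m j i))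
      (fun x => / INR (nprod m j i) * lsum g (desc m l j i x))) by (intros; ring).
    rewrite lsum_scal. rewrite Rinv_mult. ring. }
  rewrite E.
  assert (Hp : 0 < INR (nprod m j i)).
  { pose proof (length_gen_pos (j + i)). rewrite length_gen_add in H.
    pose proof (length_gen_pos j). nra. }
  assert (B : forall x, g x - L * l j <= lsum g (desc m l j i x) / INR (nprod m j i) <= g x + L * l j).
  { intros x.
    assert (Hy : forall y, In y (desc m l j i x) -> g x - L * l j <= g y <= g x + L * l j).
    { intros y Hy. apply (desc_range _ _ HT) in Hy. specialize (Hg y x).
      pose proof (tree_pos _ _ HT (j + i)).
      assert (Rabs (y - x) <= l j) by (rewrite Rabs_right; lra).
      assert (L * Rabs (y - x) <= L * l j) by now apply Rmult_le_compat_l.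
      assert (H2 : Rabs (g y - g x) <= L * l j) by lra. apply Rabs_le_between in H2. lra. }
    split.
    - apply (Rle_div_r _ _ (INR (nprod m j i))); auto. rewrite <- (length_desc m l j i x), Rmult_comm.
      rewrite <- lsum_const. apply lsum_le. intros y H. apply Hy; auto.
    - apply Rle_div_l; auto. rewrite <- (length_desc m l j i x), Rmult_comm.
      rewrite <- lsum_const. apply lsum_le. intros y H. apply Hy; auto. }
  assert (H1 : avg j (fun x => lsum g (desc m l j i x) / INR (nprod m j i)) <= avg j (fun x => g x + L * l j)).
  { apply avg_le. intros; apply B. }
  assert (H2 : avg j (fun x => g x + - (L * l j)) <= avg j (fun x => lsum g (desc m l j i x) / INR (nprod m j i))).
  { apply avg_le. intros x _. specialize (B x). lra. }
  rewrite avg_plus, avg_const in H1, H2. apply Rabs_le_between. lra.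
Qed.

(** The integral against the weak limit of the uniform probabilities on the generations. *)
Definition mean (g : R -> R) : R := real (Lim_seq (fun j => avg j g)).

Lemma mean_lim (L : R) (g : R -> R) : 0 <= L -> lipschitz L g ->
  is_lim_seq (fun j => avg j g) (mean g).
Proof.
  intros HL Hg. apply Lim_seq_correct'. apply ex_lim_seq_cauchy_corr. intros eps.
  apply is_lim_seq_spec in Hl0.
  assert (He : 0 < eps / (2 * (L + 1))) by (apply Rdiv_lt_0_compat; [apply cond_pos|lra]).
  destruct (Hl0 (mkposreal _ He)) as [N HN]. simpl in HN.
  specialize (HN N (Nat.le_refl N)). rewrite Rminus_0_r in HN.
  rewrite Rabs_right in HN by (left; apply (tree_pos _ _ HT)).
  pose proof (tree_pos _ _ HT N) as HlN.
  assert (HLN : L * l N < eps / 2).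
  { apply Rlt_div_r in HN; [|lra]. nra. }
  exists N. intros p q Hp Hq.
  replace p with (N + (p - N))%nat by lia. replace q with (N + (q - N))%nat by lia.
  pose proof (avg_cauchy L g N (p - N) HL Hg) as H1.
  pose proof (avg_cauchy L g N (q - N) HL Hg) as H2.
  apply Rabs_le_between in H1, H2. apply Rabs_lt_between. lra.
Qed.

Definition Cmean (g : R -> C) : C := (mean (fun x => fst (g x)), mean (fun x => snd (g x))).

Definition Clipschitz (g : R -> C) : Prop :=
  exists L, 0 <= L /\ forall x y, Cmod (g x - g y)%C <= L * Rabs (x - y).

Lemma Clipschitz_parts (g : R -> C) : Clipschitz g ->
  is_lim_seq (fun j => avg j (fun x => fst (g x))) (fst (Cmean g)) /\
  is_lim_seq (fun j => avg j (fun x => snd (g x))) (snd (Cmean g)).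
Proof.
  intros [L [HL H]]. split; apply (mean_lim L); auto; intros x y;
    (eapply Rle_trans; [|apply H]); (eapply Rle_trans; [|apply Rmax_Cmod]); simpl.
  apply Rmax_l. apply Rmax_r.
Qed.

Lemma lim_bounded (u : nat -> R) (a K : R) : is_lim_seq u a ->
  (forall n, Rabs (u n) <= K) -> Rabs a <= K.
Proof.
  intros Hu HK. apply is_lim_seq_abs in Hu.
  exact (is_lim_seq_le _ (fun _ => K) (Rbar_abs a) K HK Hu (is_lim_seq_const K)).
Qed.

(** A second-order Taylor estimate that is uniform along the circle survives averaging;
    this is differentiation under the integral sign. *)
Lemma Cmean_taylor (g1 g2 g3 : R -> C) (h : C) (K : R) :
  Clipschitz g1 -> Clipschitz g2 -> Clipschitz g3 ->
  (forall x, Cmod (g1 x - g2 x - g3 x * h)%C <= K) ->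
  Cmod (Cmean g1 - Cmean g2 - Cmean g3 * h)%C <= 2 * K.
Proof.
  intros H1 H2 H3 HK.
  destruct (Clipschitz_parts g1 H1) as [A1 B1]. destruct (Clipschitz_parts g2 H2) as [A2 B2].
  destruct (Clipschitz_parts g3 H3) as [A3 B3].
  (* the two components of the remainder are combinations of four means *)
  assert (Hlin : forall (F f1 f2 f3 f4 : R -> R) (p q a1 a2 a3 a4 : R),
    is_lim_seq (fun j => avg j f1) a1 -> is_lim_seq (fun j => avg j f2) a2 ->
    is_lim_seq (fun j => avg j f3) a3 -> is_lim_seq (fun j => avg j f4) a4 ->
    (forall x, F x = f1 x + (-1) * f2 x + p * f3 x + q * f4 x) -> (forall x, Rabs (F x) <= K) ->
    Rabs (a1 + (-1) * a2 + p * a3 + q * a4) <= K).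
  { intros F f1 f2 f3 f4 p q a1 a2 a3 a4 L1 L2 L3 L4 HF HFK.
    apply (lim_bounded (fun j => avg j F)).
    - apply (is_lim_seq_ext (fun j => avg j f1 + (-1) * avg j f2 + p * avg j f3 + q * avg j f4)).
      + intros j. rewrite <- !avg_scal, <- !avg_plus. symmetry. now apply avg_ext.
      + repeat apply is_lim_seq_plus'; auto; now apply (is_lim_seq_scal_l _ _ (Finite _)).
    - intros j. apply Rabs_le_between. rewrite <- (avg_const j K) at 2.
      rewrite <- (avg_const j (- K)). split; apply avg_le; intros x _; specialize (HFK x);
      apply Rabs_le_between in HFK; lra. }
  assert (Hpart : forall x, Rabs (fst (g1 x - g2 x - g3 x * h)%C) <= K /\
     Rabs (snd (g1 x - g2 x - g3 x * h)%C) <= K).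
  { intros x. specialize (HK x). pose proof (Rmax_Cmod (g1 x - g2 x - g3 x * h)%C) as Hm.
    split; (eapply Rle_trans; [|exact HK]); (eapply Rle_trans; [|exact Hm]).
    apply Rmax_l. apply Rmax_r. }
  eapply Rle_trans; [apply Cmod_le_2Rmax|]. apply Rmult_le_compat_l; [lra|]. apply Rmax_lub.
  - replace (fst (Cmean g1 - Cmean g2 - Cmean g3 * h)%C) with
      (fst (Cmean g1) + (-1) * fst (Cmean g2) + (- fst h) * fst (Cmean g3) + snd h * snd (Cmean g3))
      by (simpl; ring).
    apply (Hlin (fun x => fst (g1 x - g2 x - g3 x * h)%C) _ _ _ _ _ _ _ _ _ _ A1 A2 A3 B3);
      [intros x; simpl; ring|apply Hpart].
  - replace (snd (Cmean g1 - Cmean g2 - Cmean g3 * h)%C) with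
      (snd (Cmean g1) + (-1) * snd (Cmean g2) + (- fst h) * snd (Cmean g3) + (- snd h) * fst (Cmean g3))
      by (simpl; ring).
    apply (Hlin (fun x => snd (g1 x - g2 x - g3 x * h)%C) _ _ _ _ _ _ _ _ _ _ B1 B2 B3 A3);
      [intros x; simpl; ring|apply Hpart].
Qed.

Definition kernel_derivative (w z : C) : C := (2 * w / ((w - z) * (w - z)))%C.

Lemma circ_sub_lower (x : R) (z : C) : 1 - Cmod z <= Cmod (circ x - z)%C.
Proof. pose proof (Cmod_sub_lower (circ x) z). rewrite Cmod_circ in H. lra. Qed.

Lemma circ_sub_neq_0 (x : R) (z : C) : Cmod z < 1 -> (circ x - z)%C <> RtoC 0.
Proof. intros Hz. apply Cmod_gt_0. pose proof (circ_sub_lower x z). lra. Qed.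

Lemma herglotz_lipschitz (z : C) : Cmod z < 1 -> Clipschitz (fun x => herglotz (circ x) z).
Proof.
  intros Hz. pose proof (Cmod_ge_0 z) as Hz0.
  exists (4 / (1 - Cmod z) ^ 2). split.
  { left. apply Rdiv_lt_0_compat. lra. apply pow_lt. lra. }
  intros x y. pose proof (circ_sub_neq_0 x z Hz) as Hx. pose proof (circ_sub_neq_0 y z Hz) as Hy.
  replace (herglotz (circ x) z - herglotz (circ y) z)%C with
   (2 * z * (circ y - circ x) / ((circ x - z) * (circ y - z)))%C
   by (unfold herglotz; field; auto).
  rewrite Cmod_div by now apply Cmult_neq_0. rewrite !Cmod_mult, Cmod_R, (Rabs_right 2) by lra.
  pose proof (circ_sub_lower x z). pose proof (circ_sub_lower y z).
  pose proof (circ_dist_le y x) as Hd. rewrite (Rabs_minus_sym y x) in Hd.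
  pose proof (Cmod_ge_0 (circ y - circ x)%C). pose proof (Rabs_pos (x - y)).
  unfold Rdiv. replace (4 * / (1 - Cmod z) ^ 2 * Rabs (x - y)) with
    ((4 * Rabs (x - y)) * / ((1 - Cmod z) * (1 - Cmod z))) by (field; lra).
  apply Rmult_le_compat. repeat apply Rmult_le_pos; lra.
  left. apply Rinv_0_lt_compat. apply Rmult_lt_0_compat; lra. nra.
  apply Rinv_le_contravar. apply Rmult_lt_0_compat; lra. apply Rmult_le_compat; lra.
Qed.

Lemma kernel_derivative_lipschitz (z : C) : Cmod z < 1 ->
  Clipschitz (fun x => kernel_derivative (circ x) z).
Proof.
  intros Hz. pose proof (Cmod_ge_0 z) as Hz0.
  exists (8 / (1 - Cmod z) ^ 4). split.
  { left. apply Rdiv_lt_0_compat. lra. apply pow_lt. lra. }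
  intros x y. pose proof (circ_sub_neq_0 x z Hz) as Hx. pose proof (circ_sub_neq_0 y z Hz) as Hy.
  replace (kernel_derivative (circ x) z - kernel_derivative (circ y) z)%C with
   (2 * ((circ y - circ x) * (circ x * circ y - z * z)) /
     ((circ x - z) * (circ x - z) * ((circ y - z) * (circ y - z))))%C
   by (unfold kernel_derivative; field; auto).
  rewrite Cmod_div by (repeat apply Cmult_neq_0; auto).
  rewrite !Cmod_mult, Cmod_R, (Rabs_right 2) by lra.
  pose proof (circ_sub_lower x z). pose proof (circ_sub_lower y z).
  pose proof (circ_dist_le y x) as Hd. rewrite (Rabs_minus_sym y x) in Hd.
  pose proof (Cmod_ge_0 (circ y - circ x)%C). pose proof (Rabs_pos (x - y)).
  assert (Hq : Cmod (circ x * circ y - z * z)%C <= 2).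
  { eapply Rle_trans; [apply Cmod_triangle_sub|]. rewrite !Cmod_mult, !Cmod_circ. nra. }
  pose proof (Cmod_ge_0 (circ x * circ y - z * z)%C).
  unfold Rdiv. replace (8 * / (1 - Cmod z) ^ 4 * Rabs (x - y)) with
    ((8 * Rabs (x - y)) * / ((1 - Cmod z) * (1 - Cmod z) * ((1 - Cmod z) * (1 - Cmod z)))) by (field; lra).
  apply Rmult_le_compat. repeat apply Rmult_le_pos; lra.
  left. apply Rinv_0_lt_compat. repeat apply Rmult_lt_0_compat; lra.
  { replace (8 * Rabs (x - y)) with (2 * ((2 * Rabs (x - y)) * 2)) by ring.
    apply Rmult_le_compat_l. lra. apply Rmult_le_compat; lra. }
  apply Rinv_le_contravar. repeat apply Rmult_lt_0_compat; lra.
  apply Rmult_le_compat; try (apply Rmult_le_pos; lra); apply Rmult_le_compat; lra.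
Qed.

Definition herglotz_mean (z : C) : C := Cmean (fun x => herglotz (circ x) z).

(** With d = 1 - |z| and |h| <= d/2, the Taylor remainder of the kernel,
    2 w h^2 / ((w - z)^2 (w - z - h)), is at most 4 |h|^2 / d^3 for all w on the circle. *)
Lemma cdiff_herglotz_mean (z : C) : Cmod z < 1 -> cdiff herglotz_mean z.
Proof.
  intros Hz. pose proof (Cmod_ge_0 z) as Hz0.
  exists (Cmean (fun x => kernel_derivative (circ x) z)).
  set (d := 1 - Cmod z). assert (Hd : 0 < d <= 1) by (unfold d; lra).
  assert (Hd3 : 0 < d ^ 3) by (apply pow_lt; lra).
  intros eps He. exists (Rmin (d / 2) (eps * d ^ 3 / 8)). split.
  { apply Rmin_pos; nra. }
  intros h Hh.
  apply Rlt_Rmin in Hh as [Hh1 Hh2].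
  pose proof (Cmod_ge_0 h) as Hh0.
  assert (Hzh : Cmod (z + h)%C < 1) by (pose proof (Cmod_triangle z h); unfold d in *; lra).
  apply Rle_trans with (2 * (4 * (Cmod h * Cmod h) / d ^ 3)).
  - apply Cmean_taylor.
    now apply herglotz_lipschitz. now apply herglotz_lipschitz.
    now apply kernel_derivative_lipschitz.
    intros x. pose proof (circ_sub_neq_0 x z Hz) as Hx. pose proof (circ_sub_neq_0 x _ Hzh) as Hxh.
    replace (herglotz (circ x) (z + h) - herglotz (circ x) z - kernel_derivative (circ x) z * h)%C with
     (2 * circ x * (h * h) / ((circ x - z) * (circ x - z) * (circ x - (z + h))))%C
     by (unfold kernel_derivative, herglotz; field; auto).
    rewrite Cmod_div by (repeat apply Cmult_neq_0; auto).
    rewrite !Cmod_mult, Cmod_R, Cmod_circ, (Rabs_right 2) by lra.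
    pose proof (circ_sub_lower x z) as L1. fold d in L1.
    assert (L2 : d / 2 <= Cmod (circ x - (z + h))%C).
    { pose proof (circ_sub_lower x (z + h)%C). pose proof (Cmod_triangle z h). unfold d in *; lra. }
    unfold Rdiv. replace (4 * (Cmod h * Cmod h) * / d ^ 3) with
     (2 * 1 * (Cmod h * Cmod h) * / (d * d * (d / 2))) by (field; lra).
    apply Rmult_le_compat_l. nra.
    apply Rinv_le_contravar. repeat apply Rmult_lt_0_compat; lra.
    apply Rmult_le_compat; try lra. nra. apply Rmult_le_compat; lra.
  - replace (2 * (4 * (Cmod h * Cmod h) / d ^ 3)) with ((8 * Cmod h / d ^ 3) * Cmod h) by (field; lra).
    apply Rmult_le_compat_r; auto. apply Rle_div_l; auto. lra.
Qed.

Lemma herglotz_mean_re_lim (z : C) : Cmod z < 1 ->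
  is_lim_seq (fun j => avg j (fun x => fst (herglotz (circ x) z))) (fst (herglotz_mean z)).
Proof. intros Hz. exact (proj1 (Clipschitz_parts _ (herglotz_lipschitz z Hz))). Qed.

Lemma herglotz_circ_pos (x : R) (z : C) : Cmod z < 1 -> 0 <= fst (herglotz (circ x) z).
Proof. intros Hz. left. apply herglotz_re_pos. now rewrite Cmod_circ. Qed.

Lemma herglotz_mean_pos (z : C) : Cmod z < 1 -> 0 <= fst (herglotz_mean z).
Proof.
  intros Hz. pose proof (herglotz_mean_re_lim z Hz) as H.
  apply (is_lim_seq_le (fun _ => 0) _ 0 (Finite (fst (herglotz_mean z))) ) in H; auto.
  intros j. rewrite <- (avg_const j 0). apply avg_le. intros. now apply herglotz_circ_pos.
  apply is_lim_seq_const.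
Qed.

(** A window of b consecutive children has width T = b g and carries the mass
    b / (n m k), where n counts the arcs of stage k. From height about T every point of
    it is seen under a kernel of size at least 1 / (18 T), and b / (n m k T) is
    1 / (n l k), whatever b is. *)
Lemma herglotz_mean_lower (k a b : nat) (x th t : R) :
  In x (gen m l k) -> (1 <= b)%nat -> (a + b <= m k)%nat ->
  (let g := l k / INR (m k) in
   x + INR a * g <= th <= x + INR (a + b) * g /\ INR b * g / 2 <= t <= INR b * g) ->
  / (18 * (INR (length (gen m l k)) * l k)) <=
    fst (herglotz_mean (RtoC (1 - t) * circ th)).
Proof.
  intros Hx Hb Hab [Hth Ht]. set (g := l k / INR (m k)) in *.
  pose proof (tree_m_INR _ _ HT k) as Hm. pose proof (tree_pos _ _ HT k) as Hl.
  assert (Hg : 0 < g) by (apply Rdiv_lt_0_compat; lra).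
  assert (HbR : 1 <= INR b) by now apply INR_ge_1.
  assert (HabR : INR a + INR b <= INR (m k)) by (rewrite <- plus_INR; now apply le_INR).
  assert (HTl : INR b * g <= l k).
  { replace (l k) with (INR (m k) * g) by (unfold g; field; lra).
    apply Rmult_le_compat_r; [lra|]. pose proof (pos_INR a). lra. }
  pose proof (tree_le _ _ HT k) as Hl8.
  set (T := INR b * g) in *. assert (HT0 : 0 < T) by (unfold T; nra).
  set (z := (RtoC (1 - t) * circ th)%C).
  assert (Hz : Cmod z = 1 - t).
  { unfold z. rewrite Cmod_mult, Cmod_R, Cmod_circ, Rabs_right; lra. }
  assert (Hz1 : Cmod z < 1) by lra.
  set (v := / (18 * T)). assert (Hv : 0 < v) by (apply Rinv_0_lt_compat; lra).
  (* the window and the height of z have the same size T, so the kernel is of size 1/T *)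
  assert (Hker : forall y, x + INR a * g <= y <= x + INR (a + b) * g ->
    v <= fst (herglotz (circ y) z)).
  { intros y Hy. rewrite plus_INR in *.
    assert (Hd : Cmod (circ y - z)%C <= 3 * T).
    { pose proof (Cmod_triangle (circ y - circ th)%C (circ th - z)%C) as Htri.
      replace (circ y - circ th + (circ th - z))%C with (circ y - z)%C in Htri by ring.
      pose proof (circ_dist_le y th) as H1.
      assert (H2 : Rabs (y - th) <= T) by (apply Rabs_le_between; unfold T; lra).
      replace (circ th - z)%C with (RtoC t * circ th)%C in Htri.
      2:{ unfold z. rewrite RtoC_minus. ring. }
      rewrite Cmod_mult, Cmod_R, Cmod_circ, Rabs_right in Htri by lra. lra. }
    assert (Hne : 0 < Cmod (circ y - z)%C) by (pose proof (circ_sub_lower y z); lra).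
    rewrite herglotz_re.
    2:{ intros E. rewrite <- E, Cmod_circ in Hz1. lra. }
    rewrite Cmod_circ, Hz. apply (Rle_div_r _ _ (Cmod (circ y - z)%C ^ 2)).
    { apply Rlt_gt. now apply pow_lt. }
    assert (Cmod (circ y - z)%C ^ 2 <= 9 * T ^ 2) by nra.
    apply Rle_trans with (v * (9 * T ^ 2)). apply Rmult_le_compat_l; lra.
    replace (v * (9 * T ^ 2)) with (T / 2) by (unfold v; field; lra).
    simpl. nra. }
  set (F := fun y => fst (herglotz (circ y) z)) in *.
  assert (HF0 : forall y, 0 <= F y) by (intros; now apply herglotz_circ_pos).
  assert (Hav : forall i, / (18 * (INR (length (gen m l k)) * l k)) <= avg (i + S k) F).
  { intros i. rewrite (Nat.add_comm i (S k)).
    set (q := INR (nprod m (S k) i)).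
    assert (HE : INR (length (gen m l (S k + i))) = INR (length (gen m l k)) * INR (m k) * q).
    { rewrite length_gen_add. fold q. f_equal.
      rewrite <- mult_INR. f_equal. rewrite !gen_length. simpl. reflexivity. }
    pose proof (length_gen_pos (S k + i)) as Hpos. pose proof (length_gen_pos k) as Hposk.
    assert (Hq : 0 < q).
    { rewrite HE in Hpos. assert (0 < INR (length (gen m l k)) * INR (m k)) by nra.
      unfold q in *. pose proof (pos_INR (nprod m (S k) i)). nra. }
    assert (Hsum : INR b * (q * v) <= lsum F (gen m l (S k + i))).
    { rewrite gen_add, lsum_flat_map.
      change (gen m l (S k)) with (flat_map (children m l k) (gen m l k)).
      rewrite lsum_flat_map.
      set (Gs := fun y => lsum F (desc m l (S k) i y)).
      assert (HG0 : forall y, 0 <= Gs y) by (intros; apply lsum_nonneg; auto).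
      eapply Rle_trans; [|apply (lsum_ge_term (fun y => lsum Gs (children m l k y)) _ x); auto].
      2:{ intros; apply lsum_nonneg; auto. }
      unfold children. rewrite lsum_map. fold g.
      replace (m k) with (a + (b + (m k - a - b)))%nat by lia.
      rewrite !seq_app, !lsum_app.
      assert (N1 : 0 <= lsum (fun u => Gs (x + INR u * g)) (seq 0 a)) by (apply lsum_nonneg; auto).
      assert (N2 : 0 <= lsum (fun u => Gs (x + INR u * g)) (seq (0 + a + b) (m k - a - b)))
        by (apply lsum_nonneg; auto).
      assert (N3 : INR b * (q * v) <= lsum (fun u => Gs (x + INR u * g)) (seq (0 + a) b)).
      { rewrite <- (length_seq b (0 + a)) at 1. rewrite <- lsum_const. apply lsum_le.
        intros u Hu. apply in_seq in Hu. unfold Gs, q. rewrite <- (length_desc m l (S k) i (x + INR u * g)).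
        rewrite <- lsum_const. apply lsum_le. intros y Hy. apply Hker.
        apply (desc_range _ _ HT) in Hy. pose proof (tree_gap _ _ HT k) as Hgap. fold g in Hgap.
        pose proof (tree_pos _ _ HT (S k + i)).
        assert (INR a <= INR u) by (apply le_INR; lia).
        assert (INR u + 1 <= INR (a + b)) by (apply INR_lt_succ; lia).
        split; nra. }
      lra. }
    unfold avg. apply (Rle_div_r _ _ (INR (length (gen m l (S k + i))))); [lra|].
    eapply Rle_trans; [|exact Hsum]. rewrite HE. right. unfold v, T, g.
    field. repeat split; lra. }
  pose proof (herglotz_mean_re_lim z Hz1) as H. apply (is_lim_seq_incr_n _ (S k)) in H.
  apply (is_lim_seq_le (fun _ => / (18 * (INR (length (gen m l k)) * l k))) _
    (/ (18 * (INR (length (gen m l k)) * l k))) (Finite (fst (herglotz_mean z)))) in H; auto.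
  apply is_lim_seq_const.
Qed.

End Mean.

(** * Scales adapted to the growth function *)

Fixpoint capped_log2 (x : R) (c : nat) : nat :=
  match c with
  | O => O
  | S b => let j := capped_log2 x b in if Rle_dec x (2 ^ j) then j else S j
  end.

Lemma capped_log2_spec (x : R) (c : nat) :
  (capped_log2 x c <= c)%nat /\ (x <= 2 ^ capped_log2 x c \/ capped_log2 x c = c) /\
  (forall i, (i < capped_log2 x c)%nat -> 2 ^ i < x).
Proof.
  induction c as [|c [H1 [H2 H3]]]; simpl.
  - repeat split; auto. intros; lia.
  - destruct (Rle_dec x (2 ^ capped_log2 x c)) as [H|H].
    + repeat split; auto.
    + destruct H2 as [H2|H2]; [contradiction|]. rewrite H2 in *. repeat split; auto.
      intros i Hi. destruct (Nat.eq_dec i c) as [->|]. lra. apply H3. lia.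
Qed.

Lemma capped_log2_mono (x y : R) (c d : nat) : x <= y -> (c <= d)%nat ->
  (capped_log2 x c <= capped_log2 y d)%nat.
Proof.
  intros Hxy Hcd. destruct (capped_log2_spec x c) as [A1 [_ A3]].
  destruct (capped_log2_spec y d) as [_ [B2 _]].
  destruct (Nat.le_gt_cases (capped_log2 x c) (capped_log2 y d)) as [|H]; auto. exfalso.
  specialize (A3 _ H). destruct B2 as [B2|B2]. lra. lia.
Qed.

Lemma capped_log2_upper (x : R) (c : nat) : 0 <= x -> 2 ^ capped_log2 x c <= 2 * x + 1.
Proof.
  intros Hx. destruct (capped_log2_spec x c) as [_ [_ H]].
  destruct (capped_log2 x c) as [|j]. simpl; lra.
  specialize (H j ltac:(lia)). simpl. lra.
Qed.

Definition expo (k : nat) : nat := (2 ^ (k + 3))%nat.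
Definition scale (k : nat) : R := / 2 ^ expo k.

Lemma expo_S (k : nat) : expo (S k) = (expo k + expo k)%nat.
Proof. unfold expo. simpl. lia. Qed.

Lemma square_le_pow2 (k : nat) : (S k * S k <= 2 ^ (k + 2))%nat.
Proof.
  induction k as [|k IH]. simpl; lia.
  destruct k as [|k]. simpl; lia. destruct k as [|k]. simpl; lia.
  replace (S (S (S k)) + 2)%nat with (S (S (S k) + 2)) by lia.
  rewrite Nat.pow_succ_r'. nia.
Qed.

Lemma scale_pos (k : nat) : 0 < scale k.
Proof. apply Rinv_0_lt_compat, pow_lt. lra. Qed.

Lemma expo_ge (k : nat) : (8 <= expo k)%nat.
Proof. unfold expo. pose proof (Nat.pow_le_mono_r 2 3 (k + 3) ltac:(lia) ltac:(lia)). simpl in *. lia. Qed.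

Lemma scale_le (k : nat) : scale k <= 1 / 8.
Proof.
  unfold scale. replace (1 / 8) with (/ 2 ^ 3) by (simpl; lra).
  apply Rinv_le_contravar. apply pow_lt; lra. apply Rle_pow. lra. pose proof (expo_ge k). lia.
Qed.

Lemma scale_range (k : nat) : 0 < scale k < 1.
Proof. pose proof (scale_pos k). pose proof (scale_le k). lra. Qed.

Lemma scale_lim : is_lim_seq scale 0.
Proof.
  apply (is_lim_seq_le_le (fun _ => 0) _ (fun k => (/ 2) ^ k)).
  - intros k. split. left; apply scale_pos. unfold scale. rewrite pow_inv.
    apply Rinv_le_contravar. apply pow_lt; lra. apply Rle_pow. lra. unfold expo.
    pose proof (Nat.pow_gt_lin_r 2 k ltac:(lia)).
    pose proof (Nat.pow_le_mono_r 2 k (k + 3) ltac:(lia) ltac:(lia)). lia.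
  - apply is_lim_seq_const.
  - apply is_lim_seq_geom. rewrite Rabs_right; lra.
Qed.

Section Scales.
Variable Mk : nat -> R.
Hypothesis Mk_mono : forall k, Mk k <= Mk (S k).

(** The boundary set of stage k has length about 2^(- depth k). Up to constants this is the
    reciprocal of Mk k; the cap k^2 only matters when Mk k > 2^(k^2), and the total
    weight of such stages is finite (lost_bounded). The cap also leaves at least
    half of the dyadic levels between two scales free of thinning (levels_ge). *)
Definition depth (k : nat) : nat := capped_log2 (Mk k) (k * k).

Lemma depth_mono (k : nat) : (depth k <= depth (S k))%nat.
Proof. apply capped_log2_mono. apply Mk_mono. nia. Qed.

Lemma depth_le (k : nat) : (depth k <= k * k)%nat.
Proof. apply (capped_log2_spec (Mk k) (k * k)). Qed.

(** The number of dyadic heights between an arc and its cells; the remaining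
    factor 2 ^ (depth (S k) - depth k) is spent on thinning inside the cells. *)
Definition levels (k : nat) : nat := (expo k - (depth (S k) - depth k))%nat.

Lemma levels_eq (k : nat) : (levels k + (depth (S k) - depth k) = expo k)%nat.
Proof.
  unfold levels. pose proof (depth_le (S k)). pose proof (square_le_pow2 k).
  unfold expo. replace (k + 3)%nat with (S (k + 2)) by lia. rewrite Nat.pow_succ_r'. lia.
Qed.

Lemma levels_ge (k : nat) : (2 ^ (k + 2) <= levels k)%nat.
Proof.
  unfold levels. pose proof (depth_le (S k)). pose proof (square_le_pow2 k).
  unfold expo. replace (k + 3)%nat with (S (k + 2)) by lia. rewrite Nat.pow_succ_r'. lia.
Qed.

Definition branch (k : nat) : nat := (2 ^ levels k)%nat.

Lemma INR_branch (k : nat) : INR (branch k) = 2 ^ levels k.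
Proof. unfold branch. rewrite pow_INR. reflexivity. Qed.

Lemma branch_scale (k : nat) : scale k / INR (branch k) = 2 ^ (depth (S k) - depth k) * scale (S k).
Proof.
  rewrite INR_branch. unfold scale. rewrite expo_S, pow_add.
  replace (2 ^ expo k) with (2 ^ levels k * 2 ^ (depth (S k) - depth k)) at 2
    by (rewrite <- pow_add; f_equal; apply levels_eq).
  field. repeat split; apply pow_nonzero; lra.
Qed.

Lemma param_tree : tree branch scale.
Proof.
  constructor.
  - intros k. unfold branch. pose proof (Nat.pow_nonzero 2 (levels k)). lia.
  - apply scale_pos.
  - intros k. assert (H : 0 < INR (branch k)) by (rewrite INR_branch; apply pow_lt; lra).
    rewrite Rmult_comm. apply (Rle_div_r _ _ (INR (branch k))); auto. rewrite branch_scale.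
    pose proof (scale_pos (S k)). pose proof (pow_R1_Rle 2 (depth (S k) - depth k) ltac:(lra)). nra.
  - apply scale_le.
Qed.


Lemma param_length (k : nat) :
  INR (length (gen branch scale k)) * scale k = / (2 ^ 8 * 2 ^ depth k).
Proof.
  assert (E : (nprod branch 0 k * 2 ^ depth k * 2 ^ 8 = 2 ^ expo k)%nat).
  { induction k as [|k IH].
    - reflexivity.
    - change (nprod branch 0 (S k)) with (nprod branch 0 k * branch k)%nat.
      rewrite expo_S, Nat.pow_add_r, <- IH at 1.
      rewrite <- (levels_eq k), Nat.pow_add_r. fold (branch k).
      assert (Hd : (2 ^ depth (S k) = 2 ^ depth k * 2 ^ (depth (S k) - depth k))%nat).
      { rewrite <- Nat.pow_add_r. f_equal. pose proof (depth_mono k). lia. }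
      rewrite Hd. ring. }
  rewrite gen_length. unfold scale. apply (f_equal INR) in E.
  rewrite !mult_INR, !pow_INR in E. change (INR 2) with 2 in E. rewrite <- E.
  assert (Hn : INR (nprod branch 0 k) <> 0).
  { intros H. rewrite H in E. rewrite !Rmult_0_l in E. symmetry in E. revert E. apply pow_nonzero. lra. }
  field. repeat split; auto; apply pow_nonzero; lra.
Qed.

End Scales.

(** * Grids of zeros over the boundary sets *)

Section Grid.
Variable Mk : nat -> R.
Hypothesis Mk_mono : forall k, Mk k <= Mk (S k).
Variable q : nat -> nat.
Hypothesis Hq : forall k, (1 <= q k)%nat.

Let m := branch Mk.
Let HT : tree m scale := param_tree Mk.

Definition side (k i : nat) : R := scale k / 2 ^ i.
(** The rows fill the upper half of the dyadic square of side side k i, so that rows of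
    different squares do not meet. *)
Definition height (k i v : nat) : R := side k i * INR (q k + 1 + v) / (2 * INR (q k)).
Definition angle (k i : nat) (x : R) (u : nat) : R := x + INR u * (side k i / INR (q k)).
Definition grid_point (k i v : nat) (x : R) (u : nat) : C :=
  (RtoC (1 - height k i v) * circ (angle k i x u))%C.

Definition grid (k : nat) : list C :=
  flat_map (fun i => flat_map (fun v => flat_map (fun x =>
    map (grid_point k i v x) (seq 0 (q k * 2 ^ i))) (gen m scale k))
      (seq 0 (q k))) (seq 0 (levels Mk k)).

Definition grid_index (k i v : nat) (x : R) (u : nat) : Prop :=
  (i < levels Mk k)%nat /\ (v < q k)%nat /\ In x (gen m scale k) /\ (u < q k * 2 ^ i)%nat.

Lemma in_grid (k : nat) (p : C) : In p (grid k) ->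
  exists i v x u, grid_index k i v x u /\ p = grid_point k i v x u.
Proof.
  intros H. apply in_flat_map in H. destruct H as [i [Hi H]].
  apply in_flat_map in H. destruct H as [v [Hv H]].
  apply in_flat_map in H. destruct H as [x [Hx H]].
  apply in_map_iff in H. destruct H as [u [<- Hu]].
  apply in_seq in Hi, Hv, Hu. exists i, v, x, u. split; auto.
  repeat split; auto; lia.
Qed.

Lemma q_INR (k : nat) : 1 <= INR (q k).
Proof. apply INR_ge_1, Hq. Qed.

Lemma side_pos (k i : nat) : 0 < side k i.
Proof. unfold side. apply Rdiv_lt_0_compat. apply scale_pos. apply pow_lt; lra. Qed.

Lemma side_half (k i j : nat) : (i < j)%nat -> side k j <= side k i / 2.
Proof.
  intros H. replace j with (i + S (j - i - 1))%nat by lia.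
  unfold side. rewrite pow_add. pose proof (scale_pos k).
  pose proof (pow2_pos i) as Hi.
  pose proof (pow_R1_Rle 2 (j - i - 1) ltac:(lra)) as Hj.
  simpl. set (y := 2 ^ (j - i - 1)) in *.
  replace (scale k / (2 ^ i * (2 * y))) with (scale k / 2 ^ i / 2 * / y) by (field; lra).
  assert (0 < scale k / 2 ^ i) by now apply Rdiv_lt_0_compat.
  rewrite <- (Rmult_1_r (scale k / 2 ^ i / 2)) at 2. apply Rmult_le_compat_l. lra.
  rewrite <- Rinv_1. apply Rinv_le_contravar; lra.
Qed.

Lemma side_le (k i : nat) : side k i <= scale k.
Proof.
  unfold side. pose proof (scale_pos k). pose proof (pow_R1_Rle 2 i ltac:(lra)).
  apply Rle_div_l; [lra|]. nra.
Qed.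

Lemma side_next (k i : nat) : (i < levels Mk k)%nat -> scale (S k) <= side k i / 2.
Proof.
  intros H. apply Rle_trans with (side k (levels Mk k)); [|now apply side_half].
  pose proof (tree_gap _ _ HT k) as Hg. unfold m in Hg. rewrite INR_branch in Hg. exact Hg.
Qed.

Lemma height_range (k i v : nat) : (v < q k)%nat ->
  side k i / 2 + side k i / (2 * INR (q k)) <= height k i v <= side k i.
Proof.
  intros Hv. pose proof (q_INR k). pose proof (side_pos k i). pose proof (pos_INR v).
  assert (INR v + 1 <= INR (q k)) by (apply INR_lt_succ; lia).
  unfold height. rewrite !plus_INR. simpl INR.
  replace (side k i / 2 + side k i / (2 * INR (q k))) with
    (side k i * (INR (q k) + 1) / (2 * INR (q k))) by (field; lra).
  split.
  - apply Rmult_le_compat_r. left; apply Rinv_0_lt_compat; lra. nra.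
  - apply (Rle_div_l _ _ (2 * INR (q k))). lra. nra.
Qed.

Definition row_before (k i v k' i' v' : nat) : Prop :=
  (k < k')%nat \/ (k = k' /\ ((i < i')%nat \/ (i = i' /\ (v' < v)%nat))).

Lemma row_gap (k i v k' i' v' : nat) :
  (i < levels Mk k)%nat -> (v < q k)%nat -> (v' < q k')%nat ->
  row_before k i v k' i' v' ->
  height k' i' v' + side k i / (2 * INR (q k)) <= height k i v.
Proof.
  intros Hi Hv Hv' [Hk|[<- [Hii|[<- Hvv]]]].
  - pose proof (height_range k i v Hv). pose proof (height_range k' i' v' Hv').
    pose proof (side_le k' i'). pose proof (tree_decr _ _ HT (S k) k' ltac:(lia)).
    pose proof (side_next k i Hi). lra.
  - pose proof (height_range k i v Hv). pose proof (height_range k i' v' Hv').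
    pose proof (side_half k i i' Hii). lra.
  - unfold height. rewrite !plus_INR. simpl INR. pose proof (q_INR k). pose proof (side_pos k i).
    assert (INR v' + 1 <= INR v) by (apply INR_lt_succ; lia).
    replace (side k i * (INR (q k) + 1 + INR v') / (2 * INR (q k)) + side k i / (2 * INR (q k)))
     with (side k i * (INR (q k) + 2 + INR v') / (2 * INR (q k))) by (field; lra).
    apply Rmult_le_compat_r. left; apply Rinv_0_lt_compat; lra. nra.
Qed.

Lemma height_bounds (k i v : nat) : (i < levels Mk k)%nat -> (v < q k)%nat ->
  scale (S k) <= height k i v <= scale k.
Proof.
  intros Hi Hv. pose proof (height_range k i v Hv). pose proof (side_next k i Hi).
  pose proof (side_le k i). pose proof (q_INR k). pose proof (side_pos k i).
  assert (0 < side k i / (2 * INR (q k))) by (apply Rdiv_lt_0_compat; lra). lra.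
Qed.

Lemma angle_range (k i : nat) (x : R) (u : nat) : (u < q k * 2 ^ i)%nat ->
  x <= angle k i x u /\ angle k i x u + side k i / INR (q k) <= x + scale k.
Proof.
  intros Hu. pose proof (q_INR k). pose proof (side_pos k i). pose proof (pos_INR u).
  set (g := side k i / INR (q k)). assert (Hg : 0 < g) by (apply Rdiv_lt_0_compat; lra).
  assert (Hs : scale k = INR (q k * 2 ^ i) * g).
  { rewrite mult_INR, pow_INR. change (INR 2) with 2. unfold g, side. field.
    split; try lra; apply pow_nonzero; lra. }
  assert (INR u + 1 <= INR (q k * 2 ^ i)) by (apply INR_lt_succ; lia).
  unfold angle. fold g. rewrite Hs. split; nra.
Qed.

Lemma angle_unit (k i v : nat) (x : R) (u : nat) : grid_index k i v x u ->
  0 <= angle k i x u <= 1.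
Proof.
  intros (Hi & Hv & Hx & Hu). pose proof (angle_range k i x u Hu).
  pose proof (gen_range _ _ HT k x Hx). pose proof (q_INR k). pose proof (side_pos k i).
  assert (0 < side k i / INR (q k)) by (apply Rdiv_lt_0_compat; lra). lra.
Qed.

Lemma Cmod_grid_point (k i v : nat) (x : R) (u : nat) : grid_index k i v x u ->
  Cmod (grid_point k i v x u) = 1 - height k i v.
Proof.
  intros (Hi & Hv & Hx & Hu). pose proof (height_bounds k i v Hi Hv). pose proof (scale_le k).
  unfold grid_point. rewrite Cmod_mult, Cmod_R, Cmod_circ, Rabs_right; lra.
Qed.

Lemma angle_gap (k i v : nat) (x x' : R) (u u' : nat) :
  grid_index k i v x u -> grid_index k i v x' u' -> (x <> x' \/ u <> u') ->
  side k i / INR (q k) <= Rabs (angle k i x u - angle k i x' u').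
Proof.
  intros (Hi & Hv & Hx & Hu) (_ & _ & Hx' & Hu') Hne.
  pose proof (q_INR k). pose proof (side_pos k i).
  set (g := side k i / INR (q k)). assert (Hg : 0 < g) by (apply Rdiv_lt_0_compat; lra).
  destruct (Req_dec x x') as [->|Hxx].
  - destruct Hne as [Hne|Hne]; [congruence|]. unfold angle. fold g.
    replace (x' + INR u * g - (x' + INR u' * g)) with ((INR u - INR u') * g) by ring.
    rewrite Rabs_mult, (Rabs_right g) by lra.
    pose proof (INR_apart u u' Hne).
    nra.
  - pose proof (proj2 (gen_separated _ _ HT k) x x' Hx Hx' Hxx) as Hsep.
    pose proof (angle_range k i x u Hu) as A1. pose proof (angle_range k i x' u' Hu') as A2.
    fold g in A1, A2.
    unfold Rabs in *. destruct (Rcase_abs (x - x'));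
      destruct (Rcase_abs (angle k i x u - angle k i x' u')); lra.
Qed.

(** Different rows differ in height by side / (2 q), points of one row in angle by
    side / q, where side belongs to the larger height. As Qr is nondecreasing, the later
    point contributes no more than the earlier one. *)
Lemma grid_separated (Qr : nat -> R) (k i v : nat) (x : R) (u : nat) (k' i' v' : nat) (x' : R) (u' : nat) :
  (forall j, INR (q j) <= Qr j) -> (forall a b, (a <= b)%nat -> Qr a <= Qr b) ->
  grid_index k i v x u -> grid_index k' i' v' x' u' ->
  (k, i, v, x, u) <> (k', i', v', x', u') ->
  height k i v / (4 * Qr k) + height k' i' v' / (4 * Qr k') <=
    Cmod (grid_point k i v x u - grid_point k' i' v' x' u')%C.
Proof.
  intros HQ HQm.
  assert (Hrow : forall k i v x u k' i' v' x' u', grid_index k i v x u -> grid_index k' i' v' x' u' ->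
    row_before k i v k' i' v' ->
    height k i v / (4 * Qr k) + height k' i' v' / (4 * Qr k') <=
    Cmod (grid_point k i v x u - grid_point k' i' v' x' u')%C).
  { clear k i v x u k' i' v' x' u'. intros k i v x u k' i' v' x' u' H H' Hr.
    assert (Hkk : (k <= k')%nat) by (destruct Hr as [?|[? _]]; lia).
    pose proof (Cmod_sub_lower (grid_point k' i' v' x' u') (grid_point k i v x u)) as Hd.
    rewrite Cmod_sub_comm, !Cmod_grid_point in Hd by auto.
    destruct H as (Hi & Hv & Hx & Hu). destruct H' as (Hi' & Hv' & Hx' & Hu').
    pose proof (row_gap k i v k' i' v' Hi Hv Hv' Hr) as Hg.
    pose proof (height_range k i v Hv) as R1. pose proof (height_bounds k' i' v' Hi' Hv') as R2.
    pose proof (scale_pos (S k')). pose proof (q_INR k). pose proof (HQ k). pose proof (HQm k k' Hkk).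
    pose proof (side_pos k i).
    assert (Ht : height k' i' v' <= height k i v).
    { assert (0 < side k i / (2 * INR (q k))) by (apply Rdiv_lt_0_compat; lra). lra. }
    assert (E1 : height k' i' v' / (4 * Qr k') <= height k i v / (4 * Qr k)).
    { apply Rdiv_le_div; lra. }
    assert (E2 : height k i v / (4 * Qr k) + height k i v / (4 * Qr k) <= side k i / (2 * INR (q k))).
    { replace (height k i v / (4 * Qr k) + height k i v / (4 * Qr k)) with
       (height k i v / (2 * Qr k)) by (field; lra).
      apply Rdiv_le_div; lra. }
    lra. }
  intros H H' Hne.
  destruct (excluded_middle_informative (row_before k i v k' i' v')) as [R1|R1]; [now apply Hrow|].
  destruct (excluded_middle_informative (row_before k' i' v' k i v)) as [R2|R2].
  { rewrite Cmod_sub_comm, Rplus_comm. now apply Hrow. }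
  unfold row_before in R1, R2.
  assert (Ek : k = k') by lia. subst k'.
  assert (Ei : i = i') by lia. subst i'.
  assert (Ev : v = v') by lia. subst v'.
  assert (Hxu : x <> x' \/ u <> u').
  { destruct (Req_dec x x') as [->|]; auto. }
  pose proof (angle_gap k i v x x' u u' H H' Hxu) as Hg.
  pose proof (circ_dist_ge _ _ (angle_unit k i v x u H) (angle_unit k i v x' u' H')) as Hc.
  destruct H as (Hi & Hv & Hx & Hu).
  pose proof (height_range k i v Hv) as Hr1. pose proof (height_bounds k i v Hi Hv) as Hr2.
  pose proof (scale_le k). pose proof (side_pos k i). pose proof (q_INR k). pose proof (HQ k).
  pose proof (scale_pos (S k)).
  unfold grid_point.
  replace (RtoC (1 - height k i v) * circ (angle k i x u) - RtoC (1 - height k i v) * circ (angle k i x' u'))%C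
   with (RtoC (1 - height k i v) * (circ (angle k i x u) - circ (angle k i x' u')))%C by ring.
  rewrite Cmod_mult, Cmod_R, Rabs_right by lra.
  set (g := side k i / INR (q k)) in *. assert (Hg0 : 0 < g) by (apply Rdiv_lt_0_compat; lra).
  replace (height k i v / (4 * Qr k) + height k i v / (4 * Qr k)) with
       (1 / 2 * (height k i v / Qr k)) by (field; lra).
  assert (height k i v / Qr k <= g).
  { unfold g. apply Rdiv_le_div; lra. }
  assert (0 <= height k i v / Qr k) by (apply Rmult_le_pos; [lra|left; apply Rinv_0_lt_compat; lra]).
  nra.
Qed.

Lemma grid_point_inj (k i v : nat) (x : R) (u : nat) (k' i' v' : nat) (x' : R) (u' : nat) :
  grid_index k i v x u -> grid_index k' i' v' x' u' ->
  grid_point k i v x u = grid_point k' i' v' x' u' ->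
  (k, i, v, x, u) = (k', i', v', x', u').
Proof.
  intros H H' E. destruct (excluded_middle_informative ((k, i, v, x, u) = (k', i', v', x', u'))) as [|Hne]; auto.
  exfalso.
  set (Qr := fun n => lsum (fun j => INR (q j)) (seq 0 (S n))).
  assert (Hm : forall n, INR (q n) <= Qr n).
  { intros n. apply (lsum_ge_term (fun j => INR (q j))); [intros; apply pos_INR|].
    apply in_seq. lia. }
  assert (HQm : forall a b, (a <= b)%nat -> Qr a <= Qr b).
  { intros a b Hab. unfold Qr. replace (S b) with (S a + (b - a))%nat by lia.
    rewrite seq_app, lsum_app.
    pose proof (lsum_nonneg (fun j => INR (q j)) (seq (0 + S a) (b - a)) ltac:(intros; apply pos_INR)).
    lra. }
  pose proof (grid_separated Qr k i v x u k' i' v' x' u' Hm HQm H H' Hne) as Hs.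
  rewrite E in Hs. replace (grid_point k' i' v' x' u' - grid_point k' i' v' x' u')%C with (RtoC 0) in Hs by ring.
  rewrite Cmod_0 in Hs.
  destruct H as (Hi & Hv & _). destruct H' as (Hi' & Hv' & _).
  pose proof (height_bounds k i v Hi Hv). pose proof (height_bounds k' i' v' Hi' Hv').
  pose proof (scale_pos (S k)). pose proof (scale_pos (S k')).
  pose proof (q_INR k). pose proof (q_INR k'). pose proof (Hm k). pose proof (Hm k').
  assert (0 < height k i v / (4 * Qr k)) by (apply Rdiv_lt_0_compat; lra).
  assert (0 < height k' i' v' / (4 * Qr k')) by (apply Rdiv_lt_0_compat; lra). lra.
Qed.

Lemma NoDup_grid (k : nat) : NoDup (grid k).
Proof.
  (* two descriptions of one point have the same indices, level by level *)
  Ltac unpack := repeat match goal with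
    | H : In _ (seq _ _) |- _ => apply in_seq in H
    | H : In _ (flat_map _ _) |- _ => apply in_flat_map in H; destruct H as [? [? H]]
    | H : In _ (map _ _) |- _ => apply in_map_iff in H; destruct H as [? [? H]]
    end.
  Ltac same_index := intros; unpack; subst;
    match goal with E : grid_point _ _ _ _ _ = grid_point _ _ _ _ _ |- _ =>
      apply grid_point_inj in E; [congruence| |]; repeat split; auto; lia end.
  unfold grid. apply NoDup_flat_map; [apply seq_NoDup| |same_index].
  intros i Hi. apply NoDup_flat_map; [apply seq_NoDup| |same_index].
  intros v Hv. apply NoDup_flat_map; [apply (gen_separated _ _ HT)| |same_index].
  intros x Hx. apply NoDup_map_NoDup_ForallPairs; [|apply seq_NoDup].
  intros u u' Hu Hu' E. same_index.
Qed.

Lemma grid_disjoint (k k' : nat) (p : C) : In p (grid k) -> In p (grid k') -> k = k'.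
Proof.
  intros H H'. destruct (in_grid k p H) as [i [v [x [u [I1 E1]]]]].
  destruct (in_grid k' p H') as [i' [v' [x' [u' [I2 E2]]]]].
  pose proof (grid_point_inj _ _ _ _ _ _ _ _ _ _ I1 I2 ltac:(congruence)). congruence.
Qed.

Lemma grid_mass (k : nat) :
  INR (levels Mk k) * INR (q k) ^ 2 * / (2 * (2 ^ 8 * 2 ^ depth Mk k)) <=
  lsum (fun p => 1 - Cmod p) (grid k).
Proof.
  unfold grid. rewrite lsum_flat_map.
  rewrite <- (length_seq (levels Mk k) 0) at 1. rewrite Rmult_assoc, <- lsum_const.
  apply lsum_le. intros i Hi. apply in_seq in Hi. rewrite lsum_flat_map.
  pose proof (q_INR k) as Hq1.
  set (c := / (2 * (2 ^ 8 * 2 ^ depth Mk k))).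
  replace (INR (q k) ^ 2 * c) with (INR (length (seq 0 (q k))) * (INR (q k) * c))
    by (rewrite length_seq; ring).
  rewrite <- lsum_const. apply lsum_le. intros v Hv. apply in_seq in Hv. rewrite lsum_flat_map.
  apply Rle_trans with (INR (length (gen m scale k)) *
    (INR (length (seq 0 (q k * 2 ^ i))) * (side k i / 2))).
  - rewrite length_seq, mult_INR, pow_INR. change (INR 2) with 2.
    right. unfold c. rewrite Rinv_mult, <- (param_length Mk Mk_mono k). fold m. unfold side. field.
    apply pow_nonzero; lra.
  - rewrite <- !lsum_const. apply lsum_le. intros x Hx. rewrite lsum_map.
    apply lsum_le. intros u Hu. apply in_seq in Hu.
    rewrite Cmod_grid_point by (repeat split; auto; lia).
    pose proof (height_range k i v ltac:(lia)). pose proof (side_pos k i).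
    assert (0 < side k i / (2 * INR (q k))) by (apply Rdiv_lt_0_compat; lra). lra.
Qed.

(** The window used in herglotz_mean_lower is the dyadic subarc of length side k i below
    the point: the a-th block of 2 ^ (levels k - i) children. *)
Lemma herglotz_mean_grid (k : nat) (p : C) : In p (grid k) ->
  2 ^ depth Mk k <= fst (herglotz_mean m scale p).
Proof.
  intros Hp. destruct (in_grid k p Hp) as [i [v [x [u [I ->]]]]].
  destruct I as (Hi & Hv & Hx & Hu).
  set (b := (2 ^ (levels Mk k - i))%nat).
  assert (Hm : (2 ^ i * b = m k)%nat).
  { unfold b, m, branch. rewrite <- Nat.pow_add_r. f_equal. lia. }
  assert (Hb1 : (1 <= b)%nat) by (unfold b; pose proof (Nat.pow_nonzero 2 (levels Mk k - i)); lia).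
  set (a := (u / q k)%nat).
  assert (Ha : (a < 2 ^ i)%nat).
  { unfold a. apply Nat.Div0.div_lt_upper_bound. exact Hu. }
  assert (Hdiv : (q k * a <= u < q k * S a)%nat).
  { unfold a. split. apply Nat.Div0.mul_div_le. apply Nat.mul_succ_div_gt. pose proof (Hq k). lia. }
  pose proof (herglotz_mean_lower m scale HT scale_lim k (a * b) b x (angle k i x u) (height k i v) Hx Hb1) as HL.
  assert (Hab : (a * b + b <= m k)%nat) by (rewrite <- Hm; nia).
  specialize (HL Hab).
  assert (Hside : INR b * (scale k / INR (m k)) = side k i).
  { rewrite <- Hm, mult_INR, pow_INR. change (INR 2) with 2. unfold side. field.
    split; [apply pow_nonzero; lra|apply not_0_INR; lia]. }
  eapply Rle_trans; [|apply HL].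
  - assert (HPL := param_length Mk Mk_mono k). fold m in HPL. rewrite HPL.
    rewrite Rinv_mult, Rinv_inv.
    assert (0 < 2 ^ depth Mk k) by (apply pow_lt; lra). simpl (2 ^ 8). lra.
  - cbv zeta. rewrite Hside.
    assert (E1 : INR (a * b) * (scale k / INR (m k)) = INR a * side k i).
    { rewrite mult_INR, Rmult_assoc, Hside. ring. }
    assert (E2 : INR (a * b + b) * (scale k / INR (m k)) = INR (S a) * side k i).
    { rewrite plus_INR, Rmult_plus_distr_r, E1, Hside, S_INR. ring. }
    rewrite E1, E2. pose proof (side_pos k i) as Hs. pose proof (q_INR k) as Hq1.
    split.
    + unfold angle. replace (INR u * (side k i / INR (q k))) with (INR u / INR (q k) * side k i) by (field; lra).
      assert (A1 : INR a <= INR u / INR (q k)).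
      { apply (Rle_div_r _ _ (INR (q k))); [lra|]. rewrite <- mult_INR. apply le_INR. lia. }
      assert (A2 : INR u / INR (q k) <= INR (S a)).
      { apply Rle_div_l; [lra|]. rewrite <- mult_INR. apply le_INR. lia. }
      split; apply Rplus_le_compat_l; apply Rmult_le_compat_r; lra.
    + pose proof (height_range k i v Hv).
      assert (0 < side k i / (2 * INR (q k))) by (apply Rdiv_lt_0_compat; lra). lra.
Qed.

Lemma grid_shape (k : nat) (p : C) : In p (grid k) ->
  exists x th t, In x (gen m scale k) /\
   x <= th <= x + scale k /\ scale (S k) <= t <= scale k /\ p = (RtoC (1 - t) * circ th)%C.
Proof.
  intros Hp. destruct (in_grid k p Hp) as [i [v [x [u [I ->]]]]].
  destruct I as (Hi & Hv & Hx & Hu).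
  exists x, (angle k i x u), (height k i v). split; auto. split; [|split; [|reflexivity]].
  - pose proof (angle_range k i x u Hu). pose proof (side_pos k i). pose proof (q_INR k).
    assert (0 < side k i / INR (q k)) by (apply Rdiv_lt_0_compat; lra). lra.
  - now apply height_bounds.
Qed.

End Grid.

(** * Condensation of the divergent integral *)

Lemma ln_2_lt_1 : ln 2 < 1.
Proof.
  rewrite <- (ln_exp 1). apply ln_increasing. lra. pose proof (exp_ineq1 1 ltac:(lra)). lra.
Qed.

Lemma ln_2_gt_half : 1 / 2 < ln 2.
Proof. pose proof ln_lt_2. lra. Qed.

Lemma ln_inv_scale (k : nat) : ln (1 / scale k) = 8 * 2 ^ k * ln 2.
Proof.
  unfold scale. replace (1 / / 2 ^ expo k) with (2 ^ expo k)
    by (field; apply pow_nonzero; lra).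
  rewrite ln_pow by lra. f_equal. unfold expo. rewrite pow_INR, pow_add. change (INR 2) with 2.
  simpl (2 ^ 3). ring.
Qed.

Lemma lsum_seq_S (F : nat -> R) (n : nat) : lsum F (seq 0 (S n)) = lsum F (seq 0 n) + F n.
Proof. rewrite seq_S, lsum_app. unfold lsum at 2. simpl. ring. Qed.

Section Integral.
Variables (b : R) (M : R -> R).
Hypothesis Hb : 0 <= b.
Hypothesis M_pos : forall x : R, 0 <= x < 1 -> 0 < M x.
Hypothesis M_mono : forall x y : R, 0 <= x -> x <= y -> y < 1 -> M x <= M y.
Hypothesis M_cont : forall x : R, 0 <= x < 1 ->
     filterlim M (within (fun y : R => 0 <= y < 1) (locally x)) (locally (M x)).

Let g (t : R) : R := 1 / t * Rpower (ln (1 / t)) b * / M (1 - t).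

Lemma ln_inv_pos (t : R) : 0 < t < 1 -> 0 < ln (1 / t).
Proof.
  intros Ht. rewrite <- ln_1. apply ln_increasing. lra.
  apply (Rlt_div_r _ _ t); lra.
Qed.

Lemma M_continuous (x : R) : 0 < x < 1 -> continuous M x.
Proof.
  intros Hx P HP. specialize (M_cont x ltac:(lra) P HP).
  unfold filtermap, within in *.
  assert (Hloc : locally x (fun y => 0 <= y < 1)).
  { assert (Hr : 0 < Rmin x (1 - x)) by (apply Rmin_pos; lra).
    exists (mkposreal _ Hr). intros y Hy.
    change (Rabs (y - x) < Rmin x (1 - x)) in Hy.
    pose proof (Rmin_l x (1 - x)). pose proof (Rmin_r x (1 - x)).
    apply Rabs_lt_between in Hy. lra. }
  generalize (filter_and _ _ Hloc M_cont). apply filter_imp. intros y [H1 H2]. auto.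
Qed.

Lemma g_continuous (t : R) : 0 < t < 1 -> continuous g t.
Proof.
  intros Ht. unfold g.
  apply (continuous_mult (fun t => 1 / t * Rpower (ln (1 / t)) b) (fun t => / M (1 - t))).
  - apply (@ex_derive_continuous R_AbsRing R_NormedModule). unfold Rpower. auto_derive. 
    repeat split; try lra. apply (Rlt_div_r _ _ t); lra. now apply ln_inv_pos.
  - apply continuous_comp with (f := fun t => M (1 - t)) (g := Rinv).
    + apply (continuous_comp (fun t => 1 - t) M).
      * apply (continuous_minus (fun _ => 1) (fun t => t)). apply continuous_const. apply continuous_id.
      * apply M_continuous. lra.
    + apply continuous_Rinv. apply Rgt_not_eq, M_pos. lra.
Qed.

Lemma g_ex (x y : R) : 0 < x < 1 -> 0 < y < 1 -> ex_RInt g x y.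
Proof.
  intros Hx Hy. apply (@ex_RInt_continuous R_CompleteNormedModule). intros t Ht.
  apply g_continuous. pose proof (Rmin_glb_lt x y 0 ltac:(lra) ltac:(lra)).
  pose proof (Rmax_lub_lt x y 1 ltac:(lra) ltac:(lra)). lra.
Qed.

Lemma scale_lt (k : nat) : scale (S k) < scale k.
Proof.
  unfold scale. apply Rinv_lt_contravar. apply Rmult_lt_0_compat; apply pow_lt; lra.
  apply Rlt_pow. lra. rewrite expo_S. pose proof (expo_ge k). lia.
Qed.

Let Mk (k : nat) : R := M (1 - scale (S k)).
Let C0 : R := 16 * Rpower 32 b.

Lemma RInt_inv (x y : R) : 0 < x -> x <= y -> is_RInt Rinv x y (ln y - ln x).
Proof.
  intros Hx Hy. apply (is_RInt_derive ln Rinv).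
  - intros t Ht. rewrite Rmin_left in Ht by lra. apply is_derive_ln. lra.
  - intros t Ht. rewrite Rmin_left in Ht by lra. apply continuous_Rinv. lra.
Qed.

(** On [scale (k + 2), scale (k + 1)] the logarithm is at most 32 2^k, the measure dt / t
    has mass at most 16 2^k, and M (1 - t) >= Mk k. *)
Lemma block_integral (k : nat) :
  RInt g (scale (S (S k))) (scale (S k)) <= C0 * (Rpower (2 ^ k) (1 + b) / Mk k).
Proof.
  pose proof (scale_pos (S k)) as H1. pose proof (scale_pos (S (S k))) as H2.
  pose proof (scale_lt (S k)) as H3. pose proof (scale_le (S k)) as H4.
  pose proof ln_2_lt_1. pose proof ln_2_gt_half.
  pose proof (pow2_pos k) as H2k.
  assert (HMk : 0 < Mk k) by (apply M_pos; lra).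
  set (c := Rpower (32 * 2 ^ k) b / Mk k).
  assert (Hc : 0 < c) by (apply Rdiv_lt_0_compat; auto; apply exp_pos).
  assert (Hint : is_RInt (fun t => c * / t) (scale (S (S k))) (scale (S k))
    (c * (ln (scale (S k)) - ln (scale (S (S k)))))).
  { exact (is_RInt_scal Rinv _ _ c _ (RInt_inv _ _ H2 (Rlt_le _ _ H3))). }
  apply Rle_trans with (RInt (fun t => c * / t) (scale (S (S k))) (scale (S k))).
  - apply RInt_le. lra. apply g_ex; lra. eexists; exact Hint.
    intros t Ht. unfold g, c.
    assert (Hln : 0 < ln (1 / t)) by (apply ln_inv_pos; lra).
    assert (Hlnle : ln (1 / t) <= 32 * 2 ^ k).
    { apply Rle_trans with (ln (1 / scale (S (S k)))).
      - left. apply ln_increasing. apply Rdiv_lt_0_compat; lra.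
        unfold Rdiv. rewrite !Rmult_1_l. apply Rinv_lt_contravar; nra.
      - rewrite ln_inv_scale. simpl. nra. }
    replace (Rpower (32 * 2 ^ k) b / Mk k * / t) with (/ t * Rpower (32 * 2 ^ k) b * / Mk k) by (field; lra).
    unfold Rdiv. rewrite Rmult_1_l.
    assert (Hti : 0 < / t) by (apply Rinv_0_lt_compat; lra).
    assert (HMt : Mk k <= M (1 - t)) by (apply M_mono; lra).
    apply Rmult_le_compat.
    + apply Rmult_le_pos. lra. left; apply exp_pos.
    + left. apply Rinv_0_lt_compat. lra.
    + apply Rmult_le_compat_l. lra. apply Rle_Rpower_l; auto.
      replace (/ t) with (1 / t) by (field; lra). auto.
    + apply Rinv_le_contravar; lra.
  - rewrite (is_RInt_unique _ _ _ _ Hint).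
    assert (E : ln (scale (S k)) - ln (scale (S (S k))) = 16 * 2 ^ k * ln 2).
    { pose proof (ln_inv_scale (S k)) as E1. pose proof (ln_inv_scale (S (S k))) as E2.
      unfold Rdiv in E1, E2. rewrite Rmult_1_l, ln_Rinv in E1, E2 by auto. simpl in E1, E2. lra. }
    rewrite E. unfold c, C0.
    rewrite Rpower_plus, Rpower_1 by lra.
    rewrite <- (Rpower_mult_distr 32) by lra.
    set (P := Rpower 32 b). set (Q := Rpower (2 ^ k) b).
    assert (0 < P) by apply exp_pos. assert (0 < Q) by apply exp_pos.
    replace (16 * P * (2 ^ k * Q / Mk k)) with (P * Q / Mk k * (16 * 2 ^ k * 1)) by (field; lra).
    apply Rmult_le_compat_l. left. apply Rdiv_lt_0_compat; nra. nra.
Qed.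

Lemma integral_le_sum (N : nat) : RInt g (scale (S N)) (scale 1) <=
  C0 * lsum (fun k => Rpower (2 ^ k) (1 + b) / Mk k) (seq 0 N).
Proof.
  induction N as [|N IH].
  - rewrite RInt_point. unfold zero, lsum; simpl. lra.
  - rewrite lsum_seq_S, <- (RInt_Chasles g (scale (S (S N))) (scale (S N)) (scale 1))
      by (apply g_ex; apply scale_range || auto).
    pose proof (block_integral N). unfold plus; simpl. lra.
Qed.

Lemma sum_unbounded : int0_infinite g -> forall B, exists N,
  B < lsum (fun k => Rpower (2 ^ k) (1 + b) / Mk k) (seq 0 N).
Proof.
  intros [d [Hd Hlim]] B. apply NNPP. intros Hno.
  assert (HB : forall N, lsum (fun k => Rpower (2 ^ k) (1 + b) / Mk k) (seq 0 N) <= B).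
  { intros N. apply Rnot_lt_le. intros H. apply Hno. eauto. }
  assert (HC : 0 < C0) by (apply Rmult_lt_0_compat; [lra|apply exp_pos]).
  set (K := C0 * B + RInt g (scale 1) d).
  assert (HP : Rbar_locally p_infty (fun y => K < y)) by (exists K; auto).
  specialize (Hlim _ HP). destruct Hlim as [eta Heta].
  pose proof scale_lim as Hs. apply is_lim_seq_spec in Hs. destruct (Hs eta) as [n Hn].
  specialize (Hn (S n) ltac:(lia)). rewrite Rminus_0_r in Hn.
  assert (Hgt : K < RInt g (scale (S n)) d).
  { apply Heta. change (Rabs (scale (S n) - 0) < eta). now rewrite Rminus_0_r. apply scale_pos. }
  rewrite <- (RInt_Chasles g (scale (S n)) (scale 1) d) in Hgt by (apply g_ex; apply scale_range || auto).
  pose proof (integral_le_sum n) as H1.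
  assert (C0 * lsum (fun k => Rpower (2 ^ k) (1 + b) / Mk k) (seq 0 n) <= C0 * B)
    by (apply Rmult_le_compat_l; [lra|apply HB]).
  unfold plus, K in Hgt; simpl in Hgt. lra.
Qed.

End Integral.

(** * Weights of the stages *)

Lemma lsum_eventually_le (x y : nat -> R) (k0 : nat) :
  (forall k, (k0 <= k)%nat -> x k <= y k) -> (forall k, 0 <= y k) ->
  exists K, forall N, lsum x (seq 0 N) <= K + lsum y (seq 0 N).
Proof.
  intros Hxy Hy. exists (lsum (fun k => Rabs (x k)) (seq 0 k0)). intros N.
  assert (Hy0 : 0 <= lsum y (seq 0 N)) by (apply lsum_nonneg; auto).
  destruct (Nat.le_gt_cases k0 N) as [H|H].
  - replace N with (k0 + (N - k0))%nat by lia. rewrite seq_app, !lsum_app.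
    assert (lsum x (seq 0 k0) <= lsum (fun k => Rabs (x k)) (seq 0 k0)).
    { apply lsum_le. intros k _. apply Rle_abs. }
    assert (lsum x (seq (0 + k0) (N - k0)) <= lsum y (seq (0 + k0) (N - k0))).
    { apply lsum_le. intros k Hk. apply in_seq in Hk. apply Hxy. lia. }
    assert (0 <= lsum y (seq 0 k0)) by (apply lsum_nonneg; auto). lra.
  - replace k0 with (N + (k0 - N))%nat by lia. rewrite seq_app, lsum_app.
    assert (lsum x (seq 0 N) <= lsum (fun k => Rabs (x k)) (seq 0 N)).
    { apply lsum_le. intros k _. apply Rle_abs. }
    assert (0 <= lsum (fun k => Rabs (x k)) (seq (0 + N) (k0 - N))).
    { apply lsum_nonneg. intros. apply Rabs_pos. } lra.
Qed.

Lemma lsum_half_pow (N : nat) : lsum (fun k => (/ 2) ^ k) (seq 0 N) <= 2.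
Proof.
  assert (H : lsum (fun k => (/ 2) ^ k) (seq 0 N) = 2 - 2 * (/ 2) ^ N).
  { induction N. unfold lsum; simpl; lra. rewrite lsum_seq_S, IHN. simpl. lra. }
  rewrite H. assert (0 < (/ 2) ^ N) by (apply pow_lt; lra). lra.
Qed.

Lemma nat_above (x : R) : exists n : nat, x <= INR n.
Proof.
  exists (Z.to_nat (up x)). destruct (archimed x) as [H _].
  destruct (Z.le_gt_cases 0 (up x)) as [Hz|Hz].
  - rewrite INR_IZR_INZ, Z2Nat.id by auto. lra.
  - apply IZR_lt in Hz. pose proof (pos_INR (Z.to_nat (up x))). lra.
Qed.

Lemma pow2_ge_1 (k : nat) : 1 <= 2 ^ k.
Proof. apply pow_R1_Rle. lra. Qed.

Lemma Rpower_ge_1 (x b : R) : 1 <= x -> 0 <= b -> 1 <= Rpower x b.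
Proof. intros Hx Hb. rewrite <- (Rpower_O x) by lra. now apply Rle_Rpower. Qed.

Section Sums.
Variables (b : R) (Mk : nat -> R) (M0 : R).
Hypothesis HM0 : 0 < M0.
Hypothesis HMk : forall k, M0 <= Mk k.

Definition gain (k : nat) : R := Rpower (2 ^ k) (1 + b) / 2 ^ depth Mk k.
Definition kept (k : nat) : R := if Rle_dec (Mk k) (2 ^ depth Mk k) then gain k else 0.

Lemma gain_pos (k : nat) : 0 < gain k.
Proof. apply Rdiv_lt_0_compat. apply exp_pos. apply pow_lt; lra. Qed.

Lemma kept_nonneg (k : nat) : 0 <= kept k.
Proof. unfold kept. destruct Rle_dec. left; apply gain_pos. lra. Qed.

(** A stage is lost only when the cap is reached, and then 2 ^ depth = 2 ^ (k^2) outgrows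
    every fixed power of 2 ^ k. *)
Lemma lost_bounded : exists B0, forall N, lsum gain (seq 0 N) <= B0 + lsum kept (seq 0 N).
Proof.
  destruct (nat_above (1 + b)) as [n Hn].
  destruct (lsum_eventually_le gain (fun k => kept k + (/ 2) ^ k) (S n)) as [K HK].
  - intros k Hk. unfold kept. assert (0 < (/ 2) ^ k) by (apply pow_lt; lra).
    destruct Rle_dec as [H1|H1]. lra.
    destruct (capped_log2_spec (Mk k) (k * k)) as [_ [[H2|H2] _]].
    { contradiction. }
    unfold gain. unfold depth. rewrite H2, Rplus_0_l.
    assert (Hp : Rpower (2 ^ k) (1 + b) <= 2 ^ (k * n)).
    { rewrite pow_mult, <- (Rpower_pow n (2 ^ k)) by (apply pow_lt; lra).
      apply Rle_Rpower; auto. apply pow2_ge_1. }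
    apply Rle_div_l. apply Rlt_gt, pow_lt; lra.
    eapply Rle_trans; [exact Hp|].
    replace (k * k)%nat with (k + (k * k - k))%nat by nia. rewrite pow_add, <- Rmult_assoc.
    rewrite <- Rpow_mult_distr, Rinv_l, pow1, Rmult_1_l by lra.
    apply Rle_pow. lra. pose proof (Nat.mul_le_mono_l (S n) k k Hk). rewrite Nat.mul_succ_r in H0. lia.
  - intros k. pose proof (kept_nonneg k). assert (0 < (/ 2) ^ k) by (apply pow_lt; lra). lra.
  - exists (K + 2). intros N. specialize (HK N). rewrite (lsum_plus kept (fun k => (/ 2) ^ k)) in HK.
    pose proof (lsum_half_pow N). lra.
Qed.

Lemma kept_unbounded :
  (forall B, exists N, B < lsum (fun k => Rpower (2 ^ k) (1 + b) / Mk k) (seq 0 N)) ->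
  forall B, exists N, B < lsum kept (seq 0 N).
Proof.
  intros H B. destruct lost_bounded as [B0 HB0].
  set (c := 2 + / M0). assert (Hc : 0 < / M0) by now apply Rinv_0_lt_compat.
  destruct (H (c * B + Rabs B0)) as [N HN]. exists N.
  assert (Hle : lsum (fun k => Rpower (2 ^ k) (1 + b) / Mk k) (seq 0 N) <=
     lsum (fun k => (c - 1) * kept k + gain k) (seq 0 N)).
  { apply lsum_le. intros k _. unfold kept.
    assert (HMp : 0 < Mk k) by (specialize (HMk k); lra).
    pose proof (pow2_pos (depth Mk k)) as HD.
    assert (HW : 0 < Rpower (2 ^ k) (1 + b)) by apply exp_pos.
    destruct Rle_dec as [H1|H1].
    - replace ((c - 1) * gain k + gain k) with (c * gain k) by ring. unfold gain.
      apply Rle_div_l; auto.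
      replace (c * (Rpower (2 ^ k) (1 + b) / 2 ^ depth Mk k) * Mk k) with
       (Rpower (2 ^ k) (1 + b) * (c * Mk k / 2 ^ depth Mk k)) by (field; lra).
      rewrite <- (Rmult_1_r (Rpower (2 ^ k) (1 + b))) at 1. apply Rmult_le_compat_l. lra.
      apply (Rle_div_r _ _ (2 ^ depth Mk k)); auto. rewrite Rmult_1_l.
      pose proof (capped_log2_upper (Mk k) (k * k) ltac:(lra)) as Hu. fold (depth Mk k) in Hu.
      assert (1 <= / M0 * Mk k).
      { rewrite <- (Rinv_l M0) by lra. apply Rmult_le_compat_l. lra. apply HMk. }
      unfold c. lra.
    - rewrite Rmult_0_r, Rplus_0_l. unfold gain. apply Rmult_le_compat_l. lra.
      apply Rinv_le_contravar; lra. }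
  rewrite (lsum_plus (fun k => (c - 1) * kept k) gain), lsum_scal in Hle. specialize (HB0 N).
  apply Rnot_le_lt. intros Hno. pose proof (Rle_abs B0).
  assert (c * lsum kept (seq 0 N) <= c * B) by (apply Rmult_le_compat_l; unfold c; lra).
  lra.
Qed.

End Sums.

Lemma rpow_nonneg (x y : R) : 0 <= rpow x y.
Proof. unfold rpow. destruct Rlt_dec. left; apply exp_pos. lra. Qed.

Lemma rpow_mono (x x' y : R) : 0 <= y -> x <= x' -> rpow x y <= rpow x' y.
Proof.
  intros Hy Hx. unfold rpow. destruct (Rlt_dec 0 x); destruct (Rlt_dec 0 x'); try lra.
  now apply Rle_Rpower_l. left; apply exp_pos.
Qed.

(** * The zero sets and the bounded function *)

Section Final.
Variables (s : R) (M : R -> R).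
Hypothesis hs : 0 < s.
Hypothesis M_mono : forall x y : R, 0 <= x -> x <= y -> y < 1 -> M x <= M y.

Let b : R := Defs.beta s.
Let Mk (k : nat) : R := M (1 - scale (S k)).

Lemma beta_nonneg : 0 <= Defs.beta s.
Proof. apply Rmax_l. Qed.

Lemma one_sub_scale (k : nat) : 0 <= 1 - scale k < 1.
Proof. pose proof (scale_range k). lra. Qed.

Lemma Mk_mono (k : nat) : Mk k <= Mk (S k).
Proof.
  pose proof (one_sub_scale (S k)). pose proof (one_sub_scale (S (S k))).
  pose proof (scale_lt (S k)). apply M_mono; lra.
Qed.

Lemma Mk_ge (k : nat) : M 0 <= Mk k.
Proof. pose proof (one_sub_scale (S k)). apply M_mono; lra. Qed.

(** The square root of (2^k)^beta: a dyadic square of stage k may hold about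
    (2^k)^beta points that are s-separated, hence this many per side. *)
Definition root (k : nat) : R := Rpower (2 ^ k) (Defs.beta s / 2).
Definition density (Q k : nat) : nat := (Q * Z.to_nat (up (root k)))%nat.

Lemma root_ge_1 (k : nat) : 1 <= root k.
Proof. apply Rpower_ge_1. apply pow2_ge_1. pose proof beta_nonneg. lra. Qed.

Lemma root_mono (k k' : nat) : (k <= k')%nat -> root k <= root k'.
Proof.
  intros H. apply Rle_Rpower_l. pose proof beta_nonneg. lra.
  split. apply pow_lt; lra. apply Rle_pow; lra || auto.
Qed.

Lemma density_bounds (Q k : nat) :
  INR Q * root k <= INR (density Q k) <= INR Q * (2 * root k).
Proof.
  unfold density. rewrite mult_INR. destruct (archimed (root k)) as [H1 H2].
  pose proof (root_ge_1 k). pose proof (pos_INR Q).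
  assert (E : INR (Z.to_nat (up (root k))) = IZR (up (root k))).
  { rewrite INR_IZR_INZ, Z2Nat.id; auto. apply le_IZR. lra. }
  rewrite E. split; apply Rmult_le_compat_l; lra.
Qed.

Lemma density_pos (Q k : nat) : (1 <= Q)%nat -> (1 <= density Q k)%nat.
Proof.
  intros HQ. apply INR_le. pose proof (density_bounds Q k) as [H _].
  pose proof (root_ge_1 k). apply le_INR in HQ. simpl INR in *. nra.
Qed.

Definition zeros (Q k : nat) : list C :=
  if Rle_dec (Mk k) (2 ^ depth Mk k) then grid Mk (density Q) k else [].

Definition zero_set (Q : nat) (p : C) : Prop := exists k, In p (zeros Q k).

Lemma zeros_grid (Q k : nat) (p : C) : In p (zeros Q k) -> In p (grid Mk (density Q) k).
Proof. unfold zeros. destruct Rle_dec; simpl; tauto. Qed.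

Section FixedDensity.
Variable Q : nat.
Hypothesis HQ : (1 <= Q)%nat.

Let Hq (k : nat) : (1 <= density Q k)%nat := density_pos Q k HQ.
Let Qr (k : nat) : R := INR Q * (2 * root k).

Lemma INR_Q : 1 <= INR Q.
Proof. now apply INR_ge_1. Qed.

Lemma zeros_bounds (k : nat) (p : C) : In p (zeros Q k) ->
  scale (S k) <= 1 - Cmod p <= scale k.
Proof.
  intros H. apply zeros_grid in H.
  destruct (in_grid Mk (density Q) k p H) as [i [v [x [u [I ->]]]]].
  rewrite (Cmod_grid_point Mk (density Q) Hq k i v x u I). destruct I as (Hi & Hv & _).
  pose proof (height_bounds Mk (density Q) Hq k i v Hi Hv). lra.
Qed.

Lemma zeros_disc (p : C) : zero_set Q p -> Defs.disc p.
Proof.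
  intros [k Hk]. apply zeros_bounds in Hk. pose proof (scale_pos (S k)).
  unfold Defs.disc. lra.
Qed.

Lemma zeros_dist (k k' : nat) (p p' : C) : In p (zeros Q k) -> In p' (zeros Q k') -> p <> p' ->
  (1 - Cmod p) / (4 * Qr k) + (1 - Cmod p') / (4 * Qr k') <= Cmod (p - p')%C.
Proof.
  intros H H' Hne. apply zeros_grid in H, H'.
  destruct (in_grid Mk (density Q) k p H) as [i [v [x [u [I ->]]]]].
  destruct (in_grid Mk (density Q) k' p' H') as [i' [v' [x' [u' [I' ->]]]]].
  rewrite (Cmod_grid_point Mk (density Q) Hq k i v x u I).
  rewrite (Cmod_grid_point Mk (density Q) Hq k' i' v' x' u' I').
  replace (1 - (1 - height (density Q) k i v)) with (height (density Q) k i v) by ring.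
  replace (1 - (1 - height (density Q) k' i' v')) with (height (density Q) k' i' v') by ring.
  apply (grid_separated Mk (density Q) Hq Qr); auto.
  - intros j. apply density_bounds.
  - intros j j' Hj. apply Rmult_le_compat_l. apply pos_INR. pose proof (root_mono j j' Hj). lra.
  - intros E. inversion E. subst. now apply Hne.
Qed.

Lemma NoDup_zeros (N : nat) : NoDup (flat_map (zeros Q) (seq 0 (S N))).
Proof.
  apply NoDup_flat_map. apply seq_NoDup.
  - intros k _. unfold zeros. destruct Rle_dec; [|constructor].
    apply NoDup_grid; auto.
  - intros k k' p _ _ H H'. apply zeros_grid in H, H'.
    apply (grid_disjoint Mk (density Q) Hq k k' p H H').
Qed.

Lemma rho_zeros (k : nat) (p : C) : In p (zeros Q k) ->
  exists t, rho s p = Finite t /\ 0 < t /\ 1 / (8 * INR Q) * t <= (1 - Cmod p) / (4 * Qr k).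
Proof.
  intros H. pose proof (zeros_bounds k p H) as Hp. pose proof (scale_pos (S k)).
  pose proof (scale_le k). pose proof INR_Q. pose proof (root_ge_1 k).
  unfold rho. destruct (Rle_dec s 1) as [Hs|Hs].
  - exists (1 - Cmod p). split; auto. split. lra.
    assert (E : root k = 1).
    { unfold root, Defs.beta. rewrite Rmax_left by lra. unfold Rdiv. rewrite Rmult_0_l.
      apply Rpower_O. apply pow_lt; lra. }
    unfold Qr. rewrite E. right. field. lra.
  - destruct (Req_EM_T (Cmod p) 0) as [Hz0|Hz0]; [lra|].
    exists ((1 - Cmod p) * Rpower (logd p) (- Defs.beta s / 2)). split; auto. split.
    { apply Rmult_lt_0_compat. lra. apply exp_pos. }
    assert (Hlog : 2 ^ k <= logd p).
    { unfold logd. pose proof ln_2_gt_half. pose proof (pow2_ge_1 k).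
      apply Rle_trans with (ln (1 / scale k)). rewrite ln_inv_scale. nra.
      apply ln_le. apply Rdiv_lt_0_compat. lra. apply scale_pos.
      unfold Rdiv. rewrite !Rmult_1_l. apply Rinv_le_contravar; lra. }
    assert (Hr : Rpower (logd p) (- Defs.beta s / 2) <= / root k).
    { replace (- Defs.beta s / 2) with (- (Defs.beta s / 2)) by field. rewrite Rpower_Ropp.
      apply Rinv_le_contravar. lra. apply Rle_Rpower_l. pose proof beta_nonneg. lra.
      split; auto. apply pow_lt; lra. }
    unfold Qr. replace ((1 - Cmod p) / (4 * (INR Q * (2 * root k)))) with
      (1 / (8 * INR Q) * ((1 - Cmod p) * / root k)) by (field; lra).
    apply Rmult_le_compat_l. left. apply Rdiv_lt_0_compat; lra.
    apply Rmult_le_compat_l; lra.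
Qed.

Lemma zero_set_separated : separated s (zero_set Q).
Proof.
  split. apply zeros_disc. pose proof INR_Q.
  exists (1 / (8 * INR Q)). split. apply Rdiv_lt_0_compat; lra.
  intros p p' [k Hk] [k' Hk'] Hne w [H1 H2]. unfold separation_disc in *.
  destruct (rho_zeros k p Hk) as [t [E1 [Ht B1]]]. destruct (rho_zeros k' p' Hk') as [t' [E2 [Ht' B2]]].
  rewrite E1 in H1. rewrite E2 in H2. simpl in H1, H2.
  pose proof (zeros_dist k k' p p' Hk Hk' Hne) as Hd.
  pose proof (Cmod_triangle (p - w)%C (w - p')%C) as Ht3.
  replace (p - w + (w - p'))%C with (p - p')%C in Ht3 by ring.
  rewrite (Cmod_sub_comm p w) in Ht3. lra.
Qed.

(** Near z the heights are bounded below, so only finitely many stages matter, and these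
    have a common lower bound for mutual distances. *)
Lemma zero_set_no_limit_point (z : C) : Defs.disc z -> ~ limit_point (zero_set Q) z.
Proof.
  intros Hz Hlim. unfold Defs.disc in Hz.
  set (d := (1 - Cmod z) / 2). assert (Hd : 0 < d) by (unfold d; lra).
  pose proof scale_lim as Hs. apply is_lim_seq_spec in Hs. destruct (Hs (mkposreal d Hd)) as [K HK].
  simpl in HK. pose proof INR_Q.
  assert (HQp : forall j, 0 < Qr j).
  { intros j. unfold Qr. pose proof (root_ge_1 j). apply Rmult_lt_0_compat; lra. }
  set (c := d / (4 * Qr K)).
  assert (Hc : 0 < c) by (apply Rdiv_lt_0_compat; [lra|specialize (HQp K); lra]).
  assert (Hfar : forall p p', zero_set Q p -> zero_set Q p' -> p <> p' ->
    Cmod (p - z)%C < d -> c <= Cmod (p - p')%C).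
  { intros p p' [k Hk] [k' Hk'] Hne Hp.
    pose proof (zeros_dist k k' p p' Hk Hk' Hne) as Hdist.
    pose proof (zeros_bounds k p Hk) as Hb1. pose proof (zeros_bounds k' p' Hk') as Hb2.
    pose proof (scale_pos (S k')).
    assert (Hpd : d <= 1 - Cmod p).
    { pose proof (Cmod_sub_lower p z). unfold d in *. lra. }
    assert (HkK : (k <= K)%nat).
    { destruct (Nat.le_gt_cases k K) as [|Hgt]; auto. exfalso.
      specialize (HK k ltac:(lia)). rewrite Rminus_0_r in HK. pose proof (Rle_abs (scale k)). lra. }
    assert (Hle : c <= (1 - Cmod p) / (4 * Qr k)).
    { unfold c. apply Rmult_le_compat. lra. left. apply Rinv_0_lt_compat. specialize (HQp K); lra. lra.
      apply Rinv_le_contravar. specialize (HQp k); lra. unfold Qr.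
      pose proof (root_mono k K HkK). nra. }
    assert (0 < (1 - Cmod p') / (4 * Qr k')).
    { apply Rdiv_lt_0_compat. lra. specialize (HQp k'). lra. }
    lra. }
  destruct (Hlim (Rmin d (c / 2)) ltac:(apply Rmin_pos; lra)) as [p [Hp [Hpz Hpd]]].
  assert (Hpos : 0 < Cmod (p - z)%C).
  { apply Cmod_gt_0. intros E. apply Hpz. replace p with (z + (p - z))%C by ring. rewrite E. ring. }
  destruct (Hlim (Cmod (p - z)%C) Hpos) as [p' [Hp' [_ Hpd']]].
  assert (Hne : p <> p') by (intros ->; lra).
  pose proof (Rmin_l d (c / 2)). pose proof (Rmin_r d (c / 2)).
  pose proof (Hfar p p' Hp Hp' Hne ltac:(lra)) as Hge.
  pose proof (Cmod_triangle (p - z)%C (z - p')%C) as Ht.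
  replace (p - z + (z - p'))%C with (p - p')%C in Ht by ring.
  rewrite (Cmod_sub_comm z p') in Ht. lra.
Qed.

Lemma zeros_mass (k : nat) : INR Q ^ 2 / 128 * kept b Mk k <= lsum (fun p => 1 - Cmod p) (zeros Q k).
Proof.
  unfold kept, zeros. destruct Rle_dec as [Hg|Hg].
  2:{ unfold lsum; simpl. lra. }
  eapply Rle_trans; [|apply (grid_mass Mk Mk_mono (density Q) Hq k)].
  unfold gain. pose proof (pow2_pos (depth Mk k)) as HD.
  pose proof (pow2_pos k) as H2k.
  assert (E : Rpower (2 ^ k) (1 + b) = 2 ^ k * root k ^ 2).
  { rewrite Rpower_plus, Rpower_1 by auto. f_equal. unfold root. simpl. rewrite Rmult_1_r.
    rewrite <- Rpower_plus. f_equal. unfold b. field. }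
  rewrite E.
  assert (HL : 4 * 2 ^ k <= INR (levels Mk k)).
  { pose proof (levels_ge Mk k) as H. apply le_INR in H. rewrite pow_INR, pow_add in H.
    change (INR 2) with 2 in H. simpl (2 ^ 2) in H. lra. }
  pose proof (density_bounds Q k) as [Hd _]. pose proof (root_ge_1 k). pose proof INR_Q.
  assert (Hd2 : INR Q ^ 2 * root k ^ 2 <= INR (density Q k) ^ 2).
  { rewrite <- Rpow_mult_distr. apply pow_incr. split; auto. apply Rmult_le_pos; lra. }
  replace (INR Q ^ 2 / 128 * (2 ^ k * root k ^ 2 / 2 ^ depth Mk k)) with
   ((4 * 2 ^ k) * (INR Q ^ 2 * root k ^ 2) * / (2 * (2 ^ 8 * 2 ^ depth Mk k))) by (field; lra).
  apply Rmult_le_compat_r. left. apply Rinv_0_lt_compat. simpl (2 ^ 8). lra.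
  apply Rmult_le_compat; try lra. apply Rmult_le_pos; apply pow2_ge_0.
Qed.

Lemma zeros_total_mass (N : nat) : INR Q ^ 2 / 128 * lsum (kept b Mk) (seq 0 (S N)) <=
  lsum (fun p => 1 - Cmod p) (flat_map (zeros Q) (seq 0 (S N))).
Proof.
  rewrite lsum_flat_map, <- lsum_scal. apply lsum_le. intros k _. apply zeros_mass.
Qed.

Hypothesis kept_diverges : forall B, exists N, B < lsum (kept b Mk) (seq 0 N).

Lemma log_cutoff_le (k : nat) : ln (1 / cutoff scale k) <= 64 * 2 ^ k.
Proof.
  pose proof (scale_pos (S k)). pose proof ln_2_lt_1. pose proof ln_2_gt_half. pose proof (pow2_ge_1 k).
  assert (E : 1 / cutoff scale k = 80 * ((1 / scale (S k)) * (1 / scale (S k)))).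
  { unfold cutoff. field. lra. }
  assert (Hp : 0 < 1 / scale (S k)) by (apply Rdiv_lt_0_compat; lra).
  rewrite E, !ln_mult, ln_inv_scale; try lra. 2: nra.
  assert (H80 : ln 80 <= 7 * ln 2).
  { replace 7 with (INR 7) by (simpl; lra). rewrite <- ln_pow by lra. apply ln_le; lra. }
  simpl. nra.
Qed.

(** The bound of uniqueness_bound for the cost of stage k when Phi is the growth
    allowed in A_rs r s. *)
Definition loss (r : R) (k : nat) : R :=
  25 * r * Rpower 64 s / 256 * (Rpower (2 ^ k) s / 2 ^ depth Mk k).

(** For s >= 1 costs and zero masses are the same powers of 2^k, and a large density Q
    decides. For s < 1 the costs have the smaller power (2^k)^s and are absorbed, up to a
    constant, for every density. *)
Lemma loss_dominated (r : R) : 0 < r -> s < 1 \/ 25 * r * Rpower 64 s / 256 + 1 <= INR Q ^ 2 / 512 ->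
  exists K eta, 0 <= eta /\ eta + 1 / 1024 <= INR Q ^ 2 / 512 /\
    forall N, lsum (loss r) (seq 0 N) <= K + eta * lsum (gain b Mk) (seq 0 N).
Proof.
  intros Hr Hthr. set (c := 25 * r * Rpower 64 s / 256).
  assert (Hc : 0 < c).
  { assert (0 < Rpower 64 s) by apply exp_pos. unfold c. apply Rdiv_lt_0_compat; nra. }
  assert (HD : forall k, 0 < 2 ^ depth Mk k) by (intros; apply pow_lt; lra).
  pose proof INR_Q as HQR.
  destruct (Rlt_dec s 1) as [Hs|Hs].
  - pose proof ln_2_gt_half as Hln.
    destruct (nat_above (1024 * c / ((1 - s) * ln 2))) as [k0 Hk0].
    assert (Hb0 : b = 0) by (unfold b, Defs.beta; apply Rmax_left; lra).
    destruct (lsum_eventually_le (loss r) (fun k => 1 / 1024 * gain b Mk k) k0) as [K HK].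
    + intros k Hk. unfold loss, gain. fold c. rewrite Hb0, Rplus_0_r.
      assert (Hsplit : Rpower (2 ^ k) 1 = Rpower (2 ^ k) s * Rpower (2 ^ k) (1 - s)).
      { rewrite <- Rpower_plus. f_equal. ring. }
      assert (Hbig : 1024 * c <= Rpower (2 ^ k) (1 - s)).
      { unfold Rpower. rewrite ln_pow by lra.
        apply le_INR in Hk.
        assert (H1 : 1024 * c <= INR k0 * ((1 - s) * ln 2)) by (apply Rle_div_l in Hk0; nra).
        assert (H2 : 1024 * c <= (1 - s) * (INR k * ln 2)).
        { assert (0 < (1 - s) * ln 2) by nra. nra. }
        assert (H3 : 0 < (1 - s) * (INR k * ln 2)) by lra.
        pose proof (exp_ineq1 _ (Rgt_not_eq _ _ H3)). lra. }
      rewrite Hsplit. assert (HW : 0 < Rpower (2 ^ k) s) by apply exp_pos. specialize (HD k).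
      replace (c * (Rpower (2 ^ k) s / 2 ^ depth Mk k)) with
        (Rpower (2 ^ k) s / 2 ^ depth Mk k * c) by ring.
      replace (1 / 1024 * (Rpower (2 ^ k) s * Rpower (2 ^ k) (1 - s) / 2 ^ depth Mk k)) with
        (Rpower (2 ^ k) s / 2 ^ depth Mk k * (1 / 1024 * Rpower (2 ^ k) (1 - s))) by (field; lra).
      apply Rmult_le_compat_l; [|lra]. left. now apply Rdiv_lt_0_compat.
    + intros k. pose proof (gain_pos b Mk k). lra.
    + exists K, (1 / 1024). split; [lra|]. split; [nra|]. intros N. rewrite <- lsum_scal. apply HK.
  - destruct Hthr as [|Hthr]; [contradiction|]. fold c in Hthr.
    exists 0, c. split; [lra|]. split; [lra|]. intros N. rewrite Rplus_0_l, <- lsum_scal.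
    apply lsum_le. intros k _. unfold loss, gain. fold c.
    replace (1 + b) with s; [lra|]. unfold b, Defs.beta. rewrite Rmax_right; lra.
Qed.

(** The exponent in uniqueness_bound tends to -oo with N along a subsequence, because the
    mass of the zeros diverges and dominates the costs. So f vanishes for |a| < 1/4. *)
Lemma zero_set_uniqueness (r : R) (f : C -> C) : 0 < r ->
  s < 1 \/ 25 * r * Rpower 64 s / 256 + 1 <= INR Q ^ 2 / 512 ->
  A_rs r s f -> (forall z, zero_set Q z -> f z = RtoC 0) -> zero_on_disc f.
Proof.
  intros Hr Hthr [Hol [c Hc]] Hzero.
  assert (Hf : forall z, Defs.disc z -> cdiff f z).
  { intros z Hz. apply ex_derive_cdiff. now apply Hol. }
  apply (identity_theorem f (1 / 4)); auto. lra.
  intros a Ha. apply NNPP. intros Hne. apply Cmod_gt_0 in Hne.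
  set (Phi := fun t => r * rpow (ln (1 / t)) s).
  assert (HPhi0 : forall t, 0 <= Phi t).
  { intros t. apply Rmult_le_pos; [lra|apply rpow_nonneg]. }
  assert (HPhim : forall t t', 0 < t -> t <= t' -> Phi t' <= Phi t).
  { intros t t' Ht Htt. apply Rmult_le_compat_l; [lra|]. apply rpow_mono; [lra|].
    apply ln_le. apply Rdiv_lt_0_compat; lra. unfold Rdiv. rewrite !Rmult_1_l.
    apply Rinv_le_contravar; lra. }
  assert (Hfb : forall z, Defs.disc z -> Cmod (f z) <= exp (Phi (1 - Cmod z) + c)).
  { intros z Hz. specialize (Hc z Hz). unfold log in Hc.
    destruct (Rlt_dec 0 (Cmod (f z))) as [Hp|Hp].
    - simpl in Hc. rewrite <- (exp_ln (Cmod (f z))) by auto. apply exp_le. exact Hc.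
    - pose proof (exp_pos (Phi (1 - Cmod z) + c)). lra. }
  pose proof (param_tree Mk) as HT.
  assert (Hbound := uniqueness_bound (branch Mk) scale HT (zeros Q)
    (fun k p Hp => grid_shape Mk (density Q) Hq k p (zeros_grid Q k p Hp))
    NoDup_zeros Phi f c (fun t _ => HPhi0 t) (fun t t' Ht Htt _ => HPhim t t' Ht Htt) Hf Hfb
    (fun k p Hp => Hzero p (ex_intro _ k Hp))).
  destruct (loss_dominated r Hr Hthr) as [K [eta [Heta [HetaQ HK]]]].
  destruct (lost_bounded b Mk) as [B0 HB0].
  set (A := fun N => lsum (kept b Mk) (seq 0 N)) in *.
  set (T := c + Phi (cutoff scale 0) + K + eta * B0).
  destruct (kept_diverges (Rabs (1024 * (T - ln (Cmod (f a)))))) as [N HN].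
  destruct N as [|N].
  { unfold lsum in HN. simpl in HN. pose proof (Rabs_pos (1024 * (T - ln (Cmod (f a))))). lra. }
  fold (A (S N)) in HN. pose proof (Rle_abs (1024 * (T - ln (Cmod (f a))))) as Habs.
  specialize (Hbound N a ltac:(lra)).
  pose proof (zeros_total_mass N) as HV. fold (A (S N)) in HV.
  set (V := lsum (fun p => 1 - Cmod p) (flat_map (zeros Q) (seq 0 (S N)))) in *.
  set (E := lsum (fun k => 25 * Phi (cutoff scale k) *
     (INR (length (gen (branch Mk) scale k)) * scale k)) (seq 1 N)) in *.
  assert (HE : E <= lsum (loss r) (seq 0 (S N))).
  { assert (Hloss : forall k, 0 <= loss r k).
    { intros k. unfold loss. assert (0 < Rpower 64 s) by apply exp_pos.
      apply Rmult_le_pos. apply Rmult_le_pos; [|lra]. apply Rmult_le_pos; lra.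
      left. apply Rdiv_lt_0_compat. apply exp_pos. apply pow_lt; lra. }
    change (seq 0 (S N)) with (0%nat :: seq 1 N).
    change (lsum (loss r) (0%nat :: seq 1 N)) with (loss r 0%nat + lsum (loss r) (seq 1 N)).
    apply Rle_trans with (lsum (loss r) (seq 1 N)); [|specialize (Hloss 0%nat); lra].
    apply lsum_le. intros k _. rewrite (param_length Mk Mk_mono k).
    assert (HP : Phi (cutoff scale k) <= r * (Rpower 64 s * Rpower (2 ^ k) s)).
    { apply Rmult_le_compat_l; [lra|]. rewrite Rpower_mult_distr; [|lra|apply pow_lt; lra].
      eapply Rle_trans; [apply rpow_mono; [lra|apply log_cutoff_le]|].
      unfold rpow. pose proof (pow2_pos k).
      destruct (Rlt_dec 0 (64 * 2 ^ k)); lra. }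
    unfold loss. pose proof (pow2_pos (depth Mk k)) as HD.
    replace (25 * r * Rpower 64 s / 256 * (Rpower (2 ^ k) s / 2 ^ depth Mk k)) with
     (25 * (r * (Rpower 64 s * Rpower (2 ^ k) s)) * / (2 ^ 8 * 2 ^ depth Mk k)) by (field; lra).
    apply Rmult_le_compat_r. left. apply Rinv_0_lt_compat. simpl (2 ^ 8); lra. lra. }
  specialize (HK (S N)). specialize (HB0 (S N)). fold (A (S N)) in HB0.
  assert (eta * lsum (gain b Mk) (seq 0 (S N)) <= eta * (B0 + A (S N))) by now apply Rmult_le_compat_l.
  assert (HA0 : 0 <= A (S N)) by (apply lsum_nonneg; intros; apply kept_nonneg).
  assert (Hexp : c + Phi (cutoff scale 0) - 1 / 4 * V + E < ln (Cmod (f a))).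
  { assert ((eta + 1 / 1024) * A (S N) <= INR Q ^ 2 / 512 * A (S N)) by now apply Rmult_le_compat_r.
    unfold T in *. lra. }
  apply exp_increasing in Hexp. rewrite exp_ln in Hexp by auto. lra.
Qed.

Lemma zero_set_uniqueness_set (r : R) : 0 < r ->
  s < 1 \/ 25 * r * Rpower 64 s / 256 + 1 <= INR Q ^ 2 / 512 ->
  uniqueness_set (A_rs r s) (zero_set Q).
Proof.
  intros Hr Hthr. split; [apply zeros_disc|]. split; [apply zero_set_no_limit_point|].
  intros f Hf Hz. now apply (zero_set_uniqueness r).
Qed.

End FixedDensity.
(** The modulus is exp of minus the Poisson integral of the limit measure. *)
Definition small_function (z : C) : C := Cexp (- herglotz_mean (branch Mk) scale z)%C.

Lemma Cmod_small_function (z : C) : Cmod (small_function z) = exp (- fst (herglotz_mean (branch Mk) scale z)).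
Proof. unfold small_function. rewrite Cmod_Cexp. reflexivity. Qed.

Lemma small_function_Hinf : Hinf small_function.
Proof.
  split.
  - intros z Hz. apply cdiff_ex_derive. unfold small_function. apply (cdiff_comp Cexp).
    + apply cdiff_opp, cdiff_herglotz_mean. apply param_tree. apply scale_lim. exact Hz.
    + apply cdiff_Cexp.
  - exists 1. intros z Hz. rewrite Cmod_small_function, <- exp_0. apply exp_le.
    pose proof (herglotz_mean_pos _ _ (param_tree Mk) scale_lim z Hz). lra.
Qed.

Lemma small_function_nonzero : ~ zero_on_disc small_function.
Proof.
  intros H. apply (Cexp_neq_0 (- herglotz_mean (branch Mk) scale 0)%C). apply H.
  unfold Defs.disc. rewrite Cmod_0. lra.
Qed.

Lemma small_function_on_zero_set (Q : nat) (p : C) : (1 <= Q)%nat -> zero_set Q p ->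
  Rbar_le (log (Cmod (small_function p))) (Finite (- M (Cmod p))).
Proof.
  intros HQ [k Hk]. rewrite Cmod_small_function. unfold log.
  destruct (Rlt_dec 0 _) as [Hp|Hp]; [|exfalso; apply Hp, exp_pos].
  rewrite ln_exp. unfold Rbar_le. apply Ropp_le_contravar.
  pose proof (zeros_bounds Q HQ k p Hk) as Hb.
  unfold zeros in Hk. destruct Rle_dec as [Hg|Hg] in Hk; [|contradiction].
  pose proof (herglotz_mean_grid Mk Mk_mono _ (fun j => density_pos Q j HQ) k p Hk) as HL.
  assert (M (Cmod p) <= Mk k).
  { apply M_mono. apply Cmod_ge_0. lra. pose proof (one_sub_scale (S k)). lra. }
  lra.
Qed.

End Final.

Theorem theorem2p2 (s : R) (hs : 0 < s) (M : R -> R)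
  (M_pos : forall x : R, 0 <= x < 1 -> 0 < M x)
  (M_mono : forall x y : R, 0 <= x -> x <= y -> y < 1 -> M x <= M y)
  (M_cont : forall x : R, 0 <= x < 1 ->
     filterlim M (within (fun y : R => 0 <= y < 1) (locally x)) (locally (M x)))
  (M_int : int0_infinite
     (fun t : R => 1 / t * Rpower (ln (1 / t)) (beta s) * / M (1 - t))) :
  exists (E : C -> Prop) (f : C -> C),
    SU s E /\ Hinf f /\ ~ zero_on_disc f /\
    forall a : C, E a ->
      Rbar_le (log (Cmod (f a))) (Finite (- M (Cmod a))).
Proof.
  assert (Hdiv : forall B, exists N, B < lsum (kept (beta s) (fun k => M (1 - scale (S k)))) (seq 0 N)).
  { apply (kept_unbounded (beta s) _ (M 0)).
    - apply M_pos. lra.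
    - apply Mk_ge; auto.
    - apply sum_unbounded; auto. apply beta_nonneg. }
  destruct (Rlt_dec s 1) as [Hs|Hs].
  - exists (zero_set s M 1), (small_function M).
    split; [|split; [now apply small_function_Hinf|split; [now apply small_function_nonzero|]]].
    + unfold SU. destruct (Rlt_dec s 1) as [Hs1|Hs1]; [|contradiction]. split.
      * apply zero_set_separated; auto.
      * split; [apply zeros_disc; auto|]. split; [apply zero_set_no_limit_point; auto|].
        intros f [r [Hr Hf]] Hz. apply (zero_set_uniqueness s M hs M_mono 1) with (r := r); auto.
    + intros a Ha. apply (small_function_on_zero_set s M) with (Q := 1%nat); auto.
  - exists (fun p => exists Q, (1 <= Q)%nat /\ zero_set s M Q p), (small_function M).
    split; [|split; [now apply small_function_Hinf|split; [now apply small_function_nonzero|]]].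
    + unfold SU. destruct (Rlt_dec s 1) as [Hs1|Hs1]; [contradiction|]. split.
      * intros z [Q [HQ Hz]]. revert Hz. apply zeros_disc; auto.
      * intros r Hr.
        destruct (nat_above (512 * (25 * r * Rpower 64 s / 256 + 1))) as [Q0 HQ0].
        exists (zero_set s M (S Q0)). split; [|split].
        -- intros z Hz. exists (S Q0). split; [lia|auto].
        -- apply zero_set_separated; auto. lia.
        -- apply zero_set_uniqueness_set; auto. lia. right. rewrite S_INR.
           pose proof (pos_INR Q0). nra.
    + intros a [Q [HQ Ha]]. apply (small_function_on_zero_set s M) with (Q := Q); auto.
Qed.
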